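(* Let $G\rightrightarrows M$ and $K\rightrightarrows M$ be Lie groupoids, let $\Phi\colon K\to G$ be a Lie groupoid morphism over the identity of $M$, and let $\Lambda$ be the comma double Lie groupoid of $\Phi$. Let $W_\bullet\Lambda$ be the simplicial manifold obtained from $(\Lambda, G, K, M)$ by the bar construction. Then for every $r>0$ the $r$-th layer $W_r\Lambda$ is given by \[ \left\{\left. \begin{pmatrix} g_1 & g_2 & \dots & g_{r-1} & g_r \\ k_{1,1} & k_{1,2} & \dots & k_{1,r-1} & k_{1,r} \\ & k_{2,2} & \dots & k_{2,r-1} & k_{2,r} \\ & & \ddots & \vdots & \vdots \\ & & & k_{r-1, r-1} & k_{r-1,r}\\ & & & & k_{r,r} \end{pmatrix}\in G^{(r)} \times K^{(1)} \times K^{(2)}\times\dots \times K^{(r)}\ \right|\ t(k_{1,j}) = s(g_j)\ \ \forall\, 1 \leq j \leq r \right\} \] as a subset of $G^{(r)} \times K^{(1)} \times K^{(2)}\times\dots \times K^{(r)}$, where the factor $K^{(j)}$ corresponds to the $j$-th column $(k_{1,j},\dots,k_{j,j})$. Moreover $W_r\Lambda$ is (in this description) an embedded submanifold of $G^{(r)} \times K^{(1)} \times K^{(2)}\times\dots \times K^{(r)}$.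
   Context: For a Lie groupoid $G\rightrightarrows M$ with source $s$ and target $t$, $G^{(r)}$ denotes the manifold of composable $r$-tuples $(g_1,\dots,g_r)$, $s(g_j)=t(g_{j+1})$ (and $G^{(1)}=G$). A double Lie groupoid $(\Gamma,G,H,M)$ consists of Lie groupoids $G\rightrightarrows M$, $H\rightrightarrows M$ and two Lie groupoid structures $\Gamma\rightrightarrows G$ (source $s_G$, target $t_G$) and $\Gamma\rightrightarrows H$ (source $s_H$, target $t_H$) on $\Gamma$, such that the structure maps of each structure on $\Gamma$ are groupoid morphisms with respect to the other, and $(s_G,s_H)\colon\Gamma\to\{(g,h)\in G\times H\mid s(g)=s(h)\}$ is a surjective submersion. An element $\gamma$ is pictured as a square with top edge $t_G(\gamma)$, bottom edge $s_G(\gamma)$, left edge $t_H(\gamma)$, right edge $s_H(\gamma)$. Bar construction, layers: $W_0\Gamma=M$; $W_1\Gamma=\{(g,h)\in G\times H\mid s(g)=t(h)\}$; for $r\ge2$, $W_r\Gamma$ is the set of $(g,(\gamma_{i,j})_{1\le i\le j<r},h)\in G\times\Gamma^{r(r-1)/2}\times H$ with $s(g)=t(t_G(\gamma_{1,1}))$; $s_H(\gamma_{i,j})=t_H(\gamma_{i,j+1})$ for $1\le i\le j<r-1$; $s_G(\gamma_{i,j})=t_G(\gamma_{i+1,j})$ for $1\le i<j<r$; $t(h)=s(s_H(\gamma_{r-1,r-1}))$; with the submanifold structure from the product. Comma double Lie groupoid. Given $\Phi\colon K\to G$, $\Lambda$ is the set of triples $(k_t,g,k_s)\in K\times G\times K$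 with $s(k_t)=t(g)$, $s(k_s)=s(g)$. It is a double Lie groupoid with sides $G$ and $H:=K$: over $G$, $s_G(k_t,g,k_s)=g$, $t_G(k_t,g,k_s)=\Phi(k_t)\,g\,\Phi(k_s)^{-1}$, and $(k_t',\Phi(k_t)g\Phi(k_s)^{-1},k_s')\cdot_G(k_t,g,k_s)=(k_t'k_t,g,k_s'k_s)$; over $K$, $s_K(k_t,g,k_s)=k_s$, $t_K(k_t,g,k_s)=k_t$, and $(k_3,g',k_2)\cdot_K(k_2,g,k_1)=(k_3,g'g,k_1)$. Thus an element of $\Lambda$ is uniquely determined by its left edge $k_t$, right edge $k_s$ and top edge $g^{\mathrm{top}}$ (any elements with $t(g^{\mathrm{top}})=t(k_t)$, $s(g^{\mathrm{top}})=t(k_s)$), its bottom edge then being $\Phi(k_t)^{-1}g^{\mathrm{top}}\Phi(k_s)$. Meaning of ``is given by'': a matrix as in the claim represents the element $(g_1,(\lambda_{i,j})_{1\le i\le j<r},k_{r,r})$ of $W_r\Lambda$, where $\lambda_{i,j}\in\Lambda$ is the square with left edge $k_{i,j}$, right edge $k_{i,j+1}$ and top edge \[\Big(\prod_{l=1}^{i-1}\Phi(k_{l,j})\Big)^{-1}\cdot g_{j+1}\cdot\Big(\prod_{l=1}^{i-1}\Phi(k_{l,j+1})\Big)\] (products ordered from left to right by increasing $l$; for $i=1$ the top edge is $g_{j+1}$). The assertion is that this identifies the set of matrices, as a manifold, with $W_r\Lambda$. *)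

(* Defs.v *)
From HB Require Import structures.
From mathcomp Require Import all_boot all_order all_algebra.
From mathcomp Require Import all_classical all_reals all_analysis.

Set Implicit Arguments.
Unset Strict Implicit.
Unset Printing Implicit Defensive.

Import Order.TTheory GRing.Theory Num.Theory.
Import numFieldNormedType.Exports.
Local Open Scope classical_set_scope.
Local Open Scope ring_scope.

(* f is of class C^k at every point of the open set U; the clause k.+1 asks
   for differentiability and for every directional derivative to be C^k. *)
Fixpoint class_C (R : realType) (k m n : nat) (U : set 'rV[R]_m)
    (f : 'rV[R]_m -> 'rV[R]_n) : Prop :=
  match k with
  | 0 => forall x, U x -> {for x, continuous f}
  | k'.+1 => (forall x, U x -> differentiable f x) /\
             (forall v, class_C k' U (fun x => 'd f x v))
  end.

Definition smooth_on (R : realType) (m n : nat) (U : set 'rV[R]_m)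
    (f : 'rV[R]_m -> 'rV[R]_n) : Prop := forall k, class_C k U f.

(* chart_map is relevant only on chart_dom. *)
Record chart (R : realType) (T : Type) := Chart {
  chart_dim : nat;
  chart_dom : set T;
  chart_map : T -> 'rV[R]_chart_dim }.

(* A homeomorphism from an open set onto an open subset of R^n, expressed as
   an injective, continuous and open map. *)
Definition is_chart (R : realType) (T : topologicalType) (c : chart R T) :=
  [/\ open (chart_dom c),
      {in chart_dom c &, injective (chart_map c)},
      forall x, chart_dom c x -> {for x, continuous (chart_map c)} &
      forall V : set T, open V -> V `<=` chart_dom c ->
        open (chart_map c @` V)].

(* The transition map c' o c^-1 is smooth on c(dom c `&` dom c'). *)
Definition smooth_transition (R : realType) (T : Type) (c c' : chart R T) :=
  exists f : 'rV[R]_(chart_dim c) -> 'rV[R]_(chart_dim c'),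
    smooth_on (chart_map c @` (chart_dom c `&` chart_dom c')) f /\
    (forall x, chart_dom c x -> chart_dom c' x ->
      f (chart_map c x) = chart_map c' x).

(* The data of a manifold; the axioms are in [manifold] below. Keeping them
   apart lets products and subsets carry charts without side conditions. *)
Record premanifold (R : realType) := PreManifold {
  space :> topologicalType;
  atlas : set (chart R space) }.

(* Second countable Hausdorff, with a smooth atlas of constant dimension.
   Charts with empty domain are harmless and their dimension is ignored. *)
Record manifold (R : realType) (N : premanifold R) : Prop := {
  manifold_hausdorff : hausdorff_space N;
  manifold_second_countable : @second_countable N;
  manifold_cover : forall x : N, exists2 c, atlas c & chart_dom c x;
  manifold_chart : forall c : chart R N, atlas c -> is_chart c;
  manifold_compat : forall c c' : chart R N,
    atlas c -> atlas c' -> smooth_transition c c';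
  manifold_dim : exists n, forall c : chart R N,
    atlas c -> chart_dom c !=set0 -> chart_dim c = n }.

Definition maximal_atlas (R : realType) (N : premanifold R) :
    set (chart R N) :=
  [set c | is_chart c /\ forall c', atlas c' ->
             smooth_transition c c' /\ smooth_transition c' c].

(* F maps dom c into dom c', and f is c' o F o c^-1, smooth on c(dom c). *)
Definition local_representative (R : realType) (N N' : premanifold R)
    (F : N -> N') (c : chart R N) (c' : chart R N')
    (f : 'rV[R]_(chart_dim c) -> 'rV[R]_(chart_dim c')) : Prop :=
  [/\ maximal_atlas c, maximal_atlas c',
      forall x, chart_dom c x -> chart_dom c' (F x),
      forall x, chart_dom c x -> f (chart_map c x) = chart_map c' (F x) &
      smooth_on (chart_map c @` chart_dom c) f].

Definition smooth_map (R : realType) (N N' : premanifold R) (F : N -> N') :=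
  forall x, exists c c' f,
    @local_representative R N N' F c c' f /\ chart_dom c x.

Definition submersion (R : realType) (N N' : premanifold R) (F : N -> N') :=
  forall x, exists c c' f,
    [/\ @local_representative R N N' F c c' f, chart_dom c x &
        forall w, exists v, 'd f (chart_map c x) v = w].

Definition diffeomorphism (R : realType) (N N' : premanifold R)
    (F : N -> N') : Prop :=
  smooth_map F /\
  exists F' : N' -> N, [/\ smooth_map F', cancel F F' & cancel F' F].

Definition prod_chart (R : realType) (T T' : Type)
    (c : chart R T) (c' : chart R T') : chart R (T * T') :=
  Chart (chart_dom c `*` chart_dom c')
        (fun x => row_mx (chart_map c x.1) (chart_map c' x.2)).

Definition prod_space (R : realType) (N N' : premanifold R) : premanifold R :=
  @PreManifold R (N * N')%type
    [set prod_chart c c' | c in @atlas R N & c' in @atlas R N'].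

Definition pi_chart (R : realType) (n : nat) (T : 'I_n -> Type)
    (c : forall i, chart R (T i)) : chart R (forall i, T i) :=
  Chart [set x | forall i, chart_dom (c i) (x i)]
        (fun x => \mxrow_(i < n) chart_map (c i) (x i)).

Definition pi_space (R : realType) (n : nat) (N : 'I_n -> premanifold R) :
    premanifold R :=
  @PreManifold R (prod_topology (fun i => N i))
    [set pi_chart c | c in [set c | forall i, @atlas R (N i) (c i)]].

(* In the chart c, A is the slice where all but the first k coordinates
   vanish. *)
Definition slice_chart (R : realType) (N : premanifold R) (A : set N)
    (k : nat) (c : chart R N) : Prop :=
  [/\ maximal_atlas c, (k <= chart_dim c)%N &
      forall x, chart_dom c x ->
        (A x <-> forall i : 'I_(chart_dim c), (k <= i)%N ->
                   chart_map c x ord0 i = 0)].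

Definition embedded_submanifold (R : realType) (N : premanifold R)
    (A : set N) : Prop :=
  manifold N /\
  exists k, forall x, A x -> exists2 c, slice_chart A k c & chart_dom c x.

(* The restriction of c to A, keeping the first k coordinates. *)
Definition restrict_chart (R : realType) (T : Type) (A : set T) (k : nat)
    (c : chart R T) : chart R (set_type A) :=
  Chart [set x : set_type A | chart_dom c (val x)]
        (fun x => chart_map c (val x) *m pid_mx k : 'rV[R]_k).

(* A with the subspace topology and the restrictions of its slice charts. *)
Definition sub_space (R : realType) (N : premanifold R) (A : set N) :
    premanifold R :=
  @PreManifold R (set_type A)
    [set d | exists k c, slice_chart A k c /\ d = restrict_chart A k c].

(* [gmul A g h] is the product g h, meaningful only if src g = tgt h. *)
Record groupoid (G M : Type) := Groupoid {
  src : G -> M;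
  tgt : G -> M;
  gmul : G -> G -> G;
  gunit : M -> G;
  ginv : G -> G;
  src_unit : forall x, src (gunit x) = x;
  tgt_unit : forall x, tgt (gunit x) = x;
  src_mul : forall g h, src g = tgt h -> src (gmul g h) = src h;
  tgt_mul : forall g h, src g = tgt h -> tgt (gmul g h) = tgt g;
  gmulA : forall g h k, src g = tgt h -> src h = tgt k ->
    gmul g (gmul h k) = gmul (gmul g h) k;
  gmul1g : forall g, gmul (gunit (tgt g)) g = g;
  gmulg1 : forall g, gmul g (gunit (src g)) = g;
  src_inv : forall g, src (ginv g) = tgt g;
  tgt_inv : forall g, tgt (ginv g) = src g;
  gmulVg : forall g, gmul (ginv g) g = gunit (src g);
  gmulgV : forall g, gmul g (ginv g) = gunit (tgt g) }.

Record lie_groupoid (R : realType) (G M : premanifold R)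
    (A : groupoid G M) : Prop := {
  lie_obj : manifold M;
  lie_arr : manifold G;
  lie_src : submersion (src A);
  lie_tgt : submersion (tgt A);
  lie_mul : @smooth_map R
    (@sub_space R (prod_space G G) [set p | src A p.1 = tgt A p.2]) G
    (fun p => gmul A (val p).1 (val p).2);
  lie_unit : smooth_map (gunit A);
  lie_inv : smooth_map (ginv A) }.

Record groupoid_functor (G M G' M' : Type) (A : groupoid G M)
    (A' : groupoid G' M') (F : G -> G') (f : M -> M') : Prop := {
  functor_src : forall g, src A' (F g) = f (src A g);
  functor_tgt : forall g, tgt A' (F g) = f (tgt A g);
  functor_unit : forall x, F (gunit A x) = gunit A' (f x);
  functor_mul : forall g h, src A g = tgt A h ->
    F (gmul A g h) = gmul A' (F g) (F h) }.

Record groupoid_morphism (K G M : Type) (B : groupoid K M)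
    (A : groupoid G M) := GroupoidMorphism {
  mor_fun :> K -> G;
  mor_functor : groupoid_functor B A mor_fun id }.

(* G^(r), the composable r-tuples, for r > 0. *)
Definition composable_space (R : realType) (G M : premanifold R)
    (A : groupoid G M) (r : nat) : premanifold R :=
  @sub_space R (pi_space (fun _ : 'I_r => G))
    [set g | forall i j : 'I_r, j = i.+1 :> nat ->
               src A (g i) = tgt A (g j)].

Record double_groupoid (Gam G H M : Type) := DoubleGroupoid {
  sideG : groupoid G M;
  sideH : groupoid H M;
  overG : groupoid Gam G;
  overH : groupoid Gam H;
  dsrcG : groupoid_functor overH sideG (src overG) (src sideH);
  dtgtG : groupoid_functor overH sideG (tgt overG) (tgt sideH);
  dunitG : groupoid_functor sideG overH (gunit overG) (gunit sideH);
  dinvG : groupoid_functor overH overH (ginv overG) (ginv sideH);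
  dsrcH : groupoid_functor overG sideH (src overH) (src sideG);
  dtgtH : groupoid_functor overG sideH (tgt overH) (tgt sideG);
  dunitH : groupoid_functor sideH overG (gunit overH) (gunit sideG);
  dinvH : groupoid_functor overG overG (ginv overH) (ginv sideG);
  interchange : forall a b c d,
    src overG a = tgt overG b -> src overG c = tgt overG d ->
    src overH a = tgt overH c -> src overH b = tgt overH d ->
    gmul overH (gmul overG a b) (gmul overG c d) =
    gmul overG (gmul overH a c) (gmul overH b d) }.

(* Triangular arrays (x_(i,j)), 1 <= i <= j <= n, stored by columns: with
   indices starting from 0, x j i is the entry in row i of column j. *)
Definition triangle (R : realType) (n : nat) (N : premanifold R) :
    premanifold R :=
  pi_space (fun j : 'I_n => pi_space (fun _ : 'I_j.+1 => N)).

Definition bar_ambient (R : realType) (Gam G H M : premanifold R) (r : nat) :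
    premanifold R :=
  match r with
  | 0 => M
  | 1 => prod_space G H
  | n.+2 => prod_space (prod_space G (triangle n.+1 Gam)) H
  end.

Definition bar_set (R : realType) (Gam G H M : premanifold R)
    (D : double_groupoid Gam G H M) (r : nat) : set (bar_ambient Gam G H M r) :=
  match r with
  | 0 => setT
  | 1 => [set w : prod_space G H | src (sideG D) w.1 = tgt (sideH D) w.2]
  | n.+2 =>
    [set w : prod_space (prod_space G (triangle n.+1 Gam)) H |
     let g := w.1.1 in
     let gam (i j : nat) : Gam := w.1.2 (inord j) (inord i) in
     let h := w.2 in
     [/\ src (sideG D) g = tgt (sideG D) (tgt (overG D) (gam 0%N 0%N)),
         forall i j, (i <= j)%N -> (j < n)%N ->
           src (overH D) (gam i j) = tgt (overH D) (gam i j.+1),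
         forall i j, (i < j)%N -> (j <= n)%N ->
           src (overG D) (gam i j) = tgt (overG D) (gam i.+1 j) &
         tgt (sideH D) h = src (sideH D) (src (overH D) (gam n n))]]
  end.

Arguments bar_set {R Gam G H M} D r.

Definition bar (R : realType) (Gam G H M : premanifold R)
    (D : double_groupoid Gam G H M) (r : nat) : premanifold R :=
  sub_space (bar_set D r).

Section GroupoidTheory.
Context {G M : Type} {A : groupoid G M}.
Local Notation s := (src A).
Local Notation t := (tgt A).
Local Notation "g ** h" := (gmul A g h) (at level 40, left associativity).
Local Notation inv := (ginv A).

Lemma gmulKg g h : s g = t h -> inv g ** (g ** h) = h.
Proof.
by move=> gh; rewrite gmulA ?src_inv// gmulVg gh gmul1g.
Qed.

Lemma gmulVKg g h : t g = t h -> g ** (inv g ** h) = h.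
Proof.
by move=> gh; rewrite gmulA ?tgt_inv ?src_inv// gmulgV gh gmul1g.
Qed.

Lemma gmulgI g h h' : s g = t h -> s g = t h' -> g ** h = g ** h' -> h = h'.
Proof. by move=> gh gh' e; rewrite -(gmulKg gh) e gmulKg. Qed.

Lemma ginv_uniq g h : s g = t h -> g ** h = gunit A (t g) -> h = inv g.
Proof.
move=> gh e; apply: (@gmulgI g) => //; first by rewrite tgt_inv.
by rewrite gmulgV.
Qed.

Lemma gmulgK g h : s g = t h -> g ** h ** inv h = g.
Proof. by move=> gh; rewrite -gmulA ?tgt_inv// gmulgV -gh gmulg1. Qed.

Lemma gmulgVK g h : s g = s h -> g ** inv h ** h = g.
Proof.
by move=> gh; rewrite -gmulA ?tgt_inv ?src_inv// gmulVg -gh gmulg1.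
Qed.

Lemma ginvK g : inv (inv g) = g.
Proof.
by symmetry; apply: ginv_uniq; rewrite ?src_inv// gmulVg tgt_inv.
Qed.

Lemma ginv_unit x : inv (gunit A x) = gunit A x.
Proof.
symmetry; apply: ginv_uniq; rewrite ?src_unit ?tgt_unit//.
by rewrite -[X in _ ** gunit A X](@src_unit _ _ A x) gmulg1.
Qed.

Lemma ginvM g h : s g = t h -> inv (g ** h) = inv h ** inv g.
Proof.
move=> gh; have hg : s (inv h) = t (inv g) by rewrite src_inv tgt_inv.
symmetry; apply: ginv_uniq; first by rewrite src_mul// tgt_mul// tgt_inv.
have e : h ** (inv h ** inv g) = inv g by rewrite gmulVKg// tgt_inv.
rewrite -(gmulA gh) ?e ?gmulgV ?tgt_mul//.
by rewrite tgt_inv.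
Qed.

End GroupoidTheory.

Lemma functor_inv (G M G' M' : Type) (A : groupoid G M)
    (A' : groupoid G' M') (F : G -> G') (f : M -> M') :
  groupoid_functor A A' F f -> forall g, F (ginv A g) = ginv A' (F g).
Proof.
move=> [Fs Ft F1 FM] g; apply: ginv_uniq; first by rewrite Fs Ft tgt_inv.
by rewrite -FM ?tgt_inv// gmulgV F1 Ft.
Qed.

Definition comma_set (R : realType) (K G M : premanifold R)
    (B : groupoid K M) (A : groupoid G M) :
    set (prod_space (prod_space K G) K) :=
  [set p | src B p.1.1 = tgt A p.1.2 /\ src B p.2 = src A p.1.2].

Definition comma_space (R : realType) (K G M : premanifold R)
    (B : groupoid K M) (A : groupoid G M) : premanifold R :=
  sub_space (comma_set B A).

Section Comma.
Context {R : realType} {K G M : premanifold R}.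
Context {B : groupoid K M} {A : groupoid G M} (Phi : groupoid_morphism B A).
Local Notation Lam := (comma_space B A).
Local Notation "g ** h" := (gmul A g h) (at level 40, left associativity).

Definition comma_left (l : Lam) : K := (val l).1.1.
Definition comma_bottom (l : Lam) : G := (val l).1.2.
Definition comma_right (l : Lam) : K := (val l).2.
Definition comma_top (l : Lam) : G :=
  Phi (comma_left l) ** comma_bottom l ** ginv A (Phi (comma_right l)).

Local Notation L := comma_left.
Local Notation b := comma_bottom.
Local Notation Rt := comma_right.
Local Notation tp := comma_top.

Lemma comma_srcL l : src B (L l) = tgt A (b l).
Proof. by case: l => p hp; case: (set_mem hp). Qed.

Lemma comma_srcR l : src B (Rt l) = src A (b l).
Proof. by case: l => p hp; case: (set_mem hp). Qed.

Definition comma_square (kt : K) (g : G) (ks : K)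
    (h : src B kt = tgt A g /\ src B ks = src A g) : Lam :=
  exist _ ((kt, g), ks) (mem_set (h : comma_set B A ((kt, g), ks))).

(* Both products return their first argument on non-composable squares. *)
Definition comma_mulG (l' l : Lam) : Lam :=
  insubd l' ((gmul B (L l') (L l), b l), gmul B (Rt l') (Rt l)).

Definition comma_mulH (l' l : Lam) : Lam :=
  insubd l' ((L l', b l' ** b l), Rt l).

Lemma comma_unitG_subproof (g : G) :
  src B (gunit B (tgt A g)) = tgt A g /\ src B (gunit B (src A g)) = src A g.
Proof. by rewrite !src_unit. Qed.

Definition comma_unitG (g : G) : Lam := comma_square (comma_unitG_subproof g).

Lemma comma_unitH_subproof (k : K) :
  src B k = tgt A (gunit A (src B k)) /\ src B k = src A (gunit A (src B k)).
Proof. by rewrite src_unit tgt_unit. Qed.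

Definition comma_unitH (k : K) : Lam := comma_square (comma_unitH_subproof k).

Let Fs k : src A (Phi k) = src B k := functor_src (mor_functor Phi) k.
Let Ft k : tgt A (Phi k) = tgt B k := functor_tgt (mor_functor Phi) k.
Let F1 x : Phi (gunit B x) = gunit A x := functor_unit (mor_functor Phi) x.
Let FM k h : src B k = tgt B h -> Phi (gmul B k h) = Phi k ** Phi h :=
  fun e => functor_mul (mor_functor Phi) e.
Let FV k : Phi (ginv B k) = ginv A (Phi k) := functor_inv (mor_functor Phi) k.

Lemma comma_src_left l : src A (Phi (L l)) = tgt A (b l).
Proof. by rewrite Fs comma_srcL. Qed.

Lemma comma_src_right l : src A (b l) = tgt A (ginv A (Phi (Rt l))).
Proof. by rewrite tgt_inv Fs comma_srcR. Qed.

Lemma comma_src_top l : src A (tp l) = tgt B (Rt l).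
Proof.
rewrite /comma_top src_mul ?src_inv// ?Ft// src_mul ?comma_src_left//.
exact: comma_src_right.
Qed.

Lemma comma_tgt_top l : tgt A (tp l) = tgt B (L l).
Proof.
have e := comma_src_left l.
by rewrite /comma_top tgt_mul ?tgt_mul ?Ft// src_mul//; exact: comma_src_right.
Qed.

Lemma comma_invG_subproof (l : Lam) :
  src B (ginv B (L l)) = tgt A (tp l) /\ src B (ginv B (Rt l)) = src A (tp l).
Proof. by rewrite !src_inv comma_src_top comma_tgt_top. Qed.

Definition comma_invG (l : Lam) : Lam := comma_square (comma_invG_subproof l).

Lemma comma_invH_subproof (l : Lam) :
  src B (Rt l) = tgt A (ginv A (b l)) /\ src B (L l) = src A (ginv A (b l)).
Proof. by rewrite src_inv tgt_inv comma_srcL comma_srcR. Qed.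

Definition comma_invH (l : Lam) : Lam := comma_square (comma_invH_subproof l).

Lemma commaP (l l' : Lam) : L l = L l' -> b l = b l' -> Rt l = Rt l' -> l = l'.
Proof.
move=> e1 e2 e3; apply: val_inj; move: e1 e2 e3.
rewrite /comma_left /comma_bottom /comma_right.
by case: (val l) => -[? ?] ?; case: (val l') => -[? ?] ? /= -> -> ->.
Qed.

Lemma comma_mulGE l' l : b l' = tp l ->
  [/\ L (comma_mulG l' l) = gmul B (L l') (L l),
      b (comma_mulG l' l) = b l &
      Rt (comma_mulG l' l) = gmul B (Rt l') (Rt l)].
Proof.
move=> e; have h : comma_set B A ((gmul B (L l') (L l), b l),
    gmul B (Rt l') (Rt l)).
  have eL : src B (L l') = tgt B (L l) by rewrite comma_srcL e comma_tgt_top.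
  have eR : src B (Rt l') = tgt B (Rt l) by rewrite comma_srcR e comma_src_top.
  by split => /=; rewrite src_mul// ?comma_srcL ?comma_srcR.
rewrite /comma_left /comma_bottom /comma_right /comma_mulG insubdK//.
exact: mem_set.
Qed.

Lemma comma_mulHE l' l : Rt l' = L l ->
  [/\ L (comma_mulH l' l) = L l',
      b (comma_mulH l' l) = b l' ** b l &
      Rt (comma_mulH l' l) = Rt l].
Proof.
move=> e; have h : comma_set B A ((L l', b l' ** b l), Rt l).
  have eb : src A (b l') = tgt A (b l) by rewrite -comma_srcR e comma_srcL.
  by split => /=; rewrite ?src_mul ?tgt_mul// ?comma_srcL ?comma_srcR.
rewrite /comma_left /comma_bottom /comma_right /comma_mulH insubdK//.
exact: mem_set.
Qed.

Lemma comma_compG l' l : b l' = tp l ->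
  src B (L l') = tgt B (L l) /\ src B (Rt l') = tgt B (Rt l).
Proof.
by move=> e; rewrite comma_srcL comma_srcR e comma_tgt_top comma_src_top.
Qed.

Lemma comma_compH l' l : Rt l' = L l -> src A (b l') = tgt A (b l).
Proof. by move=> e; rewrite -comma_srcR e comma_srcL. Qed.

Lemma comma_top_mulG l' l : b l' = tp l -> tp (comma_mulG l' l) = tp l'.
Proof.
move=> e; have [eL eR] := comma_compG e.
rewrite /comma_top; have [-> -> ->] := comma_mulGE e.
rewrite !FM// ginvM ?Fs ?Ft// e /comma_top.
have h1 := comma_src_left l; have h2 := comma_src_right l.
have h3 : src A (Phi (L l')) = tgt A (Phi (L l)) by rewrite Fs Ft.
have h4 : src A (ginv A (Phi (Rt l))) = tgt A (ginv A (Phi (Rt l'))).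
  by rewrite src_inv tgt_inv Fs Ft.
by rewrite !gmulA ?src_mul ?tgt_mul ?src_mul//.
Qed.

Lemma comma_top_mulH l' l : Rt l' = L l ->
  tp (comma_mulH l' l) = tp l' ** tp l.
Proof.
move=> e; have eb := comma_compH e.
rewrite /comma_top; have [-> -> ->] := comma_mulHE e.
have h1 := comma_src_left l; have h2 := comma_src_right l.
have h1' := comma_src_left l'; have h2' := comma_src_right l'.
have h3 : src A (b l') = tgt A (ginv A (Phi (L l))) by rewrite -e.
have h4 : src A (ginv A (Phi (L l))) = tgt A (Phi (L l)) by rewrite src_inv.
rewrite !gmulA ?src_mul ?tgt_mul ?src_mul// e.
- by rewrite gmulgVK// src_mul// eb h1.
- exact: h4.
- exact: h4.
Qed.

Lemma comma_top_unitG g : tp (comma_unitG g) = g.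
Proof.
rewrite /comma_top /comma_left /comma_bottom /comma_right /=.
by rewrite !F1 gmul1g ginv_unit gmulg1.
Qed.

Lemma comma_top_unitH k : tp (comma_unitH k) = gunit A (tgt B k).
Proof.
rewrite /comma_top /comma_left /comma_bottom /comma_right /=.
by rewrite -Fs gmulg1 gmulgV Ft.
Qed.

Lemma comma_top_invG l : tp (comma_invG l) = b l.
Proof.
rewrite {1}/comma_top /comma_left /comma_bottom /comma_right /= -/(L l) -/(Rt l).
rewrite !FV {1}/comma_top.
have h1 := comma_src_left l; have h2 := comma_src_right l.
have h3 : src A (Phi (L l) ** b l) = tgt A (ginv A (Phi (Rt l))).
  by rewrite src_mul.
rewrite gmulA ?src_inv ?tgt_mul// gmulA ?src_inv ?tgt_mul// gmulVg.
by rewrite h1 gmul1g gmulgK.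
Qed.

Definition comma_overG : groupoid Lam G.
Proof.
refine (@Groupoid Lam G b tp comma_mulG comma_unitG comma_invG
  _ comma_top_unitG _ comma_top_mulG _ _ _ _ comma_top_invG _ _) => //.
- by move=> l l' /comma_mulGE[].
- move=> l1 l2 l3 e12 e23.
  have [a1 a2 a3] := comma_mulGE e12; have [b1 b2 b3] := comma_mulGE e23.
  have [c1 c2] := comma_compG e12; have [d1 d2] := comma_compG e23.
  have f1 : b l1 = tp (comma_mulG l2 l3) by rewrite comma_top_mulG.
  have f2 : b (comma_mulG l1 l2) = tp l3 by rewrite a2.
  have [g1 g2 g3] := comma_mulGE f1; have [k1 k2 k3] := comma_mulGE f2.
  by apply: commaP; rewrite ?g1 ?g2 ?g3 ?k1 ?k2 ?k3 ?a1 ?a2 ?a3 ?b1 ?b2 ?b3// gmulA.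
- move=> l; have [] := @comma_mulGE (comma_unitG (tp l)) l erefl.
  move=> e1 e2 e3; apply: commaP => //.
    by rewrite e1 {1}/comma_left /= comma_tgt_top gmul1g.
  by rewrite e3 {1}/comma_right /= comma_src_top gmul1g.
- move=> l; have [|e1 e2 e3] := @comma_mulGE l (comma_unitG (b l)).
    by rewrite comma_top_unitG.
  apply: commaP => //.
    by rewrite e1 {2}/comma_left /= -comma_srcL gmulg1.
  by rewrite e3 {2}/comma_right /= -comma_srcR gmulg1.
- move=> l; have [|e1 e2 e3] := @comma_mulGE (comma_invG l) l; first by [].
  apply: commaP => //.
    by rewrite e1 {1 3}/comma_left /= gmulVg comma_srcL.
  by rewrite e3 {1 3}/comma_right /= gmulVg comma_srcR.
- move=> l; have [|e1 e2 e3] := @comma_mulGE l (comma_invG l).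
    by rewrite comma_top_invG.
  apply: commaP => //.
    by rewrite e1 {2 3}/comma_left /= gmulgV comma_tgt_top.
  by rewrite e3 {2 3}/comma_right /= gmulgV comma_src_top.
Defined.

Lemma comma_top_invH l : tp (comma_invH l) = ginv A (tp l).
Proof.
have h1 := comma_src_left l; have h2 := comma_src_right l.
have h3 : src A (Phi (Rt l)) = tgt A (ginv A (b l)).
  by rewrite tgt_inv Fs comma_srcR.
have h4 : src A (ginv A (b l)) = tgt A (ginv A (Phi (L l))).
  by rewrite src_inv tgt_inv h1.
rewrite /(tp l) ginvM; last by rewrite src_mul.
by rewrite ginvK ginvM// gmulA.
Qed.

Definition comma_overH : groupoid Lam K.
Proof.
refine (@Groupoid Lam K Rt L comma_mulH comma_unitH comma_invH
  _ _ _ _ _ _ _ _ _ _ _) => //.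
- by move=> l l' /comma_mulHE[].
- by move=> l l' /comma_mulHE[].
- move=> l1 l2 l3 e12 e23.
  have [a1 a2 a3] := comma_mulHE e12; have [b1 b2 b3] := comma_mulHE e23.
  have c12 := comma_compH e12; have c23 := comma_compH e23.
  have f1 : Rt l1 = L (comma_mulH l2 l3) by rewrite b1.
  have f2 : Rt (comma_mulH l1 l2) = L l3 by rewrite a3.
  have [g1 g2 g3] := comma_mulHE f1; have [k1 k2 k3] := comma_mulHE f2.
  by apply: commaP; rewrite ?g1 ?g2 ?g3 ?k1 ?k2 ?k3 ?a1 ?a2 ?a3 ?b1 ?b2 ?b3// gmulA.
- move=> l; have [e1 e2 e3] := @comma_mulHE (comma_unitH (L l)) l erefl.
  apply: commaP => //.
  by rewrite e2 {1}/comma_bottom /= comma_srcL gmul1g.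
- move=> l; have [e1 e2 e3] := @comma_mulHE l (comma_unitH (Rt l)) erefl.
  apply: commaP => //.
  by rewrite e2 {2}/comma_bottom /= comma_srcR gmulg1.
- move=> l; have [e1 e2 e3] := @comma_mulHE (comma_invH l) l erefl.
  apply: commaP => //.
  by rewrite e2 {1 3}/comma_bottom /= gmulVg comma_srcR.
- move=> l; have [e1 e2 e3] := @comma_mulHE l (comma_invH l) erefl.
  apply: commaP => //.
  by rewrite e2 {2 3}/comma_bottom /= gmulgV comma_srcL.
Defined.

Definition comma_double_groupoid : double_groupoid Lam G K M.
Proof.
refine (@DoubleGroupoid Lam G K M A B comma_overG comma_overH
  _ _ _ _ _ _ _ _ _) => /=.
- split => //= [l|l|l l' /comma_mulHE[]//].
  + by rewrite comma_srcR.
  + by rewrite comma_srcL.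
- split => //=.
  + exact: comma_src_top.
  + exact: comma_tgt_top.
  + exact: comma_top_unitH.
  + exact: comma_top_mulH.
- split => //= [x|g h gh].
  + apply: commaP => //=; rewrite /comma_left /comma_right /comma_bottom /=.
    * by rewrite tgt_unit.
    * by rewrite src_unit.
    * by rewrite src_unit.
  + have [|e1 e2 e3] := @comma_mulHE (comma_unitG g) (comma_unitG h).
      by rewrite /comma_right /comma_left /= gh.
    apply: commaP; rewrite ?e1 ?e2 ?e3 /comma_left /comma_right /comma_bottom /=.
    * by rewrite tgt_mul.
    * by [].
    * by rewrite src_mul.
- split => //= [k|l l' e].
  + apply: commaP => //=.
    by rewrite {1}/comma_bottom /= comma_top_unitH /comma_bottom /= src_inv.
  + have e' : Rt (comma_invG l) = L (comma_invG l').
      by rewrite /comma_right /comma_left /= -/(Rt l) -/(L l') e.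
    have [a1 a2 a3] := comma_mulHE e; have [b1 b2 b3] := comma_mulHE e'.
    apply: commaP; rewrite ?b1 ?b2 ?b3.
    * by rewrite -[LHS]/(ginv B (L (comma_mulH l l'))) a1.
    * exact: comma_top_mulH.
    * by rewrite -[LHS]/(ginv B (Rt (comma_mulH l l'))) a3.
- split => //= [l|l|l l' /comma_mulGE[]//].
  + by rewrite comma_srcR.
  + by rewrite comma_src_top.
- split => //= [l|l|l l' /comma_mulGE[]//].
  + by rewrite comma_srcL.
  + by rewrite comma_tgt_top.
- split => //= [k|x|k k' e].
  + exact: comma_top_unitH.
  + apply: commaP => //=; rewrite /comma_left /comma_right /comma_bottom /=.
    * by rewrite tgt_unit.
    * by rewrite src_unit.
    * by rewrite src_unit.
  + have [|e1 e2 e3] := @comma_mulGE (comma_unitH k) (comma_unitH k').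
      by rewrite comma_top_unitH /comma_bottom /= e.
    apply: commaP; rewrite ?e1 ?e2 ?e3 /comma_left /comma_right /comma_bottom //=.
    by rewrite src_mul.
- split => //= [l|g|l l' e].
  + exact: comma_top_invH.
  + apply: commaP => //=; rewrite /comma_bottom /comma_left /comma_right /=.
    * by rewrite tgt_inv.
    * by rewrite src_inv.
  + have e' : b (comma_invH l) = tp (comma_invH l').
      by rewrite comma_top_invH -e.
    have [a1 a2 a3] := comma_mulGE e; have [b1 b2 b3] := comma_mulGE e'.
    apply: commaP; rewrite ?b1 ?b2 ?b3.
    * exact: a3.
    * by rewrite -[LHS]/(ginv A (b (comma_mulG l l'))) a2.
    * exact: a1.
- move=> l1 l2 l3 l4 e12 e34 e13 e24.
  have [a1 a2 a3] := comma_mulGE e12; have [b1 b2 b3] := comma_mulGE e34.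
  have [c1 c2 c3] := comma_mulHE e13; have [d1 d2 d3] := comma_mulHE e24.
  have f : Rt (comma_mulG l1 l2) = L (comma_mulG l3 l4).
    by rewrite a3 b1 e13 e24.
  have g : b (comma_mulH l1 l3) = tp (comma_mulH l2 l4).
    by rewrite comma_top_mulH// c2 e12 e34.
  have [f1 f2 f3] := comma_mulHE f; have [g1 g2 g3] := comma_mulGE g.
  apply: commaP; first by rewrite f1 g1 a1 c1 d1.
    by rewrite f2 g2 a2 b2 d2.
  by rewrite f3 g3 b3 c3 d3.
Defined.

End Comma.

Section Matrices.
Context {R : realType} {K G M : premanifold R}.
Context {B : groupoid K M} {A : groupoid G M}.

(* G^(r) x K^(1) x ... x K^(r), where r > 0. *)
Definition matrix_ambient (r : nat) : premanifold R :=
  prod_space (composable_space A r)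
    (pi_space (fun j : 'I_r => composable_space B j.+1)).

(* Entries in the top row and in the triangle below it, with row and column
   indices starting from 0. *)
Definition matrix_g (r : nat) (m : matrix_ambient r.+1) (j : nat) : G :=
  val m.1 (inord j).

Definition matrix_k (r : nat) (m : matrix_ambient r.+1) (i j : nat) : K :=
  val (m.2 (inord j)) (inord i).

Definition matrix_set (r : nat) : set (matrix_ambient r) :=
  [set m : matrix_ambient r | forall j : 'I_r,
     tgt B (val (m.2 j) ord0) = src A (val m.1 j)].

Variable Phi : groupoid_morphism B A.

(* The product of the images of the first i entries of column j, from left to
   right; for i = 0 it is the unit at the target of the column. *)
Definition column_prod (r : nat) (m : matrix_ambient r.+1) (i j : nat) : G :=
  foldl (gmul A) (gunit A (tgt B (matrix_k m 0 j)))
    [seq Phi (matrix_k m l j) | l <- iota 0 i].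

(* The matrix m represents the element w of the layer r + 1. *)
Definition represents (r : nat) :
    matrix_ambient r.+1 ->
    bar_ambient (comma_space B A) G K M r.+1 -> Prop :=
  let D := comma_double_groupoid Phi in
  match r with
  | 0 => fun m (w : prod_space G K) =>
      w.1 = matrix_g m 0 /\ w.2 = matrix_k m 0 0
  | n.+1 => fun m
      (w : prod_space (prod_space G (triangle n.+1 (comma_space B A))) K) =>
      [/\ w.1.1 = matrix_g m 0,
          forall i j, (i <= j)%N -> (j <= n)%N ->
            let lam : comma_space B A := w.1.2 (inord j) (inord i) in
            [/\ tgt (overH D) lam = matrix_k m i j,
                src (overH D) lam = matrix_k m i j.+1 &
                tgt (overG D) lam =
                  gmul A (gmul A (ginv A (column_prod m i j))
                                 (matrix_g m j.+1))
                         (column_prod m i j.+1)] &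
          w.2 = matrix_k m n.+1 n.+1]
  end.

End Matrices.

Arguments matrix_ambient {R K G M} B A r.
Arguments matrix_set {R K G M} B A r.

(* Main.v *)
(* A matrix determines all its squares: the top edge of the square (i, j) is
   g_(j+1) conjugated by the products of the first i entries of the columns j
   and j+1, and its bottom edge is the top edge of the square (i+1, j), which is
   what makes the squares of a column fit together. Conversely the entries of the
   matrix are edges of the squares, so the assignment F from matrices to the
   ambient space of W_r is smooth and has as image W_r, and a smooth map E defined
   on the whole ambient space satisfies E o F = id on the entries. Hence F is an
   embedding with image W_r, which is thus an embedded submanifold diffeomorphic
   to the space of matrices.

   That G^(r), the comma space and the space of matrices are embedded is a matter
   of transversality. The source and target maps, being submersions, have smooth
   local sections, and with those any small discrepancy in the equations, say
   s(g_j) = t(g_(j+1)), can be prescribed and solved for smoothly, one arrow after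
   the other. The defining equations therefore have a smooth local section, and
   the inverse function theorem turns this into slice charts. *)

Require Import Defs.
From HB Require Import structures.
From mathcomp Require Import all_boot all_order all_algebra perm.
From mathcomp Require Import all_classical all_reals all_analysis ring lra.

Set Implicit Arguments.
Unset Strict Implicit.
Unset Printing Implicit Defensive.

Import Order.TTheory GRing.Theory Num.Theory.
Import numFieldNormedType.Exports.
Local Open Scope classical_set_scope.
Local Open Scope ring_scope.

(** The layer [W_r] is in general not cut out transversally by its own equations: where four squares
    meet at a vertex, three of the edge equations already equate one endpoint of the two edges
    compared by the fourth. This is why it is treated as an image, whereas [embedded_equalizer]
    serves for composable tuples, the comma space and the matrices, whose equations can be solved
    one arrow at a time. The map that reads off the edges cannot take values in matrices, since away
    from [W_r] the edges need not fit together. Its target is the space of unconstrained arrays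
    [free_matrices], from which local retractions lead back to matrices.

    Many maps are total functions with default values ([insubd], [xget], [chart_inv]) and are
    meaningful only near a point. Smoothness is therefore handled by germs, through [smooth_near]
    and [smooth_at], and inverses are inverse only locally. Tangent spaces are avoided: a surjective
    differential is turned into a smooth local section, and ranks enter only through matrix
    identities given by the chain rule. *)

HB.instance Definition _ (R : realType) (m n : nat) :=
  Complete.on 'M[R]_(m, n).

(** * Differential calculus on row vectors *)

Section Differentials.
Context {R : realType}.
Implicit Types U V W : normedModType R.

(** Replaces little-o terms by an explicit estimate. With the converse [eps_differentiable], a
    differential is found by exhibiting a continuous linear candidate. *)
Lemma differentiable_epsP V W (f : V -> W) (x : V) : differentiable f x ->
  forall e, 0 < e ->
    \forall y \near x, `|f y - f x - 'd f x (y - x)| <= e * `|y - x|.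
Proof.
move=> df e e0; have /diff_locally/eqaddoP/(_ e e0) h := df.
rewrite (near_shift 0); apply: filterS h => y.
rewrite /= /shift /= subr0 addrK.
by rewrite -[X in `|X|]/(f (y + x) - (f x + 'd f x y)) opprD addrA.
Qed.

Lemma eps_differentiable V W (f : V -> W) (x : V) (L : {linear V -> W}) :
  continuous L ->
  (forall e, 0 < e ->
    \forall y \near x, `|f y - f x - L (y - x)| <= e * `|y - x|) ->
  differentiable f x /\ 'd f x = L :> (V -> W).
Proof.
move=> Lc h.
have E : f \o shift x = cst (f x) + L +o_0 id.
  apply/eqaddoP => e e0; have := h e e0.
  rewrite (near_shift 0); apply: filterS => y.
  rewrite /= /shift /= subr0 addrK.
  by rewrite -[X in _ -> `|X| <= _]/(f (y + x) - (f x + L y)) opprD addrA.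
have dE := diff_unique Lc E; split => //.
by apply/diff_locallyP; rewrite dE; split.
Qed.

Lemma near_eq_differentiable V W (f g : V -> W) (x : V) :
  (\forall y \near x, f y = g y) -> differentiable f x ->
  differentiable g x /\ 'd g x = 'd f x :> (V -> W).
Proof.
move=> fg df; have fgx := nbhs_singleton fg; apply: eps_differentiable; first exact: diff_continuous.
move=> e e0; have := differentiable_epsP df e0; apply: filterS2 fg => y.
by rewrite -fgx => <-.
Qed.

Lemma diffDE V W (f g : V -> W) x v : differentiable f x -> differentiable g x ->
  'd (fun y => f y + g y) x v = 'd f x v + 'd g x v.
Proof. by move=> df dg; rewrite [in LHS](diffD df dg). Qed.

Lemma diff_compE U V W (f : U -> V) (g : V -> W) x v :
  differentiable f x -> differentiable g (f x) ->
  'd (g \o f) x v = 'd g (f x) ('d f x v).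
Proof. by move=> df dg; rewrite diff_comp. Qed.

End Differentials.

(** * Closure properties of maps of class C^k *)

Section ClassC.
Context {R : realType}.
Implicit Types (k m n p : nat).

Lemma cvg_mx (T : Type) (F : set_system T) (FF : Filter F) m n
    (f : T -> 'M[R]_(m, n)) (l : 'M[R]_(m, n)) :
  (forall i j, f x i j @[x --> F] --> l i j) -> f @ F --> l.
Proof.
move=> h A [P Pn PA]; apply: (@filterS _ _ _ (fun x => forall i j, P i j (f x i j))).
  by move=> x Px; apply: PA.
by apply: filter_forall => i; apply: filter_forall => j; apply: h; exact: Pn.
Qed.

Lemma mulmxr_continuous n p (C : 'M[R]_(n, p)) :
  continuous (mulmxr C : 'rV[R]_n -> 'rV[R]_p).
Proof.
move=> v; apply: (@cvg_mx _ _ (nbhs_filter v)) => i j; rewrite ord1 mxE.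
under eq_fun do rewrite mxE.
apply: cvg_big => [|l _]; first exact: add_continuous.
by apply: cvgM; [exact: coord_continuous|exact: cvg_cst].
Qed.

Lemma diff_mulmxr n m p (f : 'rV[R]_m -> 'rV[R]_n) (C : 'M[R]_(n, p)) x :
  differentiable f x ->
  differentiable (fun y => f y *m C) x /\
  'd (fun y => f y *m C) x = (fun v => 'd f x v *m C) :> ('rV_m -> 'rV_p).
Proof.
move=> df; have Cc := @mulmxr_continuous _ _ C.
have dC : differentiable (mulmxr C : 'rV[R]_n -> 'rV[R]_p) (f x).
  exact: linear_differentiable.
split; first exact: (differentiable_comp df dC).
by have := diff_comp df dC; rewrite diff_lin.
Qed.

Lemma diff_coord m n (f : 'rV[R]_m -> 'rV[R]_n) (j : 'I_n) x :
  differentiable f x ->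
  differentiable (fun y => f y ord0 j) x /\
  'd (fun y => f y ord0 j) x = (fun v => 'd f x v ord0 j) :> ('rV_m -> R).
Proof.
move=> df; pose c : 'rV[R]_n -> R := fun N => N ord0 j.
have lc : linear c by move=> a u v; rewrite /c !mxE.
pose cM := GRing.isLinear.Build _ _ _ _ _ lc.
pose cL : {linear 'rV[R]_n -> R} := HB.pack c cM.
have cc : continuous cL by exact: coord_continuous.
have dc : differentiable cL (f x) by exact: linear_differentiable.
split; first exact: (differentiable_comp df dc).
by have := diff_comp df dc; rewrite diff_lin.
Qed.

(** Registered as an instance just below, so that [differentiable_bilin] and [diff_bilin] yield the
    product rule for a scalar times a vector. *)
Lemma scaler_is_bilinear (W : normedModType R) :
  bilinear_for (GRing.Scale.Law.clone _ _ *:%R _) (GRing.Scale.Law.clone _ _ *:%R _)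
    (@GRing.scale R W).
Proof.
by split=> [u'|u] a x y /=; rewrite ?scalerDl ?scalerDr ?scalerA// mulrC.
Qed.
HB.instance Definition _ (W : normedModType R) :=
  bilinear_isBilinear.Build R R W W _ _ (@GRing.scale R W) (scaler_is_bilinear W).

Lemma diff_scale (V W : normedModType R) (c : V -> R) (f : V -> W) x :
  differentiable c x -> differentiable f x ->
  differentiable (fun y => c y *: f y) x /\
  'd (fun y => c y *: f y) x = (fun v => c x *: 'd f x v + 'd c x v *: f x)
    :> (V -> W).
Proof.
move=> dc df; pose s (p : R * W) := p.1 *: p.2.
have sc : continuous s by exact: scale_continuous.
have ds (q : R * W) : differentiable s q by exact: differentiable_bilin.
have dcf := differentiable_pair dc df.
split; first exact: (differentiable_comp dcf (ds _)).
by have := diff_comp dcf (ds _); rewrite diff_pair// diff_bilin.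
Qed.

Lemma diff_coordZ m n (W : normedModType R) (c : 'rV[R]_m -> 'rV[R]_n)
    (f : 'rV[R]_m -> W) j x v :
  differentiable c x -> differentiable f x ->
  differentiable (fun y => c y ord0 j *: f y) x /\
  'd (fun y => c y ord0 j *: f y) x v =
    c x ord0 j *: 'd f x v + 'd c x v ord0 j *: f x.
Proof.
move=> dc df; have [dcj e] := diff_coord j dc.
have [? dE] := diff_scale dcj df; split=> //.
by rewrite (congr1 (fun F => F v) dE) e.
Qed.

Lemma class_CS k m n (U : set 'rV[R]_m) (f : 'rV[R]_m -> 'rV[R]_n) :
  class_C k.+1 U f = ((forall x, U x -> differentiable f x) /\
                      (forall v, class_C k U (fun x => 'd f x v))).
Proof. by []. Qed.

(** Every clause of [class_C] is a condition on the total function [f] at single points of [U],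
    never on a restriction of [f] to [U]. Hence passing to subsets and gluing work for arbitrary
    sets. *)
Lemma class_C_pointP k m n (U : set 'rV[R]_m) (f : 'rV[R]_m -> 'rV[R]_n) :
  class_C k U f <-> forall x, U x -> class_C k [set x] f.
Proof.
elim: k f => [|k IH] f.
  by split=> [h x Ux y ->|h x Ux]; [exact: h|exact: (h x Ux x erefl)].
rewrite class_CS; split=> [[df h] x Ux|h].
  rewrite class_CS; split=> [y ->|v]; first exact: df.
  by move/IH: (h v); apply.
split=> [x Ux|v]; first by have [+ _] := h x Ux; apply.
by apply/IH => x Ux; have := h x Ux; rewrite class_CS => -[_]; apply.
Qed.

Lemma sub_class_C k m n (U V : set 'rV[R]_m) (f : 'rV[R]_m -> 'rV[R]_n) :
  U `<=` V -> class_C k V f -> class_C k U f.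
Proof.
by move=> UV /class_C_pointP h; apply/class_C_pointP => x /UV; exact: h.
Qed.

Lemma class_C_weak k m n (U : set 'rV[R]_m) (f : 'rV[R]_m -> 'rV[R]_n) :
  class_C k.+1 U f -> class_C k U f.
Proof.
elim: k f => [|k IH] f; rewrite class_CS => -[df h].
  by move=> x Ux; apply/differentiable_continuous/df.
by rewrite class_CS; split=> // v; apply: IH; exact: h.
Qed.

Lemma near_eq_continuous (T T' : topologicalType) (f g : T -> T') x :
  (\forall y \near x, f y = g y) -> {for x, continuous f} ->
  {for x, continuous g}.
Proof.
move=> fg; rewrite /prop_for /continuous_at -(nbhs_singleton fg).
by apply: cvg_trans; apply: near_eq_cvg.
Qed.

Lemma near_open (T : topologicalType) (U : set T) x (P : T -> Prop) :
  open U -> U x -> (forall y, U y -> P y) -> \forall y \near x, P y.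
Proof. by move=> Uo Ux UP; apply: filterS (open_nbhs_nbhs (conj Uo Ux)). Qed.

(** On an open set, equality of functions is equality of germs, and differentials see only germs. *)
Lemma eq_class_C k m n (U : set 'rV[R]_m) (f g : 'rV[R]_m -> 'rV[R]_n) :
  open U -> (forall x, U x -> f x = g x) -> class_C k U f -> class_C k U g.
Proof.
move=> Uo; elim: k f g => [|k IH] f g fg.
  by move=> cf x Ux; exact: near_eq_continuous (near_open Uo Ux fg) (cf x Ux).
rewrite !class_CS => -[df h].
have fgn x : U x -> differentiable g x /\ 'd g x = 'd f x :> ('rV_m -> 'rV_n).
  by move=> Ux; exact: near_eq_differentiable (near_open Uo Ux fg) (df x Ux).
split=> [x Ux|v]; first by have [] := fgn x Ux.
have E x : U x -> 'd f x v = 'd g x v.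
  by move=> Ux; exact (congr1 (fun F => F v) (esym (fgn x Ux).2)).
exact: (IH _ _ E (h v)).
Qed.

Lemma class_C_cst k m n (U : set 'rV[R]_m) (c : 'rV[R]_n) :
  class_C k U (fun=> c).
Proof.
elim: k c => [|k IH] c; first by move=> x _; exact: cst_continuous.
rewrite class_CS; split=> [x _|v]; first exact: differentiable_cst.
by under eq_fun do rewrite diff_cst; exact: IH.
Qed.

Lemma class_C_id k m (U : set 'rV[R]_m) : class_C k U id.
Proof.
case: k => [|k]; first by move=> x _; exact: cvg_id.
rewrite class_CS; split=> [x _|v]; first by [].
rewrite (_ : (fun _ => _) = fun=> v); first exact: class_C_cst.
by apply/funext => x; rewrite diff_val.
Qed.

Lemma class_CD k m n (U : set 'rV[R]_m) (f g : 'rV[R]_m -> 'rV[R]_n) :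
  open U -> class_C k U f -> class_C k U g -> class_C k U (fun x => f x + g x).
Proof.
move=> Uo; elim: k f g => [|k IH] f g.
  by move=> cf cg x Ux; exact: (continuousD (cf x Ux) (cg x Ux)).
rewrite !class_CS => -[df hf] [dg hg]; split=> [x Ux|v].
  by apply: differentiableD; [exact: df|exact: dg].
have E x : U x -> 'd f x v + 'd g x v = 'd (fun y => f y + g y) x v.
  by move=> Ux; exact (esym (diffDE v (df x Ux) (dg x Ux))).
exact: (eq_class_C Uo E (IH _ _ (hf v) (hg v))).
Qed.

Lemma class_C_sum k m n (U : set 'rV[R]_m) I (r : seq I) (P : pred I)
    (f : I -> 'rV[R]_m -> 'rV[R]_n) :
  open U -> (forall i, P i -> class_C k U (f i)) ->
  class_C k U (fun x => \sum_(i <- r | P i) f i x).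
Proof.
move=> Uo h; elim: r => [|i r IH].
  by under eq_fun do rewrite big_nil; exact: class_C_cst.
under eq_fun do rewrite big_cons.
by case: (boolP (P i)) => // Pi; apply: class_CD => //; exact: h.
Qed.

Lemma class_C_mulmxr k m n p (U : set 'rV[R]_m) (f : 'rV[R]_m -> 'rV[R]_n)
    (C : 'M[R]_(n, p)) :
  open U -> class_C k U f -> class_C k U (fun x => f x *m C).
Proof.
move=> Uo; elim: k f => [|k IH] f.
  move=> cf x Ux.
  exact: (@continuous_comp _ _ _ f (mulmxr C) x (cf x Ux) (@mulmxr_continuous _ _ C _)).
rewrite !class_CS => -[df hf]; split=> [x Ux|v]; first by have [] := diff_mulmxr C (df x Ux).
have E x : U x -> 'd f x v *m C = 'd (fun y => f y *m C) x v.
  move=> Ux; have [_ dE] := diff_mulmxr C (df x Ux).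
  exact (esym (congr1 (fun F => F v) dE)).
exact: (eq_class_C Uo E (IH _ (hf v))).
Qed.

(** The scalar factor is encoded as a coordinate of a row-valued map, because [class_C] speaks only
    of maps between row spaces. The product rule closes the induction, both factors being also of
    the lower class. *)
Lemma class_CZ k m n p (U : set 'rV[R]_m) (c : 'rV[R]_m -> 'rV[R]_n) j
    (f : 'rV[R]_m -> 'rV[R]_p) :
  open U -> class_C k U c -> class_C k U f ->
  class_C k U (fun x => c x ord0 j *: f x).
Proof.
move=> Uo; elim: k c f => [|k IH] c f.
  move=> cc cf x Ux; have ccj : {for x, continuous (fun y => c y ord0 j)}.
    exact: (@continuous_comp _ _ _ c (fun N : 'rV[R]_n => N ord0 j) x
              (cc x Ux) (@coord_continuous _ _ _ ord0 j _)).
  exact: (continuousZ ccj (cf x Ux)).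
move=> hc hf; have := hc; have := hf; rewrite !class_CS => -[df h2] [dc h1]; split=> [x Ux|v].
  exact (diff_coordZ j 0 (dc x Ux) (df x Ux)).1.
have E x : U x -> c x ord0 j *: 'd f x v + 'd c x v ord0 j *: f x =
    'd (fun y => c y ord0 j *: f y) x v.
  by move=> Ux; exact (esym (diff_coordZ j v (dc x Ux) (df x Ux)).2).
exact: (eq_class_C Uo E (class_CD Uo (IH _ _ (class_C_weak hc) (h2 v))
                                     (IH _ _ (h1 v) (class_C_weak hf)))).
Qed.

Lemma class_C_comp k m n p (U : set 'rV[R]_m) (V : set 'rV[R]_n)
    (f : 'rV[R]_m -> 'rV[R]_n) (g : 'rV[R]_n -> 'rV[R]_p) :
  open U -> open V -> (forall x, U x -> V (f x)) ->
  class_C k U f -> class_C k V g -> class_C k U (g \o f).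
Proof.
move=> Uo Vo fUV; elim: k g f fUV => [|k IH] g f fUV.
  by move=> cf cg x Ux; apply: continuous_comp; [exact: cf|exact/cg/fUV].
move=> hf hg; have := hg; have := hf; rewrite !class_CS => -[df h1] [dg h2]; split=> [x Ux|v].
  by apply: differentiable_comp; [exact: df|exact/dg/fUV].
have h3 (j : 'I_n) (_ : true) : class_C k U (fun x =>
    ('d f x v) ord0 j *: ('d g (f x) (delta_mx ord0 j))).
  exact: (class_CZ j Uo (h1 v) (IH _ _ fUV (class_C_weak hf) (h2 _))).
(* Only the partial derivatives of g, taken in fixed directions, are known to
   be of class C^k, whence the chain rule in coordinates. *)
have E x : U x -> \sum_(j < n) ('d f x v) ord0 j *: ('d g (f x) (delta_mx ord0 j))
    = 'd (g \o f) x v.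
  move=> Ux; rewrite (diff_compE v (df x Ux) (dg _ (fUV x Ux))).
  rewrite [in RHS](row_sum_delta ('d f x v)) linear_sum.
  by apply: eq_bigr => j _; rewrite linearZ.
exact: (eq_class_C Uo E (class_C_sum _ Uo h3)).
Qed.

End ClassC.

Lemma diff_invrZ (R : realType) (V W : normedModType R) (c : V -> R) (w : W) x v :
  differentiable c x -> c x != 0 ->
  differentiable (fun y => (c y)^-1 *: w) x /\
  'd (fun y => (c y)^-1 *: w) x v =
    (c x)^-1 *: ((c x)^-1 *: (- 'd c x v *: w)).
Proof.
move=> dc cx; have dV := differentiableV dc cx.
have [d1 d2] := diff_scale dV (differentiable_cst w x).
split; first exact d1.
rewrite (congr1 (fun F => F v) d2) diff_cst scaler0 add0r (diffV dc cx).
rewrite -[(_ \*: _) v]/(- c x ^- 2 * 'd c x v) !scalerA; congr (_ *: _).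
by rewrite expr2 invfM mulNr mulrN.
Qed.

(** * Smooth dependence of the inverse matrix on its entries *)

Section MatrixInverse.
Context {R : realType} {m : nat} (U : set 'rV[R]_m) (Uo : open U).

(** Throughout this section a real-valued function enters [class_C] as a 1 by 1 matrix [%:M]. A row
    is the sum of its coordinates times the basis vectors. *)
Lemma class_C_row k n (f : 'rV[R]_m -> 'rV[R]_n) :
  (forall j, class_C k U (fun x => (f x ord0 j)%:M : 'rV_1)) -> class_C k U f.
Proof.
move=> h; have h' (j : 'I_n) (_ : true) : class_C k U (fun x =>
    ((f x ord0 j)%:M : 'rV[R]_1) ord0 ord0 *: (delta_mx ord0 j : 'rV[R]_n)).
  exact: (class_CZ ord0 Uo (h j) (class_C_cst k U (delta_mx ord0 j))).
apply: (eq_class_C Uo _ (class_C_sum (index_enum _) Uo h')) => x _.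
rewrite [RHS]row_sum_delta; apply: eq_bigr => j _.
by rewrite mxE eqxx mulr1n.
Qed.

Lemma class_C_entry k n (f : 'rV[R]_m -> 'rV[R]_n) j :
  class_C k U f -> class_C k U (fun x => (f x ord0 j)%:M : 'rV_1).
Proof.
move=> h; apply: (eq_class_C Uo _
  (class_CZ j Uo h (class_C_cst k U (1%:M : 'rV[R]_1)))) => x _.
by rewrite scalemx1.
Qed.

Lemma class_C_prod k I (r : seq I) (P : pred I) (a : I -> 'rV[R]_m -> R) :
  (forall i, P i -> class_C k U (fun x => (a i x)%:M : 'rV_1)) ->
  class_C k U (fun x => (\prod_(i <- r | P i) a i x)%:M : 'rV_1).
Proof.
move=> h; elim: r => [|i r IH].
  by under eq_fun do rewrite big_nil; exact: class_C_cst.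
under eq_fun do rewrite big_cons.
case: (boolP (P i)) => // Pi.
apply: (eq_class_C Uo _ (class_CZ ord0 Uo (h i Pi) IH)) => x _.
by rewrite mxE eqxx mulr1n scale_scalar_mx.
Qed.

(** The Leibniz formula is a signed sum of products of entries. *)
Lemma class_C_det k n (A : 'rV[R]_m -> 'M[R]_n) :
  (forall i j, class_C k U (fun x => (A x i j)%:M : 'rV_1)) ->
  class_C k U (fun x => (\det (A x))%:M : 'rV_1).
Proof.
move=> h; have h' (s : 'S_n) (_ : true) : class_C k U
    (fun x => (\prod_i A x i (s i))%:M *m ((-1) ^+ s)%:M : 'rV_1).
  by apply: class_C_mulmxr => //; apply: class_C_prod => i _; exact: h.
apply: (eq_class_C Uo _ (class_C_sum (index_enum _) Uo h')) => x _.
rewrite /determinant rmorph_sum /=; apply: eq_bigr => s _.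
by rewrite -scalar_mxM mulrC.
Qed.

Lemma diff_invr_entry (h : 'rV[R]_m -> 'rV[R]_1) x v :
  differentiable h x -> h x ord0 ord0 != 0 ->
  differentiable (fun y => (h y ord0 ord0)^-1%:M : 'rV_1) x /\
  'd (fun y => (h y ord0 ord0)^-1%:M : 'rV_1) x v =
    (h x ord0 ord0)^-1 *: ((h x ord0 ord0)^-1 *: ('d h x v *m (-1)%:M)).
Proof.
move=> dh hx; have [dc e] := diff_coord ord0 dh.
have [d1 d2] := diff_invrZ (1%:M : 'rV[R]_1) v dc hx.
have E y : (h y ord0 ord0)^-1 *: (1%:M : 'rV[R]_1) = (h y ord0 ord0)^-1%:M.
  by rewrite scalemx1.
have E2 (w : 'rV[R]_1) c : c = w ord0 ord0 -> w *m (-1)%:M = - c *: 1%:M.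
  move=> ->; rewrite mul_mx_scalar; apply/rowP => j.
  by rewrite !ord1 !mxE eqxx mulr1 mulN1r.
rewrite -(funext E) (E2 _ _ (congr1 (fun F => F v) e)); split.
- exact d1.
- exact d2.
Qed.

(** The derivative of 1/h is - h'/h^2, a product of h' with two factors 1/h to which the induction
    hypothesis applies. *)
Lemma class_C_inv k (h : 'rV[R]_m -> 'rV[R]_1) :
  (forall x, U x -> h x ord0 ord0 != 0) -> class_C k U h ->
  class_C k U (fun x => (h x ord0 ord0)^-1%:M : 'rV_1).
Proof.
move=> h0; elim: k => [|k IH].
  move=> hc x Ux.
  have hcj : {for x, continuous (fun y => h y ord0 ord0)}.
    exact: (@continuous_comp _ _ _ h (fun N : 'rV[R]_1 => N ord0 ord0) x
              (hc x Ux) (@coord_continuous _ _ _ ord0 ord0 _)).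
  have hV := continuousV (h0 x Ux) hcj.
  have hZ := continuousZ hV (@cst_continuous _ _ (1%:M : 'rV[R]_1) x).
  have E y : U y -> (h y ord0 ord0)^-1 *: cst (1%:M : 'rV[R]_1) y =
      (h y ord0 ord0)^-1%:M by rewrite scalemx1.
  exact (near_eq_continuous (near_open Uo Ux E) hZ).
move=> hS; have := hS; rewrite !class_CS => -[dh h1]; have h2 := IH (class_C_weak hS).
split=> [x Ux|v]; first exact (diff_invr_entry 0 (dh x Ux) (h0 x Ux)).1.
have := class_CZ ord0 Uo h2 (class_CZ ord0 Uo h2 (class_C_mulmxr (-1)%:M Uo (h1 v))).
apply: eq_class_C => // x Ux.
rewrite !mxE eqxx mulr1n.
exact (esym (diff_invr_entry v (dh x Ux) (h0 x Ux)).2).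
Qed.

(** Cramer's rule: the inverse is the adjugate divided by the determinant, and cofactors are
    determinants of minors. The vector [v] is fixed because the derivative of an inverse function is
    taken in a fixed direction. *)
Lemma class_C_mulVmx k n (A : 'rV[R]_m -> 'M[R]_n) (v : 'rV[R]_n) :
  (forall x, U x -> A x \in unitmx) ->
  (forall i, class_C k U (fun x => row i (A x))) ->
  class_C k U (fun x => v *m invmx (A x)).
Proof.
move=> Au hA.
have hA' i j : class_C k U (fun x => (A x i j)%:M : 'rV_1).
  by apply: (eq_class_C Uo _ (class_C_entry j (hA i))) => x _; rewrite mxE.
have hadj : class_C k U (fun x => v *m \adj (A x)).
  apply: class_C_row => j.
  have hc (i : 'I_n) (_ : true) : class_C k U
      (fun x => (\det (row' j (col' i (A x))))%:M *m
                (v ord0 i * (-1) ^+ (j + i))%:M : 'rV_1).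
    apply: class_C_mulmxr => //; apply: class_C_det => i' j'.
    by apply: (eq_class_C Uo _ (hA' (lift j i') (lift i j'))) => x _; rewrite !mxE.
  apply: (eq_class_C Uo _ (class_C_sum (index_enum _) Uo hc)) => x _.
  rewrite mxE rmorph_sum /=; apply: eq_bigr => i _.
  by rewrite -scalar_mxM mxE /cofactor mulrC mulrA.
have hd : forall x, U x -> ((\det (A x))%:M : 'rV[R]_1) ord0 ord0 != 0.
  by move=> x Ux; rewrite mxE eqxx mulr1n -unitfE; exact: Au.
have := class_CZ ord0 Uo (class_C_inv hd (class_C_det hA')) hadj.
apply: eq_class_C => // x Ux.
by rewrite /invmx Au// !mxE eqxx !mulr1n scalemxAr.
Qed.

End MatrixInverse.

(** * The sup norm on rows and the mean value inequality *)

Section RowNorm.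
Context {R : realType}.

Lemma norm_rV_le n (w : 'rV[R]_n) e :
  0 <= e -> (forall j, `|w ord0 j| <= e) -> `|w| <= e.
Proof.
move=> e0 h; rewrite [leLHS]/Num.Def.normr/= mx_normrE (bigmax_le _ e0)//=.
by move=> [i j] _; rewrite ord1.
Qed.

Lemma norm_coord n (w : 'rV[R]_n) j : `|w ord0 j| <= `|w|.
Proof.
rewrite [leRHS]/Num.Def.normr/= mx_normrE.
exact: (@le_bigmax _ _ _ _ (fun i : 'I_1 * 'I_n => `|w i.1 i.2|) (ord0, j)).
Qed.

Lemma mulmx_lipschitz n p (C : 'M[R]_(n, p)) :
  exists2 k : R, 0 < k & forall v : 'rV[R]_n, `|v *m C| <= k * `|v|.
Proof. exact: (linear_lipschitz (@mulmxr_continuous R n p C)). Qed.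

Lemma diff_path (V : normedModType R) (x u : V) (t : R) :
  differentiable (fun s : R => x + s *: u) t /\
  'd (fun s : R => x + s *: u) t 1 = u.
Proof.
have dl := @differentiable_cst R R V x t.
have di : differentiable (id : R -> R) t by [].
have dr := differentiableZl u di.
split; first exact: (differentiableD dl dr).
rewrite (diffDE (1 : R) dl dr) diff_cst add0r.
by rewrite (congr1 (fun F => F (1 : R)) (diffZl u di)) diff_val scale1r.
Qed.

(** The norm is the maximum of the absolute values of the coordinates, so the mean value theorem in
    one variable can be applied to each coordinate along the segment. The intermediate point may
    vary with the coordinate, which is harmless for an inequality. *)
Lemma mean_value_le n p (f : 'rV[R]_n -> 'rV[R]_p) (x y : 'rV[R]_n) (c : R) :
  0 <= c ->
  (forall t : R, 0 <= t <= 1 -> differentiable f (x + t *: (y - x)) /\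
     `|'d f (x + t *: (y - x)) (y - x)| <= c) ->
  `|f y - f x| <= c.
Proof.
move=> c0 h; apply: norm_rV_le => // j.
pose l t := x + t *: (y - x).
pose g (t : R) : R := f (l t) ord0 j.
have gd (t : R) : 0 <= t <= 1 -> differentiable g t /\
    'd g t 1 = 'd f (l t) (y - x) ord0 j.
  move=> t01; have [df _] := h t t01; have [dl dlE] := diff_path x (y - x) t.
  have dfl := differentiable_comp dl df.
  have dflE := diff_compE (1 : R) dl df.
  have [d1 d2] := diff_coord j df.
  split; first exact: (differentiable_comp dl d1).
  rewrite (_ : g = (fun z => f z ord0 j) \o l)//.
  by rewrite (diff_compE (1 : R) dl d1) d2 dlE.
have [||s s01 e] := @MVT_segment R g (fun t => 'd f (l t) (y - x) ord0 j) 0 1 ler01.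
- move=> t; rewrite in_itv /= => /andP[/ltW t0 /ltW t1].
  have [d e] := gd t (introT andP (conj t0 t1)).
  by apply: DeriveDef; [exact: diff_derivable|rewrite deriveE].
- apply: continuous_in_subspaceT => t; rewrite inE/= in_itv /= => t01.
  by apply: differentiable_continuous; have [] := gd t t01.
rewrite !mxE; have := e; rewrite subr0 mulr1 /g /l scale1r scale0r addr0 subrKC => ->.
apply: le_trans (norm_coord _ _) _.
by have [] := h s s01.
Qed.

End RowNorm.

(** * The inverse function theorem *)

Lemma diff_idE (R : realType) (V : normedModType R) (x v : V) : 'd id x v = v.
Proof. by rewrite diff_val. Qed.

Lemma near_normP (R : realType) (V : normedModType R) (a : V) (P : V -> Prop) :
  (\forall x \near a, P x) -> exists2 d : R, 0 < d & forall x, `|x - a| < d -> P x.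
Proof.
move=> /nbhs_ballP[d /= d0 h]; exists d => // x xa; apply: h.
by rewrite -ball_normE /= distrC.
Qed.

Lemma lipschitz_continuous_at (R : realType) (V W : normedModType R) (g : V -> W)
    (y : V) (c : R) :
  (\forall z \near y, `|g z - g y| <= c * `|z - y|) -> {for y, continuous g}.
Proof.
move=> h; apply/cvgrPdist_le => e e0; near=> z; rewrite distrC.
(* [c] may be zero or negative, hence the division by a positive majorant. *)
have c1 : 0 < `|c| + 1 by rewrite ltr_wpDl.
apply: (@le_trans _ _ ((`|c| + 1) * `|z - y|)).
  apply: (@le_trans _ _ (c * `|z - y|)); first by near: z.
  by rewrite ler_wpM2r// (le_trans (ler_norm c))// lerDl.
rewrite -ler_pdivlMl// distrC mulrC; near: z; apply: cvgr_dist_le => //.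
by rewrite divr_gt0.
Unshelve. all: by end_near. Qed.

Lemma subr_continuous (R : realType) (V : normedModType R) (a : V) :
  continuous (fun y : V => y - a).
Proof. by move=> y; apply: cvgB; [exact: cvg_id|exact: cvg_cst]. Qed.

Section InverseFunction.
Context {R : realType} {n : nat} (f : 'rV[R]_n -> 'rV[R]_n).
Context (U : set 'rV[R]_n) (a : 'rV[R]_n) (A : 'M[R]_n).
Hypotheses (Uo : open U) (Ua : U a) (fU : smooth_on U f).
Hypothesis fA : forall v, 'd f a v *m A = v.

(* A inverts 'd f a, so that 'd phi a = 0: phi contracts a ball around a, and
   the solutions of f x = y are the fixed points of phi x + y *m A. *)
Let phi x := x - f x *m A.

Lemma smooth_differentiable x : U x -> differentiable f x.
Proof. by have := fU 1; rewrite class_CS => -[df _] Ux; exact: df. Qed.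

Let J x := lin1_mx ('d f x).

Let dfE x v : 'd f x v = v *m J x.
Proof. by rewrite mul_rV_lin1. Qed.

Lemma inverse_diff_unit : A \in unitmx.
Proof.
have JA : J a *m A = 1%:M.
  apply/row_matrixP => i; rewrite row_mul rowE -dfE fA.
  by rewrite row1.
by have [_] := mulmx1_unit JA.
Qed.

Lemma diff_phi x v : U x ->
  differentiable phi x /\ 'd phi x v = v - 'd f x v *m A.
Proof.
move=> /smooth_differentiable df.
have [d1 d2] := diff_mulmxr (- A) df.
have di : differentiable (id : 'rV[R]_n -> 'rV[R]_n) x by [].
have -> : phi = fun y => id y + f y *m (- A).
  by apply/funext => y; rewrite mulmxN.
split; first exact: (differentiableD di d1).
rewrite -mulmxN -[X in X + _](diff_idE x v) -(congr1 (fun F => F v) d2).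
exact (diffDE v di d1).
Qed.

(** The differential of [phi] vanishes at [a]. Only its values in fixed directions are known to be
    continuous, so the operator bound is assembled from the basis directions. *)
Lemma phi_small : exists2 d : R, 0 < d &
  forall x, `|x - a| <= d -> U x /\ forall v, `|'d phi x v| <= 2^-1 * `|v|.
Proof.
(* The n basis directions contribute at most n e <= 1/2 in total; [n.+1] keeps the inverse
   meaningful for n = 0. *)
pose e : R := (2 * n.+1%:R)^-1.
have e0 : 0 < e by rewrite invr_gt0 mulr_gt0.
pose D (j : 'I_n) x := delta_mx ord0 j - 'd f x (delta_mx ord0 j) *m A.
have Dc j : {for a, continuous (D j)}.
  have h := (fU 1); rewrite class_CS in h; have {h}[_ h] := h.
  have h1 := class_C_mulmxr (- A) Uo (h (delta_mx ord0 j)).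
  have h2 := class_CD Uo (class_C_cst 0 U (delta_mx ord0 j : 'rV[R]_n)) h1.
  have E x : U x -> delta_mx ord0 j + 'd f x (delta_mx ord0 j) *m - A = D j x.
    by move=> _; rewrite mulmxN.
  exact (near_eq_continuous (near_open Uo Ua E) (h2 a Ua)).
have Da j : D j a = 0 by rewrite /D fA subrr.
have hDj j : \forall x \near a, `|D j x| <= e.
  have := Dc j; rewrite /prop_for /continuous_at Da => /cvgr0Pnorm_le/(_ e e0).
  exact.
have hD : \forall x \near a, forall j, `|D j x| <= e by exact: filter_forall hDj.
have hU : \forall x \near a, U x by exact: open_nbhs_nbhs.
have [d d0 hd] := near_normP (filterI hD hU).
(* Halving the radius passes from the open ball of [near_normP] to a closed one, on which a
   contraction can be iterated. *)
exists (d / 2); first by rewrite divr_gt0.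
move=> x xd; have [|Dx Ux] := hd x.
  by rewrite (le_lt_trans xd)// ltr_pdivrMr// ltr_pMr// ltr1n.
split=> // v; have [_ ->] := diff_phi v Ux.
have -> : v - 'd f x v *m A = \sum_j v ord0 j *: D j x.
  rewrite {1 2}(row_sum_delta v) linear_sum mulmx_suml -sumrB.
  by apply: eq_bigr => j _; rewrite linearZ -scalemxAl scalerBr.
apply: (le_trans (ler_norm_sum _ _ _)).
apply: (@le_trans _ _ (\sum_(j < n) `|v| * e)).
  apply: ler_sum => j _; rewrite normrZ ler_pM//.
  exact: norm_coord.
have -> : \sum_(j < n) `|v| * e = (n%:R * e) * `|v|.
  by rewrite sumr_const card_ord -[LHS]mulr_natl; ring.
rewrite ler_wpM2r// /e invfM mulrC -mulrA ler_piMr ?invr_ge0// mulrC.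
by rewrite ler_pdivrMr// mul1r ler_nat.
Qed.

Section Ball.
Context (d : R) (d0 : 0 < d).
Hypothesis hd :
  forall x, `|x - a| <= d -> U x /\ forall v, `|'d phi x v| <= 2^-1 * `|v|.

Lemma phi_lipschitz x y : `|x - a| <= d -> `|y - a| <= d ->
  `|phi y - phi x| <= 2^-1 * `|y - x|.
Proof.
move=> xd yd; apply: mean_value_le => [|t /andP[t0 t1]]; first by rewrite mulr_ge0.
have td : `|x + t *: (y - x) - a| <= d.
  have -> : x + t *: (y - x) - a = (1 - t) *: (x - a) + t *: (y - a).
    by apply/rowP => j; rewrite !mxE; ring.
  rewrite (le_trans (ler_normD _ _))// !normrZ ger0_norm ?subr_ge0// ger0_norm//.
  rewrite [leRHS](_ : d = (1 - t) * d + t * d); last by rewrite -mulrDl subrK mul1r.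
  by rewrite lerD// ler_wpM2l// subr_ge0.
have [Ux hv] := hd td; split; last exact: hv.
by have [] := diff_phi 0 Ux.
Qed.

(** Since x = phi x + f x *m A, a displacement is the displacement of [phi], at most half of it,
    plus that of [f] times [A]; the half is absorbed. Besides injectivity this gives the Lipschitz
    bound of the inverse. *)
Lemma f_injective x y : `|x - a| <= d -> `|y - a| <= d ->
  `|y - x| <= 2 * `|(f y - f x) *m A|.
Proof.
move=> xd yd; have h := phi_lipschitz xd yd.
have E : y - x = (phi y - phi x) + (f y - f x) *m A.
  rewrite /phi mulmxBl; move: (f x *m A) (f y *m A) => p q.
  by apply/rowP => j; rewrite !mxE; ring.
have : `|y - x| <= 2^-1 * `|y - x| + `|(f y - f x) *m A|.
  by rewrite {1}E (le_trans (ler_normD _ _))// lerD2r.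
lra.
Qed.

(** The map [T] moves points of the closed ball of radius d by less than d from [a]: at most d/2
    comes from [phi] and less than d/2 from [y]. At a fixed point (y - f x) *m A = 0, and [A] is
    invertible. *)
Lemma f_surjective y : `|(y - f a) *m A| < d / 2 ->
  exists x, `|x - a| < d /\ f x = y.
Proof.
move=> yd; pose T x := phi x + y *m A.
pose B := closed_ball_ (fun x => `|x|) a d.
have BE x : B x = (`|x - a| <= d) :> Prop by rewrite /B /closed_ball_ /= distrC.
have Ta x : `|x - a| <= d -> `|T x - a| < d.
  move=> xd; have aad : `|a - a| <= d by rewrite subrr normr0 ltW.
  have -> : T x - a = (phi x - phi a) + (y - f a) *m A.
    rewrite /T /phi mulmxBl; move: (f x *m A) (f a *m A) (y *m A) => p q r.
    by apply/rowP => j; rewrite !mxE; ring.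
  rewrite (le_lt_trans (ler_normD _ _))//.
  have := phi_lipschitz aad xd; lra.
have TB : {homo T : x / B x >-> B x} by move=> x; rewrite !BE => /Ta/ltW.
(* Applicable because row spaces were declared complete normed modules at the outset. *)
have [|||x Bx xE] := @banach_fixed_point R _ B (mkfun TB).
- exists 2^-1%:nng; split; first by rewrite /=; lra.
  move=> [x z] [/= Bx Bz].
  have -> : T x - T z = phi x - phi z.
    by rewrite /T opprD addrACA subrr addr0.
  by apply: phi_lipschitz; rewrite -BE.
- exact: closed_closed_ball_.
- by exists a; rewrite BE subrr normr0 ltW.
have {}xE : x = T x := xE.
exists x; split; first by rewrite xE Ta// -BE.
have e1 (z : 'rV[R]_n) : (y - f z) *m A = T z - z.
  rewrite /T /phi mulmxBl; move: (f z *m A) (y *m A) => p q.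
  by apply/rowP => j; rewrite !mxE; ring.
have : (y - f x) *m A = 0 by rewrite e1; apply/eqP; rewrite subr_eq0 -xE.
by move/(congr1 (fun z => z *m invmx A)); rewrite mulmxK ?inverse_diff_unit// mul0mx
  => /subr0_eq.
Qed.

End Ball.

(** The inverse is chosen by [f_surjective] and is Lipschitz with constant 2k by [f_injective],
    where k bounds [A]. Multiplying the first order expansion of [f] at [g y] by [invmx (J (g y))]
    then yields the differential of [g]. *)
Theorem inverse_function : exists V W g,
  [/\ open V, open W, V a, V `<=` U & smooth_on W g] /\
  (forall x, V x -> W (f x) /\ g (f x) = x) /\
  (forall y, W y -> V (g y) /\ f (g y) = y).
Proof.
have [d d0 hd] := phi_small.
have [k k0 kA] := mulmx_lipschitz A.
pose W := [set y | `|(y - f a) *m A| < d / 2].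
(* Intersecting the ball with the preimage of [W] makes [f] and [g] inverse bijections between [V]
   and [W]. *)
pose V := [set x | `|x - a| < d /\ W (f x)].
pose g y := xget a [set x | `|x - a| < d /\ f x = y].
have gP y : W y -> `|g y - a| < d /\ f (g y) = y.
  move=> Wy; have ex : exists x, [set x | `|x - a| < d /\ f x = y] x.
    exact: (f_surjective d0 hd Wy).
  exact: (xgetPex a ex).
have gV y : W y -> V (g y) by move=> Wy; have [? e] := gP _ Wy; split; rewrite ?e.
have VU x : V x -> U x by move=> [/ltW/hd[]].
have Wo : open W.
  have Wc : continuous (fun y : 'rV[R]_n => `|mulmxr A (y - f a)|).
    move=> y; apply: continuous_comp; last exact: norm_continuous.
    apply: (@continuous_comp _ _ _ (fun y => y - f a) (mulmxr A)).
      exact: subr_continuous.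
    exact: mulmxr_continuous.
  exact: (open_comp (fun y _ => Wc y) (@open_lt _ (d / 2))).
have Vo : open V.
  rewrite openE => x Vx; have [xd Wx] := Vx.
  have fc := differentiable_continuous (smooth_differentiable (VU _ Vx)).
  have Wn : \forall z \near x, W (f z) by apply: fc; exact: open_nbhs_nbhs.
  have Bn : \forall z \near x, `|z - a| < d.
    apply: (@cvgr_lt _ _ _ (nbhs_filter x) (fun z => `|z - a|) `|x - a|) => //.
    exact: (@continuous_comp _ _ _ (fun z => z - a) _ x
              (@subr_continuous _ _ a x) (@norm_continuous _ _ _)).
  exact: filterI Bn Wn.
have gf x : V x -> g (f x) = x.
  move=> [xd Wx]; have [gd ge] := gP _ Wx; apply/eqP; rewrite -subr_eq0 -normr_le0.
  have := f_injective hd (ltW xd) (ltW gd).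
  by rewrite ge subrr mul0mx normr0 mulr0.
have glip y z : W y -> W z -> `|g z - g y| <= 2 * k * `|z - y|.
  move=> Wy Wz; have [gd ge] := gP _ Wy; have [gd' ge'] := gP _ Wz.
  apply: le_trans (f_injective hd (ltW gd) (ltW gd')) _.
  by rewrite ge ge' -mulrA ler_pM2l.
have Wn y : W y -> \forall z \near y, W z by move=> Wy; exact: open_nbhs_nbhs.
have gc y : W y -> {for y, continuous g}.
  move=> Wy; apply: (@lipschitz_continuous_at _ _ _ g y (2 * k)).
  by apply: filterS (Wn y Wy) => z; exact: glip.
(* If v *m J x = 0, then 'd phi x v = v, which a bound by half of the norm of [v] allows only for v
   = 0. *)
have Ju x : V x -> J x \in unitmx.
  move=> Vx; rewrite -row_free_unit -kermx_eq0; apply/rowV0P => v /sub_kermxP vJ.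
  have [_ /(_ v)] := hd _ (ltW Vx.1).
  have [_ ->] := diff_phi v (VU _ Vx).
  rewrite dfE vJ mul0mx subr0 => h; apply/eqP; rewrite -normr_le0.
  by have := normr_ge0 v; lra.
have gd y v : W y -> differentiable g y /\ 'd g y v = v *m invmx (J (g y)).
  move=> Wy; pose L := mulmxr (invmx (J (g y))) : {linear 'rV[R]_n -> 'rV[R]_n}.
  have Vx := gV y Wy; have [_ fgy] := gP y Wy.
  have [k' k'0 kJ] := mulmx_lipschitz (invmx (J (g y))).
  have Lc : continuous L by exact: mulmxr_continuous.
  have [|? E] := eps_differentiable (f := g) (x := y) Lc; last first.
    by split=> //; exact (congr1 (fun F => F v) E).
  (* The error of [f] gets multiplied by at most k' through [invmx (J (g y))], and displacements by
     at most 2k through [g]. *)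
  move=> e e0; pose e1 := e / (k' * (2 * k)).
  have e10 : 0 < e1 by rewrite divr_gt0// !mulr_gt0.
  have hf := differentiable_epsP (smooth_differentiable (VU _ Vx)) e10.
  have := gc y Wy _ hf; apply: filterS2 (Wn y Wy) => z Wz /=.
  have [_ fgz] := gP z Wz; rewrite fgy fgz dfE => hz.
  have -> : g z - g y - (z - y) *m invmx (J (g y)) =
      - ((z - y - (g z - g y) *m J (g y)) *m invmx (J (g y))).
    rewrite [in RHS]mulmxBl mulmxK ?Ju//.
    by rewrite opprB.
  rewrite normrN (le_trans (kJ _))// mulrC -ler_pdivlMr//.
  apply: (le_trans hz); apply: (@le_trans _ _ (e1 * (2 * k * `|z - y|))).
    by rewrite ler_wpM2l ?(ltW e10)// glip.
  rewrite /e1 le_eqVlt; apply/orP; left; apply/eqP; field.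
  by rewrite !gt_eqF.
exists V, W, g; split; [split=> //|].
- by split; [rewrite subrr normr0|rewrite /W /= subrr mul0mx normr0 divr_gt0].
(* Bootstrap: the differential of [g] is matrix inversion applied to [J] composed with [g], so it is
   of class C^l as soon as [g] is. *)
- elim=> [|l IH]; first exact gc.
  rewrite class_CS; split=> [y Wy|v]; first exact (gd y 0 Wy).1.
  have hJ i : class_C l V (fun x => row i (J x)).
    have := fU l.+1; rewrite class_CS => -[_ h].
    apply: (eq_class_C Vo _ (sub_class_C VU (h (delta_mx ord0 i)))) => x _.
    by rewrite rowE dfE.
  have h := class_C_comp Wo Vo gV IH (class_C_mulVmx Vo v Ju hJ).
  by apply: (eq_class_C Wo _ h) => y Wy; exact (esym (gd y v Wy).2).
- by split=> [x Vx|y Wy]; split; [exact: Vx.2|exact: gf|exact: gV|exact (gP y Wy).2].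
Qed.

End InverseFunction.

Lemma near_openP (T : topologicalType) (x : T) (P : T -> Prop) :
  (\forall y \near x, P y) -> exists U, [/\ open U, U x & forall y, U y -> P y].
Proof.
by move=> h; have : nbhs x P := h; rewrite nbhsE => -[V [Vo Vx] VP]; exists V.
Qed.

(** * Germs of smooth maps between row spaces *)

Section SmoothNear.
Context {R : realType}.

(** Leaving the neighbourhood unspecified allows composing maps that are meaningful only near a
    point without tracking domains. *)
Definition smooth_near m n (f : 'rV[R]_m -> 'rV[R]_n) (x : 'rV[R]_m) :=
  exists U, [/\ open U, U x & smooth_on U f].

Lemma smooth_near_continuous m n (f : 'rV[R]_m -> 'rV[R]_n) x :
  smooth_near f x -> {for x, continuous f}.
Proof. by move=> [U [_ Ux fU]]; exact: (fU 0 x Ux). Qed.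

Lemma smooth_near_differentiable m n (f : 'rV[R]_m -> 'rV[R]_n) x :
  smooth_near f x -> differentiable f x.
Proof. by move=> [U [_ Ux fU]]; have := fU 1; rewrite class_CS => -[h _]; exact: h. Qed.

Lemma near_smooth_near m n (f : 'rV[R]_m -> 'rV[R]_n) x :
  smooth_near f x -> \forall y \near x, smooth_near f y.
Proof.
by move=> [U [Uo Ux fU]]; apply: (near_open Uo Ux) => y Uy; exists U.
Qed.

Lemma smooth_on_near m n (U : set 'rV[R]_m) (f : 'rV[R]_m -> 'rV[R]_n) :
  (forall x, U x -> smooth_near f x) -> smooth_on U f.
Proof.
move=> h k; apply/class_C_pointP => x /h[V [_ Vx fV]].
by apply: (sub_class_C _ (fV k)) => y ->.
Qed.

Lemma smooth_near_eq m n (f g : 'rV[R]_m -> 'rV[R]_n) x :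
  (\forall y \near x, f y = g y) -> smooth_near f x -> smooth_near g x.
Proof.
move=> /near_openP[V [Vo Vx fg]] [U [Uo Ux fU]].
have UVo : open (U `&` V) by exact: openI.
exists (U `&` V); split=> // k; apply: (eq_class_C UVo _ (sub_class_C _ (fU k))).
  by move=> y [_]; exact: fg.
by move=> y [].
Qed.

Lemma open_preimage_at (T T' : topologicalType) (U : set T) (V : set T') f :
  open U -> open V -> (forall x, U x -> {for x, continuous f}) ->
  open (U `&` f @^-1` V).
Proof.
move=> Uo Vo fc; rewrite openE => x [Ux Vx]; apply: filterI.
  exact: open_nbhs_nbhs.
by apply: (fc x Ux); exact: open_nbhs_nbhs.
Qed.

Lemma smooth_near_comp m n p (f : 'rV[R]_m -> 'rV[R]_n)
    (g : 'rV[R]_n -> 'rV[R]_p) x :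
  smooth_near f x -> smooth_near g (f x) -> smooth_near (g \o f) x.
Proof.
move=> [U [Uo Ux fU]] [V [Vo Vx gV]].
have Wo := open_preimage_at Uo Vo (fU 0).
exists (U `&` f @^-1` V); split=> // k.
apply: (class_C_comp Wo Vo _ (sub_class_C _ (fU k)) (gV k)) => y [] //.
Qed.

Lemma smooth_near_cst m n (c : 'rV[R]_n) (x : 'rV[R]_m) :
  smooth_near (fun=> c) x.
Proof. by exists setT; split=> // [|k]; [exact: openT|exact: class_C_cst]. Qed.

Lemma smooth_near_id m (x : 'rV[R]_m) : smooth_near id x.
Proof. by exists setT; split=> // [|k]; [exact: openT|exact: class_C_id]. Qed.

Lemma smooth_near_mulmxr m n p (f : 'rV[R]_m -> 'rV[R]_n) (C : 'M[R]_(n, p)) x :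
  smooth_near f x -> smooth_near (fun y => f y *m C) x.
Proof.
by move=> [U [Uo Ux fU]]; exists U; split=> // k; exact: class_C_mulmxr.
Qed.

Lemma smooth_nearD m n (f g : 'rV[R]_m -> 'rV[R]_n) x :
  smooth_near f x -> smooth_near g x -> smooth_near (fun y => f y + g y) x.
Proof.
move=> [U [Uo Ux fU]] [V [Vo Vx gV]]; have UVo : open (U `&` V) by exact: openI.
exists (U `&` V); split=> // k.
by apply: (class_CD UVo (sub_class_C _ (fU k)) (sub_class_C _ (gV k))) => y [].
Qed.

Lemma smooth_nearB m n (f g : 'rV[R]_m -> 'rV[R]_n) x :
  smooth_near f x -> smooth_near g x -> smooth_near (fun y => f y - g y) x.
Proof.
move=> hf hg; have := smooth_nearD hf (smooth_near_mulmxr (- 1%:M) hg).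
by under eq_fun do rewrite mulmxN mulmx1.
Qed.

(** Joining and cutting blocks are linear operations; here and below they are written as products
    with constant block matrices. *)
Lemma smooth_near_row_mx m n p (f : 'rV[R]_m -> 'rV[R]_n)
    (g : 'rV[R]_m -> 'rV[R]_p) x :
  smooth_near f x -> smooth_near g x ->
  smooth_near (fun y => row_mx (f y) (g y)) x.
Proof.
move=> hf hg; have := smooth_nearD
  (smooth_near_mulmxr (row_mx 1%:M 0) hf) (smooth_near_mulmxr (row_mx 0 1%:M) hg).
under eq_fun do rewrite !mul_mx_row !mulmx1 !mulmx0 add_row_mx addr0 add0r.
by [].
Qed.

Lemma smooth_near_lsubmx m n p (f : 'rV[R]_m -> 'rV[R]_(n + p)) x :
  smooth_near f x -> smooth_near (fun y => lsubmx (f y)) x.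
Proof.
move=> hf; have := smooth_near_mulmxr (col_mx 1%:M 0) hf.
under eq_fun do rewrite -[X in X *m _]hsubmxK mul_row_col mulmx1 mulmx0 addr0.
by [].
Qed.

Lemma smooth_near_rsubmx m n p (f : 'rV[R]_m -> 'rV[R]_(n + p)) x :
  smooth_near f x -> smooth_near (fun y => rsubmx (f y)) x.
Proof.
move=> hf; have := smooth_near_mulmxr (col_mx 0 1%:M) hf.
under eq_fun do rewrite -[X in X *m _]hsubmxK mul_row_col mulmx1 mulmx0 add0r.
by [].
Qed.

Lemma smooth_near_sum m n I (r : seq I) (f : I -> 'rV[R]_m -> 'rV[R]_n) x :
  (forall i, smooth_near (f i) x) ->
  smooth_near (fun y => \sum_(i <- r) f i y) x.
Proof.
move=> hf; elim: r => [|i r IH].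
  by under eq_fun do rewrite big_nil; exact: smooth_near_cst.
by under eq_fun do rewrite big_cons; exact: smooth_nearD.
Qed.

Lemma smooth_near_mxrow m n (p : 'I_n -> nat)
    (f : forall i, 'rV[R]_m -> 'rV[R]_(p i)) x :
  (forall i, smooth_near (f i) x) -> smooth_near (fun y => \mxrow_i f i y) x.
Proof.
move=> hf; pose E i := submxcol (1%:M : 'M[R]_(\sum_i p i)) i.
have h := smooth_near_sum (index_enum _) (fun i => smooth_near_mulmxr (E i) (hf i)).
apply: (smooth_near_eq _ h); apply: (near_open openT) => // y _.
by rewrite -mul_mxrow_mxcol submxcolK mulmx1.
Qed.

Lemma smooth_near_submxrow m n (p : 'I_n -> nat)
    (f : 'rV[R]_m -> 'rV[R]_(\sum_i p i)) i x :
  smooth_near f x -> smooth_near (fun y => submxrow (f y) i) x.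
Proof.
move=> hf; have := smooth_near_mulmxr (submxrow 1%:M i) hf.
by under eq_fun do rewrite mul_submxrow mulmx1.
Qed.

End SmoothNear.

Lemma near_continuous (T T' : topologicalType) (f : T -> T') x (P : T' -> Prop) :
  {for x, continuous f} -> (\forall y \near f x, P y) -> \forall z \near x, P (f z).
Proof. by move=> fc h; exact: fc. Qed.

(** * Charts and smooth maps *)

Section Charts.
Context {R : realType}.

(** A germwise inverse gives injectivity, and also openness: the preimage of [V] under [g] is a
    neighbourhood of each image point, and near that point its elements are images of points of [V].
    Restricted and product charts are verified in this way. *)
Lemma is_chart_inverse (T : topologicalType) (c : chart R T) (g : 'rV[R]_(chart_dim c) -> T) :
  open (chart_dom c) ->
  (forall x, chart_dom c x -> [/\ g (chart_map c x) = x,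
     {for x, continuous (chart_map c)},
     {for chart_map c x, continuous g} &
     \forall w \near chart_map c x, chart_map c (g w) = w]) ->
  is_chart c.
Proof.
move=> Do h; split=> //.
- move=> x y; rewrite !inE => Dx Dy e.
  by have [<- _ _ _] := h x Dx; rewrite e; have [-> _ _ _] := h y Dy.
- by move=> x /h[].
- move=> V Vo VD; rewrite openE => _ [x Vx <-].
  have [gx cc gc near_id] := h x (VD x Vx).
  have Vg : \forall w \near chart_map c x, V (g w).
    by apply: gc; rewrite gx; exact: open_nbhs_nbhs.
  by apply: filterS2 near_id Vg => w gw Vw; exists (g w).
Qed.

(** The default [x0] is returned outside the image of the chart; only the germs at points of the
    image matter. *)
Definition chart_inv (T : topologicalType) (c : chart R T) (x0 : T) w :=
  xget x0 [set x | chart_dom c x /\ chart_map c x = w].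

Arguments chart_inv {T} c x0 w.

Section Chart.
Context {T : topologicalType} (c : chart R T) (cc : is_chart c) (x0 : T).

Lemma chart_invP x : chart_dom c x ->
  chart_dom c (chart_inv c x0 (chart_map c x)) /\
  chart_map c (chart_inv c x0 (chart_map c x)) = chart_map c x.
Proof.
move=> Dx; have ex : exists y, [set y | chart_dom c y /\ chart_map c y = chart_map c x] y.
  by exists x.
exact: (xgetPex x0 ex).
Qed.

Lemma chart_mapK x : chart_dom c x -> chart_inv c x0 (chart_map c x) = x.
Proof.
move=> Dx; have [h1 h2] := chart_invP Dx; have [_ inj _ _] := cc.
by apply: inj; rewrite ?inE.
Qed.

Lemma near_chart_image x : chart_dom c x ->
  \forall w \near chart_map c x, exists2 y, chart_dom c y & chart_map c y = w.
Proof.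
move=> Dx; have [Do _ _ om] := cc.
apply: (near_open (om _ Do (fun _ h => h))); first by exists x.
by move=> _ [y Dy <-]; exists y.
Qed.

Lemma chart_invK x : chart_dom c x ->
  \forall w \near chart_map c x, chart_map c (chart_inv c x0 w) = w.
Proof.
by move=> /near_chart_image; apply: filterS => _ [y /chart_invP[_ +] <-].
Qed.

Lemma chart_inv_continuous x : chart_dom c x ->
  {for chart_map c x, continuous (chart_inv c x0)}.
Proof.
move=> Dx V; rewrite chart_mapK// => nV; have [Do _ _ om] := cc.
have DVo : open (chart_dom c `&` V°) by apply: openI => //; exact: open_interior.
have img : (chart_map c @` (chart_dom c `&` V°)) (chart_map c x) by exists x.
have oimg : open (chart_map c @` (chart_dom c `&` V°)) by apply: om => // y [].
apply: (near_open oimg img) => _ [y [Dy Vy] <-].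
by rewrite /= chart_mapK//; exact: nbhs_singleton Vy.
Qed.

End Chart.

(** The part of [manifold] that governs smoothness of maps. Subspaces and products receive it before
    their topology and dimension are studied. *)
Record smooth_atlas (N : premanifold R) : Prop := SmoothAtlas {
  atlas_cover : forall x : N, exists2 c, atlas c & chart_dom c x;
  atlas_chart : forall c : chart R N, atlas c -> is_chart c;
  atlas_compat : forall c c' : chart R N,
    atlas c -> atlas c' -> smooth_transition c c' }.

Lemma manifold_smooth_atlas (N : premanifold R) : manifold N -> smooth_atlas N.
Proof. by case. Qed.

Lemma atlas_maximal (N : premanifold R) (c : chart R N) :
  smooth_atlas N -> atlas c -> maximal_atlas c.
Proof.
move=> hN ac; split; first exact: (atlas_chart hN).
by move=> c' ac'; split; exact: (atlas_compat hN).
Qed.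

Definition near_transition (T : topologicalType) (c c' : chart R T) (x : T) :=
  exists f : 'rV[R]_(chart_dim c) -> 'rV[R]_(chart_dim c'),
    smooth_near f (chart_map c x) /\
    \forall y \near x, f (chart_map c y) = chart_map c' y.

Lemma near_transition_of (T : topologicalType) (c c' : chart R T) x :
  is_chart c -> is_chart c' -> smooth_transition c c' ->
  chart_dom c x -> chart_dom c' x -> near_transition c c' x.
Proof.
move=> [Do _ _ om] [D'o _ _ _] [f [fs fE]] Dx D'x.
have DDo : open (chart_dom c `&` chart_dom c') by exact: openI.
exists f; split.
  exists (chart_map c @` (chart_dom c `&` chart_dom c')); split=> //.
    by apply: om => // y [].
  by exists x.
by apply: (near_open DDo (conj Dx D'x)) => y [Dy D'y]; exact: fE.
Qed.

Lemma near_transition_trans (T : topologicalType) (c1 c2 c3 : chart R T) x :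
  near_transition c1 c2 x -> near_transition c2 c3 x -> near_transition c1 c3 x.
Proof.
move=> [f [fs fE]] [g [gs gE]]; exists (g \o f); split.
  by apply: smooth_near_comp => //; rewrite (nbhs_singleton fE).
by apply: filterS2 fE gE => y /= -> ->.
Qed.

(** Charts of the maximal atlas are compared only with charts of [atlas], so the transition goes
    through one of the latter around [x]. *)
Lemma maximal_transition (N : premanifold R) (c c' : chart R N) x :
  smooth_atlas N -> maximal_atlas c -> maximal_atlas c' ->
  chart_dom c x -> chart_dom c' x -> near_transition c c' x.
Proof.
move=> hN [cc hc] [cc' hc'] Dx D'x; have [c0 ac0 D0x] := atlas_cover hN x.
have [h1 _] := hc _ ac0; have [_ h2] := hc' _ ac0; have cc0 := atlas_chart hN ac0.
apply: (near_transition_trans (near_transition_of cc cc0 h1 Dx D0x)).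
exact: (near_transition_of cc0 cc' h2 D0x D'x).
Qed.

Lemma smooth_transition_of (T : topologicalType) (c c' : chart R T) :
  is_chart c ->
  (forall x, chart_dom c x -> chart_dom c' x -> near_transition c c' x) ->
  smooth_transition c c'.
Proof.
(* [chart_inv] needs a default point, so the empty space is treated apart. *)
move=> cc h; have [[x0 _]|no] := pselect (exists x0 : T, True); last first.
  exists (fun=> 0); split=> [|x]; last by case: no; exists x.
  by apply: smooth_on_near => w [x]; case: no; exists x.
exists (chart_map c' \o chart_inv c x0); split; last first.
  by move=> x Dx _; rewrite /= chart_mapK.
apply: smooth_on_near => _ [x [Dx D'x] <-].
have [f [fs fE]] := h x Dx D'x; apply: smooth_near_eq fs.
have hE : \forall w \near chart_map c x,
    f (chart_map c (chart_inv c x0 w)) = chart_map c' (chart_inv c x0 w).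
  rewrite -{1}(chart_mapK cc x0 Dx) in fE.
  exact (near_continuous (chart_inv_continuous cc (x0 := x0) Dx) fE).
by apply: filterS2 (chart_invK cc x0 Dx) hE => w e; rewrite e.
Qed.

Definition restrict_dom (T : Type) (c : chart R T) (V : set T) : chart R T :=
  Chart (chart_dom c `&` V) (chart_map c).

Lemma restrict_dom_chart (T : topologicalType) (c : chart R T) V :
  is_chart c -> open V -> is_chart (restrict_dom c V).
Proof.
move=> [Do inj ct om] Vo; split.
- exact: openI.
- by move=> x y; rewrite !inE => -[Dx _] [Dy _]; apply: inj; rewrite inE.
- by move=> x [Dx _]; exact: ct.
- by move=> W Wo WD; apply: om => // x /WD[].
Qed.

Lemma restrict_dom_maximal (N : premanifold R) (c : chart R N) V :
  maximal_atlas c -> open V -> maximal_atlas (restrict_dom c V).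
Proof.
move=> [cc h] Vo; split=> [|c' /h[[f [fs fE]] [g [gs gE]]]].
  exact: restrict_dom_chart.
split; [exists f|exists g]; split.
- by move=> k; apply: sub_class_C (fs k) => _ [x [[Dx _] D'x] <-]; exists x.
- by move=> x [Dx _]; exact: fE.
- by move=> k; apply: sub_class_C (gs k) => _ [x [D'x [Dx _]] <-]; exists x.
- by move=> x D'x [Dx _]; exact: gE.
Qed.

End Charts.

Arguments chart_inv {R T} c x0 w.

(** * Smoothness at a point *)

Section SmoothAt.
Context {R : realType}.
Implicit Types N : premanifold R.

(** In contrast with [local_representative], [F] has to map into the domain of [c'] only near [x],
    so the chart [c] need not be shrunk in advance. *)
Definition smooth_at N N' (F : N -> N') (x : N) := exists c c' f,
  [/\ maximal_atlas c, maximal_atlas c', chart_dom c x, chart_dom c' (F x) &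
      smooth_near f (chart_map c x)] /\
  \forall y \near x, chart_dom c' (F y) /\ f (chart_map c y) = chart_map c' (F y).

Lemma smooth_at_continuous N N' (F : N -> N') x :
  smooth_at F x -> {for x, continuous F}.
Proof.
move=> [c [c' [f [[[cc _] [cc' _] Dx D'x fs] fE]]]] V nV.
have [_ _ ct _] := cc; have [D'o inj' _ om'] := cc'.
have DVo : open (chart_dom c' `&` V°) by apply: openI => //; exact: open_interior.
have oimg : open (chart_map c' @` (chart_dom c' `&` V°)) by apply: om' => // y [].
have img : (chart_map c' @` (chart_dom c' `&` V°)) (f (chart_map c x)).
  by exists (F x) => //; rewrite (nbhs_singleton fE).2.
have h1 := near_continuous (smooth_near_continuous fs) (near_open oimg img (fun _ h => h)).
have h2 := near_continuous (ct x Dx) h1.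
apply: filterS2 h2 fE => y [z [Dz Vz] e] [DFy fy].
have Fyz : F y = z by apply: inj'; rewrite ?inE// -fy e.
by rewrite /preimage /= Fyz; exact: nbhs_singleton Vz.
Qed.

Lemma smooth_at_charts N N' (F : N -> N') x c c' :
  smooth_atlas N -> smooth_atlas N' -> maximal_atlas c -> maximal_atlas c' ->
  chart_dom c x -> chart_dom c' (F x) -> smooth_at F x ->
  exists f, smooth_near f (chart_map c x) /\
    \forall y \near x, chart_dom c' (F y) /\ f (chart_map c y) = chart_map c' (F y).
Proof.
move=> hN hN' mc mc' Dx D'x Fs; have Fc := smooth_at_continuous Fs.
have [c1 [c1' [f [[mc1 mc1' D1x D1'x fs] fE]]]] := Fs.
have [g [gs gE]] := maximal_transition hN mc mc1 Dx D1x.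
have [g' [g's g'E]] := maximal_transition hN' mc1' mc' D1'x D'x.
have [_ fEx] := nbhs_singleton fE; have gEx := nbhs_singleton gE.
exists (g' \o (f \o g)); split.
  rewrite -gEx in fs fEx; rewrite -fEx in g's.
  exact (smooth_near_comp (smooth_near_comp gs fs) g's).
have [[D'o _ _ _] _] := mc'.
have h1 := near_continuous Fc (near_open D'o D'x (fun _ h => h)).
have h2 := near_continuous Fc g'E.
apply: filterS2 (filterI h1 h2) (filterI gE fE) => y [D'y g'y] [gy [_ fy]].
by split=> //=; rewrite gy fy.
Qed.

(** From right to left the source chart is cut down until [F] maps it into [c'] and its image lies
    where [f] is smooth. *)
Lemma smooth_mapP N N' (F : N -> N') :
  smooth_map F <-> forall x, smooth_at F x.
Proof.
split=> h x.
  have [c [c' [f [[mc mc' dd fE fs] Dx]]]] := h x.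
  have [[Do _ _ om] _] := mc.
  have sf : smooth_near f (chart_map c x).
    by exists (chart_map c @` chart_dom c); split=> //; exact: om.
  exists c, c', f; split; first (split=> //; exact: dd).
  by apply: (near_open Do Dx) => y Dy; split; [exact: dd|exact: fE].
have [c [c' [f [[mc mc' Dx D'x [W [Wo Wx fW]]] fE]]]] := h x.
have [V [Vo Vx hV]] := near_openP fE.
have [[Do _ ct _] _] := mc.
have cW := near_continuous (ct x Dx) (near_open Wo Wx (fun _ h => h)).
have [V' [V'o V'x hV']] := near_openP cW.
have VVo : open (V `&` V') by exact: openI.
exists (restrict_dom c (V `&` V')), c', f; split=> //; split=> //.
- exact: restrict_dom_maximal.
- by move=> y [Dy [Vy _]]; have [] := hV y Vy.
- by move=> y [Dy [Vy _]]; have [] := hV y Vy.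
- by move=> k; apply: sub_class_C (fW k) => _ [y [Dy [_ V'y]] <-]; exact: hV'.
Qed.

Lemma smooth_at_eq N N' (F G : N -> N') x :
  (\forall y \near x, F y = G y) -> smooth_at F x -> smooth_at G x.
Proof.
move=> FG [c [c' [f [[mc mc' Dx D'x fs] fE]]]].
exists c, c', f; rewrite -(nbhs_singleton FG); split=> //.
by apply: filterS2 FG fE => y <-.
Qed.

Lemma near_smooth_at N N' (F : N -> N') x :
  smooth_at F x -> \forall y \near x, smooth_at F y.
Proof.
move=> [c [c' [f [[mc mc' Dx D'x fs] fE]]]].
have [[Do _ ct _] _] := mc; have [V [Vo Vx hV]] := near_openP fE.
have h := near_continuous (ct x Dx) (near_smooth_near fs).
have h1 := near_open Vo Vx (fun _ h => h).
have h2 := near_open Do Dx (fun _ h => h).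
near=> y; exists c, c', f; split; first split=> //.
- by near: y.
- have Vy : V y by near: y.
  by have [] := hV y Vy.
- by near: y.
- have Vy : V y by near: y.
  exact: near_open Vo Vy hV.
Unshelve. all: by end_near. Qed.

Lemma smooth_at_comp N N' N'' (F : N -> N') (G : N' -> N'') x :
  smooth_atlas N -> smooth_atlas N' -> smooth_atlas N'' ->
  smooth_at F x -> smooth_at G (F x) -> smooth_at (G \o F) x.
Proof.
move=> hN hN' hN'' Fs Gs.
have [c ac Dx] := atlas_cover hN x; have mc := atlas_maximal hN ac.
have [c' ac' D'x] := atlas_cover hN' (F x); have mc' := atlas_maximal hN' ac'.
have [c'' ac'' D''x] := atlas_cover hN'' (G (F x)); have mc'' := atlas_maximal hN'' ac''.
have [f [fs fE]] := smooth_at_charts hN hN' mc mc' Dx D'x Fs.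
have [g [gs gE]] := smooth_at_charts hN' hN'' mc' mc'' D'x D''x Gs.
have [_ fEx] := nbhs_singleton fE.
exists c, c'', (g \o f); split.
  by split=> //; apply: smooth_near_comp => //; rewrite fEx.
apply: filterS2 fE (near_continuous (smooth_at_continuous Fs) gE) => y.
by move=> [_ fEy] [D gEy]; split=> //=; rewrite fEy.
Qed.

Lemma smooth_at_cst N N' (a : N') (x : N) : smooth_atlas N -> smooth_atlas N' ->
  smooth_at (fun=> a) x.
Proof.
move=> hN hN'; have [c ac Dx] := atlas_cover hN x; have mc := atlas_maximal hN ac.
have [c' ac' Da] := atlas_cover hN' a; have mc' := atlas_maximal hN' ac'.
exists c, c', (fun=> chart_map c' a); split; first split=> //.
  exact: smooth_near_cst.
by apply: (near_open openT).
Qed.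

(** With row spaces as premanifolds, charts, their inverses and coordinate functions all become maps
    to which [smooth_at] applies. *)
Definition euclid n : premanifold R :=
  @PreManifold R 'rV[R]_n [set Chart [set: 'rV[R]_n] id].

Lemma euclid_smooth_atlas n : smooth_atlas (euclid n).
Proof.
split.
- by move=> x; exists (Chart [set: 'rV[R]_n] id).
- move=> _ ->; apply: (@is_chart_inverse R (euclid n) (Chart [set: 'rV[R]_n] id) id).
    exact: openT.
  by move=> x _; split=> //; try exact: cvg_id; exact: (near_open openT).
- move=> _ _ -> ->; exists id; split=> // k; exact: class_C_id.
Qed.

Lemma euclid_chart n : maximal_atlas (Chart [set: 'rV[R]_n] id : chart R (euclid n)).
Proof. exact: atlas_maximal (euclid_smooth_atlas n) _. Qed.

Lemma smooth_at_euclid m n (f : euclid m -> euclid n) x :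
  smooth_at f x <-> smooth_near f x.
Proof.
split=> h; last first.
  exists (Chart [set: 'rV[R]_m] id), (Chart [set: 'rV[R]_n] id), f.
  split; last exact: (near_open openT).
  by split=> //; exact: euclid_chart.
have [||g [gs gE]] := smooth_at_charts (euclid_smooth_atlas m) (euclid_smooth_atlas n)
  (euclid_chart m) (euclid_chart n) _ _ h => //.
by apply: smooth_near_eq gs; apply: filterS gE => y [].
Qed.

Lemma smooth_at_chart N (c : chart R N) x : smooth_atlas N -> maximal_atlas c ->
  chart_dom c x -> smooth_at (chart_map c : N -> euclid (chart_dim c)) x.
Proof.
move=> hN mc Dx; exists c, (Chart [set: 'rV[R]_(chart_dim c)] id), id.
split; last exact: (near_open openT).
by split=> //; [exact: euclid_chart|exact: smooth_near_id].
Qed.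

Lemma smooth_at_chart_inv N (c : chart R N) x0 x : smooth_atlas N ->
  maximal_atlas c -> chart_dom c x ->
  smooth_at (chart_inv c x0 : euclid (chart_dim c) -> N) (chart_map c x).
Proof.
move=> hN mc Dx; have [cc _] := mc; have [Do _ _ _] := cc.
exists (Chart [set: 'rV[R]_(chart_dim c)] id), c, id; rewrite chart_mapK//; split.
  by split=> //; [exact: euclid_chart|exact: smooth_near_id].
have h1 := chart_invK cc x0 Dx.
have h2 : \forall w \near chart_map c x, chart_dom c (chart_inv c x0 w).
  have Dn := near_open Do Dx (fun _ h => h); rewrite -(chart_mapK cc x0 Dx) in Dn.
  exact (near_continuous (chart_inv_continuous cc (x0 := x0) Dx) Dn).
by apply: filterS2 h1 h2 => w /= -> .
Qed.

End SmoothAt.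

(** * Local diffeomorphisms, dimension, and charts *)

Section LocalDiffeo.
Context {R : realType}.
Implicit Types N : premanifold R.

Definition local_diffeo N N' (F : N -> N') (F' : N' -> N) (x : N) :=
  [/\ smooth_at F x, smooth_at F' (F x), \forall y \near x, F' (F y) = y &
      \forall z \near F x, F (F' z) = z].

Lemma near_near (T : topologicalType) (x : T) (P : T -> Prop) :
  (\forall y \near x, P y) -> \forall y \near x, \forall z \near y, P z.
Proof.
by move=> /near_openP[U [Uo Ux UP]]; apply: (near_open Uo Ux) => y Uy; exact: near_open Uo Uy UP.
Qed.

Lemma near_local_diffeo N N' (F : N -> N') (F' : N' -> N) x :
  local_diffeo F F' x -> \forall y \near x, local_diffeo F F' y.
Proof.
move=> [Fs F's K K']; have Fc := smooth_at_continuous Fs.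
have h1 := near_smooth_at Fs.
have h2 := near_continuous Fc (near_smooth_at F's).
have h3 := near_near K; have h4 := near_continuous Fc (near_near K').
by apply: filterS2 (filterI h1 h2) (filterI h3 h4) => y [? ?] [? ?]; split.
Qed.

Lemma local_diffeo_sym N N' (F : N -> N') (F' : N' -> N) x :
  local_diffeo F F' x -> local_diffeo F' F (F x).
Proof. by move=> [Fs F's K K']; split=> //; rewrite (nbhs_singleton K). Qed.

Lemma local_diffeo_comp N N' N'' (F : N -> N') (F' : N' -> N) (G : N' -> N'')
    (G' : N'' -> N') x :
  smooth_atlas N -> smooth_atlas N' -> smooth_atlas N'' ->
  local_diffeo F F' x -> local_diffeo G G' (F x) ->
  local_diffeo (G \o F) (F' \o G') x.
Proof.
move=> hN hN' hN'' [Fs F's FK FK'] [Gs G's GK GK'].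
have Gx : G' (G (F x)) = F x := nbhs_singleton GK.
have G'c := smooth_at_continuous G's.
split.
- exact: smooth_at_comp.
- by apply: smooth_at_comp => //=; rewrite Gx.
- by apply: filterS2 FK (near_continuous (smooth_at_continuous Fs) GK) => y /= + ->.
- rewrite -Gx in FK'.
  by apply: filterS2 GK' (near_continuous G'c FK') => z /= + ->.
Qed.

Lemma chart_local_diffeo N (c : chart R N) x0 x : smooth_atlas N ->
  maximal_atlas c -> chart_dom c x ->
  local_diffeo (chart_map c : N -> euclid (chart_dim c)) (chart_inv c x0) x.
Proof.
move=> hN mc Dx; have [cc _] := mc; have [Do _ _ _] := cc; split.
- exact: smooth_at_chart.
- exact: smooth_at_chart_inv.
- by apply: (near_open Do Dx) => y; exact: chart_mapK.
- exact: chart_invK.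
Qed.

Lemma local_diffeo_maximal N n (F : N -> euclid n) F' x (V0 : set N) :
  smooth_atlas N -> local_diffeo F F' x -> open V0 -> V0 x ->
  exists V, [/\ open V, V x, V `<=` V0 & @maximal_atlas R N (Chart V F)].
Proof.
move=> hN /near_local_diffeo/near_openP[V [Vo Vx hV]] V0o V0x.
have he := @euclid_smooth_atlas R n.
have VV0 : open (V `&` V0) by exact: openI.
suff mF : @maximal_atlas R N (Chart (V `&` V0) F).
  by exists (V `&` V0); split=> // y [].
have cF : is_chart (@Chart R N n (V `&` V0) F).
  apply: (@is_chart_inverse R N (@Chart R N n (V `&` V0) F) F') => //.
  move=> y [/hV[Fs F's K K'] _]; split=> //.
  - exact: nbhs_singleton K.
  - exact: smooth_at_continuous Fs.
  - exact: smooth_at_continuous F's.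
split=> // c ac; have mc := atlas_maximal hN ac.
have cc := atlas_chart hN ac.
have FK y : V y -> F' (F y) = y by move=> /hV[_ _ /nbhs_singleton].
split.
  exists (chart_map c \o F'); split; last by move=> y [Vy _] _ /=; rewrite FK.
  apply: smooth_on_near => _ [y [[Vy _] Dy] <-]; have [Fs F's _ _] := hV y Vy.
  apply/smooth_at_euclid; apply: (smooth_at_comp (N' := N)) => //.
    exact: euclid_smooth_atlas.
  by rewrite /= FK//; exact: smooth_at_chart.
exists (F \o chart_inv c x); split; last by move=> y Dy _ /=; rewrite chart_mapK.
apply: smooth_on_near => _ [y [Dy [Vy _]] <-]; have [Fs _ _ _] := hV y Vy.
apply/smooth_at_euclid; apply: (smooth_at_comp (N' := N)) => //.
- exact: euclid_smooth_atlas.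
- exact: smooth_at_chart_inv.
- by rewrite chart_mapK.
Qed.

(** Chain rule for a composite that is the identity near [x]. Matrices act on rows from the right,
    so the differential of the inner map comes first. *)
Lemma diff_near_id m n (f : 'rV[R]_m -> 'rV[R]_n) (g : 'rV[R]_n -> 'rV[R]_m) x :
  smooth_near f x -> smooth_near g (f x) ->
  (\forall y \near x, g (f y) = y) ->
  lin1_mx ('d f x) *m lin1_mx ('d g (f x)) = 1%:M.
Proof.
move=> fs gs gf; have df := smooth_near_differentiable fs.
have dg := smooth_near_differentiable gs.
have idgf : \forall y \near x, id y = (g \o f) y by apply: filterS gf => y gfy; exact (esym gfy).
have di : differentiable (id : 'rV[R]_m -> 'rV[R]_m) x by [].
have [_ dE] := near_eq_differentiable idgf di.
apply/row_matrixP => i; rewrite row_mul row1 rowE.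
have E := diff_compE (delta_mx ord0 i) df dg.
rewrite (congr1 (fun F => F _) dE) diff_idE in E.
by rewrite mul_rV_lin1 mul_rV_lin1 -E.
Qed.

(** The differentials have product 1 in both orders, and each product bounds one dimension by the
    other. *)
Lemma local_diffeo_dim m n (F : euclid m -> euclid n) F' x :
  @local_diffeo (euclid m) (euclid n) F F' x -> m = n.
Proof.
move=> [/smooth_at_euclid Fs /smooth_at_euclid F's K K'].
have h1 := diff_near_id Fs F's K.
rewrite -(nbhs_singleton K) in Fs.
have h2 := diff_near_id F's Fs K'.
by apply/eqP; rewrite eqn_leq (mulmx1_min h1) (mulmx1_min h2).
Qed.

Definition has_dim N d :=
  forall c : chart R N, atlas c -> chart_dom c !=set0 -> chart_dim c = d.

Lemma chart_dim_unique N n (F : N -> euclid n) F' (c : chart R N) x :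
  smooth_atlas N -> local_diffeo F F' x -> maximal_atlas c -> chart_dom c x ->
  chart_dim c = n.
Proof.
move=> hN hF mc Dx; have he := @euclid_smooth_atlas R.
have hc := local_diffeo_sym (chart_local_diffeo x hN mc Dx).
have [cc _] := mc; rewrite -(chart_mapK cc x Dx) in hF.
exact (local_diffeo_dim (local_diffeo_comp (he _) hN (he _) hc hF)).
Qed.

Lemma has_dim_chart N d x : smooth_atlas N -> has_dim N d ->
  exists (F : N -> euclid d) F', local_diffeo F F' x.
Proof.
move=> hN hd; have [c ac Dx] := atlas_cover hN x.
have := chart_local_diffeo x hN (atlas_maximal hN ac) Dx.
have <- : chart_dim c = d by apply: hd => //; exists x.
by move=> h; exists (chart_map c), (chart_inv c x).
Qed.

(** The equality of dimensions is a hypothesis because they arise as different expressions, such as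
    d and k + m. *)
Lemma local_inverse n p (f : 'rV[R]_n -> 'rV[R]_p) a (A : 'M[R]_(p, n)) :
  n = p -> smooth_near f a -> (forall v, 'd f a v *m A = v) ->
  exists g, @local_diffeo (euclid n) (euclid p) f g a.
Proof.
move=> e; case: _ / e f A => f A fs fA; have [U [Uo Ua fU]] := fs.
have [V [W [g [[Vo Wo Va VU gW] [fg gf]]]]] := inverse_function Uo Ua fU fA.
have [Wfa _] := fg a Va.
exists g; split.
- exact/smooth_at_euclid.
- by apply/smooth_at_euclid; exists W.
- by apply: (near_open Vo Va) => y /fg[].
- by apply: (near_open Wo Wfa) => y /gf[].
Qed.

(** P = 1 - D T projects onto the rows killed by [D]. Its rank factorization P = C B completes [D]
    to the invertible matrix (C D), whose inverse has the blocks [B] and [T]. *)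
Lemma complement_matrix d m (D : 'M[R]_(d, m)) (T : 'M[R]_(m, d)) :
  T *m D = 1%:M ->
  exists k (C : 'M[R]_(d, k)) (B : 'M[R]_(k + m, d)),
    d = (k + m)%N /\ row_mx C D *m B = 1%:M.
Proof.
move=> TD; pose P : 'M[R]_d := 1%:M - D *m T.
have TP : T *m P = 0 by rewrite mulmxBr mulmx1 mulmxA TD mul1mx subrr.
have PD : P *m D = 0 by rewrite mulmxBl mul1mx -mulmxA TD mulmx1 subrr.
have PP : P *m P = P by rewrite {1}/P mulmxBl mul1mx -mulmxA TP mulmx0 subr0.
have CB : col_base P *m row_base P = P by exact: mulmx_base.
have [C' C'C] : exists C', C' *m col_base P = 1%:M.
  by apply/row_fullP; rewrite col_base_full.
have [B' BB'] : exists B', row_base P *m B' = 1%:M.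
  by apply/row_freeP; rewrite row_base_free.
move: (\rank P) (col_base P) (row_base P) C' B' CB C'C BB' => k C B C' B' CB C'C BB'.
have TC : T *m C = 0 by rewrite -[LHS]mulmx1 -BB' mulmxA -[T *m C *m B]mulmxA CB TP mul0mx.
have BD : B *m D = 0 by rewrite -[LHS]mul1mx -C'C -mulmxA [C *m (_ *m _)]mulmxA CB PD mulmx0.
have BC : B *m C = 1%:M.
  rewrite -[LHS]mul1mx -[LHS]mulmx1 -{1}C'C -BB'.
  rewrite -!mulmxA [C *m (B *m _)]mulmxA CB [C *m (B *m _)]mulmxA CB.
  by rewrite [P *m (P *m _)]mulmxA PP -CB !mulmxA C'C mul1mx BB'.
have h1 : row_mx C D *m col_mx B T = 1%:M by rewrite mul_row_col CB /P subrK.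
have h2 : col_mx B T *m row_mx C D = 1%:M.
  by rewrite mul_col_row TD TC BD BC -scalar_mx_block.
exists k, C, (col_mx B T); split=> //.
by apply/eqP; rewrite eqn_leq (mulmx1_min h1) (mulmx1_min h2).
Qed.

End LocalDiffeo.

(** * Embedded submanifolds *)

Section Slices.
Context {R : realType}.
Implicit Types N : premanifold R.

Let he := @euclid_smooth_atlas R.

Lemma local_diffeo_eq N N' (F G : N -> N') (F' : N' -> N) x :
  (\forall y \near x, F y = G y) -> local_diffeo F F' x -> local_diffeo G F' x.
Proof.
move=> FG [Fs F's K K']; have e := nbhs_singleton FG; have Kx := nbhs_singleton K.
split.
- exact: smooth_at_eq FG Fs.
- by rewrite -e.
- by apply: filterS2 FG K => y <-.
- rewrite -e; rewrite -Kx in FG.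
  by apply: filterS2 K' (near_continuous (smooth_at_continuous F's) FG) => z + <-.
Qed.

Lemma diff_row_mx d k m (C : 'M[R]_(d, k)) (f : 'rV[R]_d -> 'rV[R]_m) a v :
  differentiable f a ->
  'd (fun y => row_mx (y *m C) (f y)) a v = row_mx (v *m C) ('d f a v).
Proof.
move=> df; have di : differentiable (id : 'rV[R]_d -> 'rV[R]_d) a by [].
have [d1 e1] := diff_mulmxr (row_mx C 0 : 'M[R]_(d, k + m)) di.
have [d2 e2] := diff_mulmxr (row_mx 0 1%:M : 'M[R]_(m, k + m)) df.
have E y : id y *m row_mx C 0 + f y *m row_mx 0 1%:M = row_mx (y *m C) (f y).
  by rewrite !mul_mx_row mulmx1 !mulmx0 add_row_mx addr0 add0r.
have E1 := etrans (congr1 (fun F => F v) e1)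
                  (congr1 (mulmx^~ (row_mx C 0)) (diff_idE a v)).
have E2 := congr1 (fun F => F v) e2.
rewrite -(funext E); refine (etrans (diffDE v d1 d2) _).
refine (etrans (congr2 +%R E1 E2) _).
by rewrite !mul_mx_row mulmx1 !mulmx0 add_row_mx addr0 add0r.
Qed.

(* The local form of submersions, with a smooth local section playing the part
   of the surjectivity of the differential. *)
Lemma submersion_chart N d m (f : N -> euclid m) (s : euclid m -> N) x :
  smooth_atlas N -> has_dim N d -> smooth_at f x -> smooth_at s (f x) ->
  s (f x) = x -> (\forall w \near f x, f (s w) = w) ->
  exists k (h : N -> euclid k) F', d = (k + m)%N /\ smooth_at h x /\
    @local_diffeo R N (euclid (k + m)) (fun y => row_mx (h y) (f y)) F' x.
Proof.
move=> hN hd fs ss sfx fsK.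
have [psi [psi' psiD]] := has_dim_chart x hN hd; have [p1 p2 p3 p4] := psiD.
have px := nbhs_singleton p3.
have phis : smooth_at (f \o psi' : euclid d -> euclid m) (psi x).
  by apply: smooth_at_comp => //; rewrite px.
have taus : smooth_at (psi \o s : euclid m -> euclid d) (f x).
  by apply: smooth_at_comp => //; rewrite sfx.
have tx : (psi \o s) (f x) = psi x by rewrite /= sfx.
have pt : \forall w \near f x, (f \o psi') ((psi \o s) w) = w.
  rewrite -sfx in p3.
  by apply: filterS2 fsK (near_continuous (smooth_at_continuous ss) p3) => w /= + ->.
move/smooth_at_euclid : phis => phis; move/smooth_at_euclid : taus => taus.
have phis' := phis; rewrite -tx in phis'.
(* Near [f x] the section in coordinates is a right inverse of [f] in coordinates; this is the only
   use of [s]. *)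
have TD := diff_near_id taus phis' pt; rewrite tx in TD.
have [k [C [B [dE CDB]]]] := complement_matrix TD.
pose fh (y : 'rV[R]_d) : 'rV[R]_(k + m) := row_mx (y *m C) (f (psi' y)).
have fhs : smooth_near fh (psi x).
  apply: smooth_near_row_mx => //.
  by apply: smooth_near_mulmxr; exact: smooth_near_id.
have fhd v : 'd fh (psi x) v *m B = v.
  rewrite (diff_row_mx C v (smooth_near_differentiable phis)).
  by rewrite -(mul_rV_lin1 ('d _ _)) -mul_mx_row -mulmxA CDB mulmx1.
have [g gD] := local_inverse dE fhs fhd.
exists k, (fun y => psi y *m C), (psi' \o g); split=> //; split.
  have Cs : @smooth_at R (euclid d) (euclid k) (fun z : 'rV[R]_d => z *m C) (psi x).
    by apply/smooth_at_euclid; apply: smooth_near_mulmxr; exact: smooth_near_id.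
  exact: (smooth_at_comp hN (he d) (he k) p1 Cs).
apply: local_diffeo_eq (local_diffeo_comp hN (he d) (he (k + m)) psiD gD).
by apply: filterS p3 => y /= py; rewrite /fh py.
Qed.

(** A slice chart asks the coordinates from k on to vanish, which is why the defining functions form
    the right block. *)
Lemma slice_of_local_diffeo N (A : set N) k m (F : N -> euclid (k + m)) F' x :
  smooth_atlas N -> local_diffeo F F' x ->
  (\forall y \near x, A y <-> rsubmx (F y) = 0) ->
  exists2 c, slice_chart A k c & chart_dom c x.
Proof.
move=> hN FD /near_openP[V0 [V0o V0x hV0]].
have [V [Vo Vx VV0 mF]] := local_diffeo_maximal hN FD V0o V0x.
exists (@Chart R N (k + m) V F) => //; split=> //=; first exact: leq_addr.
move=> y /VV0/hV0 ->; split=> [e i ki|h].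
  have lt : (i - k < m)%N by rewrite ltn_subLR.
  move/rowP/(_ (Ordinal lt)) : e; rewrite !mxE => <-; congr (F y _ _).
  by apply/val_inj; rewrite /= subnKC.
by apply/rowP => j; rewrite !mxE h//= leq_addr.
Qed.

(** The section [s] stands for the rank condition, and the constant dimension of [N] makes d - m the
    same at all points, as [embedded_submanifold] requires. *)
Lemma embedded_zero_set N (A : set N) d m : manifold N -> has_dim N d ->
  (forall x, A x -> exists (f : N -> euclid m) s,
    [/\ smooth_at f x, smooth_at s (f x), s (f x) = x,
        \forall w \near f x, f (s w) = w & \forall y \near x, A y <-> f y = 0]) ->
  embedded_submanifold A.
Proof.
move=> mN hd h; have hN := manifold_smooth_atlas mN.
split=> //; exists (d - m)%N => x Ax.
have [f [s [fs ss sx fsK hA]]] := h x Ax.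
have [k [g [F' [dE [gs gD]]]]] := submersion_chart hN hd fs ss sx fsK.
rewrite dE addnK; apply: (slice_of_local_diffeo hN gD).
by apply: filterS hA => y; rewrite row_mxKr.
Qed.

Lemma smooth_at_euclid_comp N k m (f : N -> euclid k) (g : 'rV[R]_k -> 'rV[R]_m) x :
  smooth_atlas N -> smooth_at f x -> smooth_near g (f x) ->
  @smooth_at R N (euclid m) (fun y => g (f y)) x.
Proof.
move=> hN fs gs; apply: (smooth_at_comp (G := g : euclid k -> euclid m) hN (he k) (he m) fs).
exact/smooth_at_euclid.
Qed.

(* Images of immersions with local retractions are embedded; in the chart
   (f, h) of the retraction they are graphs, which a shear flattens. *)
Lemma embedded_image N (P : premanifold R) (A : set N) d p (F : P -> N) :
  manifold N -> has_dim N d -> smooth_atlas P -> has_dim P p ->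
  (forall q, smooth_at F q) -> (forall q, A (F q)) ->
  (forall x, A x -> exists q (L : N -> P), [/\ F q = x, smooth_at L x &
     \forall y \near x, forall q', F q' = y -> L y = q']) ->
  embedded_submanifold A.
Proof.
move=> mN hd hP hp Fs FA hL; have hN := manifold_smooth_atlas mN.
split=> //; exists p => x Ax; have [q [L [Fq Ls LF]]] := hL x Ax.
have Lx : L x = q by exact: (nbhs_singleton LF).
have [t [t' tD]] := has_dim_chart q hP hp; have [t1 t2 t3 t4] := tD.
have tq := nbhs_singleton t3.
pose f y := t (L y); pose s w := F (t' w).
have fs : @smooth_at R N (euclid p) f x.
  by apply: (smooth_at_comp hN hP (he p) Ls); rewrite Lx.
have fx : f x = t q by rewrite /f Lx.
have ss : @smooth_at R (euclid p) N s (f x).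
  by rewrite fx; apply: (smooth_at_comp (he p) hP hN t2); exact: Fs.
have sfx : s (f x) = x by rewrite fx /s tq.
have sc := smooth_at_continuous ss; have fc := smooth_at_continuous fs.
have LF' := LF; rewrite -[X in \forall y \near X, _]sfx in LF'.
have fsK : \forall w \near f x, f (s w) = w.
  rewrite -fx in t4; apply: filterS2 t4 (near_continuous sc LF') => w tw /(_ _ erefl).
  by rewrite /f => ->.
have [k [h [F' [dE [hs hD]]]]] := submersion_chart hN hd fs ss sfx fsK.
(* Besides flattening the graph of [h] composed with [s], the map swaps the blocks: the p
   coordinates along [A] have to come first. *)
pose G (w : 'rV[R]_(k + p)) : 'rV[R]_(p + k) :=
  row_mx (rsubmx w) (lsubmx w - h (s (rsubmx w))).
pose G' (w : 'rV[R]_(p + k)) : 'rV[R]_(k + p) :=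
  row_mx (rsubmx w + h (s (lsubmx w))) (lsubmx w).
have GK : cancel G G' by move=> w; rewrite /G /G' row_mxKl row_mxKr subrK hsubmxK.
have G'K : cancel G' G by move=> w; rewrite /G /G' row_mxKl row_mxKr addrK hsubmxK.
pose y0 := row_mx (h x) (f x) : 'rV[R]_(k + p).
have hss : smooth_near (fun w => h (s w)) (f x).
  apply/smooth_at_euclid; apply: (smooth_at_comp (he p) hN (he k) ss).
  by rewrite sfx.
have GD : @local_diffeo R (euclid (k + p)) (euclid (p + k)) G G' y0.
  have id1 := smooth_near_id y0; have id2 := smooth_near_id (G y0).
  split; last 2 first.
  - by apply: (near_open openT) => // w _; exact: GK.
  - by apply: (near_open openT) => // w _; exact: G'K.
  - apply/smooth_at_euclid; apply: smooth_near_row_mx.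
      exact: smooth_near_rsubmx.
    apply: smooth_nearB; first exact: smooth_near_lsubmx.
    have hs1 : smooth_near (fun w => h (s w)) (rsubmx y0) by rewrite row_mxKr.
    exact (smooth_near_comp (smooth_near_rsubmx id1) hs1).
  - apply/smooth_at_euclid; apply: smooth_near_row_mx; last exact: smooth_near_lsubmx.
    apply: smooth_nearD; first exact: smooth_near_rsubmx.
    have hs1 : smooth_near (fun w => h (s w)) (lsubmx (G y0)).
      by rewrite row_mxKl row_mxKr.
    exact (smooth_near_comp (smooth_near_lsubmx id2) hs1).
have FD := local_diffeo_comp hN (he (k + p)) (he (p + k)) hD GD.
apply: (slice_of_local_diffeo hN FD).
have [_ _ hK _] := hD.
have sfn : \forall y \near x, F' (row_mx (h (s (f y))) (f (s (f y)))) = s (f y).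
  have h1 : \forall y \near s (f x), F' (row_mx (h y) (f y)) = y by rewrite sfx.
  exact (near_continuous fc (near_continuous sc h1)).
have tL : \forall y \near x, t' (t (L y)) = L y.
  by rewrite -Lx in t3; exact (near_continuous (smooth_at_continuous Ls) t3).
apply: filterS2 (filterI LF (filterI hK tL)) (filterI sfn (near_continuous fc fsK)).
move=> y [LFy [hKy tLy]] [sfy fsfy] /=; rewrite row_mxKr /= row_mxKl row_mxKr.
split=> [Ay|/subr0_eq e].
  have [q' [_ [Fq' _ _]]] := hL y Ay; have Ly := LFy q' Fq'.
  by rewrite /s /f tLy Ly Fq' subrr.
(* Here [y] and [s (f y)] have the same coordinates under [h] and [f], so they coincide, and [s]
   takes its values in [A]. *)
by rewrite -hKy e -[X in row_mx _ X]fsfy sfy; exact: FA.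
Qed.

End Slices.

(** * Submanifolds and products as manifolds *)

Section Topology.

Definition countable_basis (T : topologicalType) (I : Type) (e : I -> set T) :=
  (forall i, open (e i)) /\
  (forall x V, nbhs x V -> exists i, e i x /\ e i `<=` V).

Lemma countable_basis_second (T : topologicalType) (I : countType) (e : I -> set T) :
  countable_basis e -> @second_countable T.
Proof.
move=> [eo eb]; exists (range e).
  by apply: (sub_countable (card_image_le e setT)); exact: countableP.
split=> [_ [i _ <-]|x V /eb[i [ex eV]]]; first exact: eo.
by exists (e i) => //=; split=> //; exists i.
Qed.

Lemma second_countable_basis (T : topologicalType) :
  @second_countable T -> exists e : nat -> set T, countable_basis e.
Proof.
move=> [B /countable_injP[f finj] [Bo Bb]].
(* At most one basic set has code n, so the union is that set, or empty if n codes nothing. *)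
pose e n := \bigcup_(b in [set b | B b /\ f b = n]) b.
have eB b : B b -> e (f b) = b.
  move=> Bb'; apply/seteqP; split=> [x [b' [Bb1 fb] b'x]|x bx]; last by exists b.
  by have <- : b' = b by apply: finj; rewrite ?inE.
exists e; split=> [n|x V /Bb[b /= [Bb' bx] bV]].
  by apply: bigcup_open => b [Bb' _]; exact: Bo.
by exists (f b); rewrite eB.
Qed.

(** Reduces separation to a jointly injective family of continuous maps into Hausdorff spaces, such
    as projections or an inclusion. *)
Lemma hausdorff_map_eq (T T' : topologicalType) (f : T -> T') p q :
  hausdorff_space T' -> continuous f -> cluster (nbhs p) q -> f p = f q.
Proof.
move=> hT' fc pq; apply: hT' => U V nU nV.
by have [z [Uz Vz]] := pq _ _ (fc p U nU) (fc q V nV); exists (f z).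
Qed.

Lemma set_val_continuous (T : topologicalType) (A : set T) :
  continuous (val : set_type A -> T).
Proof. exact: initial_continuous. Qed.

Lemma nbhs_set_type (T : topologicalType) (A : set T) (x : set_type A) V :
  nbhs x V -> exists U, [/\ open U, U (val x) & forall y : set_type A, U (val y) -> V y].
Proof.
rewrite nbhsE => -[B [[U Uo UB] Bx] BV]; exists U; split=> //.
  by have := Bx; rewrite -UB.
by move=> y Uy; apply: BV; rewrite -UB.
Qed.

Lemma continuous_set_type (T T' : topologicalType) (A : set T') (f : T -> set_type A) x :
  {for x, continuous (fun y => val (f y))} -> {for x, continuous f}.
Proof.
move=> fc V /nbhs_set_type[U [Uo Ux UV]].
have h := near_continuous fc (near_open Uo Ux (fun _ h => h)).
by apply: filterS h => y /UV.
Qed.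

Lemma continuous_pair_at (T T1 T2 : topologicalType) (f : T -> T1) (g : T -> T2) x :
  {for x, continuous f} -> {for x, continuous g} ->
  {for x, continuous (fun y => (f y, g y))}.
Proof. by move=> fc gc; apply: cvg_pair. Qed.

Lemma prod_second_countable (T T' : topologicalType) :
  @second_countable T -> @second_countable T' -> @second_countable (T * T')%type.
Proof.
move=> /second_countable_basis[e [eo eb]] /second_countable_basis[e' [e'o e'b]].
apply: (@countable_basis_second _ (nat * nat)%type (fun i => e i.1 `*` e' i.2)).
split=> [i|[x y] V [[P Q] /= [Px Qy] PQ]].
  rewrite openE => -[x y] [/= ex e'y]; exists (e i.1, e' i.2) => //=.
  by split; exact: open_nbhs_nbhs.
have [i [ix iP]] := eb x P Px; have [j [jy jQ]] := e'b y Q Qy.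
by exists (i, j); split=> // -[x' y'] [/= /iP ? /jQ ?]; exact: PQ.
Qed.

Lemma prod_hausdorff (T T' : topologicalType) :
  hausdorff_space T -> hausdorff_space T' -> hausdorff_space (T * T')%type.
Proof.
move=> hT hT' [p p'] [q q'] pq; congr (_, _).
  by apply: (hausdorff_map_eq (f := fst) hT _ pq) => z; exact: cvg_fst.
by apply: (hausdorff_map_eq (f := snd) hT' _ pq) => z; exact: cvg_snd.
Qed.

Lemma sub_second_countable (T : topologicalType) (A : set T) :
  @second_countable T -> @second_countable (set_type A).
Proof.
move=> /second_countable_basis[e [eo eb]].
apply: (@countable_basis_second _ nat 
  (fun i => [set x : set_type A | e i (val x)])).
split=> [i|x V /nbhs_set_type[U [Uo Ux UV]]]; first by exists (e i).
have [i [ix iU]] := eb _ _ (open_nbhs_nbhs (conj Uo Ux)).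
by exists i; split=> // y /iU/UV.
Qed.

Lemma sub_hausdorff (T : topologicalType) (A : set T) :
  hausdorff_space T -> hausdorff_space (set_type A).
Proof.
by move=> hT p q pq; apply: val_inj; exact: (hausdorff_map_eq hT (@set_val_continuous _ A) pq).
Qed.

Section Pi.
Context {n : nat} (T : 'I_n -> topologicalType).
Local Notation P := (prod_topology (fun i => T i)).

Lemma pi_proj_continuous i : continuous (fun x : P => x i).
Proof.
move=> x; have : nbhs x --> x by exact: cvg_id.
move/(cvg_sup (fun i => Topological.class (initial_topology (fun f : P => f i))) _)
  => /(_ i) h.
exact: (cvg_trans (cvg_app _ h) (@initial_continuous _ _ (fun f : P => f i) x)).
Qed.

Lemma cvg_pi (F : set_system P) (x : P) : Filter F ->
  (forall i, (fun y : P => y i) @ F --> x i) -> F --> x.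
Proof.
move=> FF h; apply/cvg_sup => i V.
rewrite /= (@nbhsE (initial_topology (fun f : P => f i))).
move=> -[B [[U Uo UB] Bx] BV]; apply: (filterS BV).
have Ux : U (x i) by have := Bx; rewrite -UB.
rewrite -UB; apply: (h i); exact: open_nbhs_nbhs.
Qed.

(** The sets that contain a box around [x] form a filter. It converges to [x] in every coordinate,
    hence in the product, so it contains all neighbourhoods. *)
Lemma nbhs_pi (x : P) V : nbhs x V ->
  exists U : forall i, set (T i), (forall i, nbhs (x i) (U i)) /\
    forall y : P, (forall i, U i (y i)) -> V y.
Proof.
pose F : set_system P := [set V | exists U : forall i, set (T i),
  (forall i, nbhs (x i) (U i)) /\ forall y : P, (forall i, U i (y i)) -> V y].
have FF : Filter F.
  split.
  - by exists (fun=> setT); split=> // i; exact: filterT.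
  - move=> V1 V2 [U1 [n1 h1]] [U2 [n2 h2]].
    exists (fun i => U1 i `&` U2 i); split=> [i|y hy]; first exact: filterI.
    by split; [apply: h1 => i; have [] := hy i|apply: h2 => i; have [] := hy i].
  - by move=> V1 V2 V12 [U [nU h]]; exists U; split=> // y /h/V12.
have Fx : F --> x.
  apply: cvg_pi => i U nU; exists (dfwith (fun j => [set: T j]) i U).
  split=> [j|y /(_ i)]; last by rewrite dfwithin.
  by case: dfwithP => // *; exact: filterT.
exact: (Fx V).
Qed.

Lemma continuous_pi (S : topologicalType) (f : S -> P) x :
  (forall i, {for x, continuous (fun y => f y i)}) -> {for x, continuous f}.
Proof. by move=> fc; apply: cvg_pi => i; exact: fc. Qed.

Lemma open_pi (U : forall i, set (T i)) : (forall i, open (U i)) ->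
  open [set x : P | forall i, U i (x i)].
Proof.
move=> Uo; rewrite openE => x Ux.
have h i : \forall y \near x, U i (y i).
  exact (near_continuous (@pi_proj_continuous i x)
           (near_open (Uo i) (Ux i) (fun _ h => h))).
exact: (@filter_forall _ _ (fun i (y : P) => U i (y i)) (nbhs x) (nbhs_filter x) h).
Qed.

Lemma pi_second_countable : (forall i, @second_countable (T i)) -> @second_countable P.
Proof.
move=> h; pose e i := sval (cid (second_countable_basis (h i))).
have he i : countable_basis (e i) by exact: svalP (cid _).
(* Boxes are coded by functions on a finite set, which form a countable type. *)
apply: (@countable_basis_second _ {ffun 'I_n -> nat}
  (fun k => [set x : P | forall i, e i (k i) (x i)])).
split=> [k|x V /nbhs_pi[U [nU UV]]].
  by apply: (@open_pi (fun i => e i (k i))) => i; have [eo _] := he i; exact: eo.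
have /choice[k hk] i : exists k, e i k (x i) /\ e i k `<=` U i.
  by have [_ eb] := he i; exact: eb.
exists (finfun k); split=> [i|y hy]; first by rewrite ffunE; have [] := hk i.
by apply: UV => i; have [_] := hk i; apply; rewrite -[k i](ffunE k).
Qed.

Lemma pi_hausdorff : (forall i, hausdorff_space (T i)) -> hausdorff_space P.
Proof.
move=> hT p q pq; apply: functional_extensionality_dep => i.
exact: (hausdorff_map_eq (f := fun x : P => x i) (hT i) (@pi_proj_continuous i) pq).
Qed.

End Pi.

End Topology.

(** Handles spaces without a point to serve as the default of an inverse chart. *)
Lemma empty_is_chart (R : realType) (T : topologicalType) (c : chart R T) :
  (T -> False) -> is_chart c.
Proof.
move=> noT; split.
- by rewrite (_ : chart_dom c = set0) ?predeqE => [|x]; [exact: open0|case: (noT x)].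
- by move=> x; case: (noT x).
- by move=> x; case: (noT x).
- move=> V _ _; rewrite (_ : _ @` V = set0) ?predeqE => [|w]; first exact: open0.
  by split=> // -[x]; case: (noT x).
Qed.

(** * Restriction of slice charts *)

Section SubManifold.
Context {R : realType} {N : premanifold R} (A : set N).
Hypothesis (hN : smooth_atlas N).

(** On [A] the coordinates from k on are zero, so truncating and padding with zeros changes
    nothing. *)
Lemma slice_pid k (c : chart R N) x : slice_chart A k c -> A x -> chart_dom c x ->
  chart_map c x *m @pid_mx R (chart_dim c) k k *m @pid_mx R k (chart_dim c) k = chart_map c x.
Proof.
move=> [_ kc sl] Ax Dx; have /(sl x Dx) h := Ax.
rewrite -mulmxA mul_pid_mx !minnn; apply/rowP => j.
rewrite mxE (bigD1 j)//= big1 ?addr0 => [|i ij].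
  rewrite mxE eqxx /=; case: ltnP => [_|kj]; first by rewrite mulr1.
  by rewrite h// mul0r.
by rewrite mxE (_ : (i == j :> nat) = false) ?mulr0//; apply/negbTE.
Qed.

Lemma pid_slice k n (w : 'rV[R]_k) : (k <= n)%N ->
  w *m (pid_mx k : 'M[R]_(k, n)) *m (pid_mx k : 'M[R]_(n, k)) = w.
Proof. by move=> kn; rewrite -mulmxA pid_mx_id// pid_mx_1 mulmx1. Qed.

Lemma pid_vanish k n (w : 'rV[R]_k) (i : 'I_n) : (k <= i)%N ->
  (w *m (pid_mx k : 'M[R]_(k, n))) ord0 i = 0.
Proof.
move=> ki; rewrite mxE big1// => j _; rewrite mxE.
by rewrite (_ : (j == i :> nat) = false) ?mulr0//; apply: ltn_eqF; exact: leq_trans (ltn_ord j) ki.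
Qed.

(* pid_mx k followed by pid_mx k kills the coordinates transverse to A. The
   value is meaningful only near A; x0 is a default. *)
Definition slice_retraction k (c : chart R N) (x0 y : N) : N :=
  chart_inv c x0 (chart_map c y *m @pid_mx R (chart_dim c) k k *m pid_mx k).

Lemma slice_inv_near k (c : chart R N) x0 x : slice_chart A k c -> A x -> chart_dom c x ->
  \forall w \near chart_map c x *m @pid_mx R (chart_dim c) k k,
    [/\ A (chart_inv c x0 (w *m pid_mx k)),
        chart_dom c (chart_inv c x0 (w *m pid_mx k)) &
        chart_map c (chart_inv c x0 (w *m pid_mx k)) = w *m pid_mx k].
Proof.
move=> sc Ax Dx; have [[cc _] kc sl] := sc; have [Do _ _ _] := cc.
pose pid := pid_mx k : 'M[R]_(k, chart_dim c).
have e := slice_pid sc Ax Dx.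
have h1 := chart_invK cc x0 Dx.
have Dn := near_open Do Dx (fun _ h => h); rewrite -(chart_mapK cc x0 Dx) in Dn.
have h2 := near_continuous (chart_inv_continuous cc (x0 := x0) Dx) Dn.
rewrite -e in h1 h2.
have mc := @mulmxr_continuous R _ _ pid (chart_map c x *m @pid_mx R (chart_dim c) k k).
have h3 := near_continuous mc h1.
have h4 := near_continuous mc h2.
apply: filterS2 h3 h4 => w wE wD; split=> //.
by apply/(sl _ wD) => i ki; rewrite wE pid_vanish.
Qed.

(** The inverse pads with zeros and applies the inverse of [c]; near the given point the slice
    condition places the result in [A]. *)
Lemma restrict_is_chart k (c : chart R N) : slice_chart A k c ->
  is_chart (restrict_chart A k c).
Proof.
move=> sc; have [[x0 _]|no] := pselect (exists x0 : set_type A, True); last first.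
  by apply: empty_is_chart => x; apply: no; exists x.
have [[cc _] kc sl] := sc; have [Do _ ct _] := cc.
pose g (w : 'rV[R]_k) := insubd x0 (chart_inv c (val x0) (w *m pid_mx k)).
have inA (x : set_type A) : A (val x) by exact: set_mem (valP x).
have gE w : A (chart_inv c (val x0) (w *m pid_mx k)) ->
    val (g w) = chart_inv c (val x0) (w *m pid_mx k).
  by move=> Aw; rewrite /g insubdK//; exact: mem_set.
apply: (@is_chart_inverse R (set_type A) (restrict_chart A k c) g).
  exact: (open_comp (fun y _ => @set_val_continuous _ A y) Do).
move=> x Dx; have e := slice_pid sc (inA x) Dx.
have hn := slice_inv_near (val x0) sc (inA x) Dx.
split.
- apply: val_inj; have [h _ _] := nbhs_singleton hn.
  by rewrite gE//= e chart_mapK.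
- apply: (@continuous_comp _ _ _ (fun y : set_type A => chart_map c (val y)) (mulmxr (pid_mx k))).
    apply: (@continuous_comp _ _ _ (val : set_type A -> N) (chart_map c)).
      exact: set_val_continuous.
    exact: ct.
  exact: mulmxr_continuous.
- apply: continuous_set_type.
  have cinv := chart_inv_continuous cc (x0 := val x0) Dx; rewrite -e in cinv.
  have gn : \forall w \near chart_map c (val x) *m @pid_mx R (chart_dim c) k k,
      chart_inv c (val x0) (w *m pid_mx k) = val (g w).
    by apply: filterS hn => w [Aw _ _]; rewrite gE.
  have mc := @mulmxr_continuous R _ _ (@pid_mx R k (chart_dim c) k)
    (chart_map c (val x) *m @pid_mx R (chart_dim c) k k).
  exact (near_eq_continuous gn (continuous_comp mc cinv)).
- by apply: filterS hn => w [Aw _ wE]; rewrite /= gE// wE pid_slice.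
Qed.

Lemma restrict_transition k k' (c c' : chart R N) (x : set_type A) :
  slice_chart A k c -> slice_chart A k' c' ->
  chart_dom c (val x) -> chart_dom c' (val x) ->
  near_transition (restrict_chart A k c) (restrict_chart A k' c') x.
Proof.
move=> sc sc' Dx D'x; have [mc _ _] := sc; have [mc' _ _] := sc'.
have [[Do _ _ _] _] := mc.
have [f [fs fE]] := maximal_transition hN mc mc' Dx D'x.
have inA (y : set_type A) : A (val y) by exact: set_mem (valP y).
exists (fun w : 'rV[R]_k => f (w *m pid_mx k) *m pid_mx k'); split.
  apply: smooth_near_mulmxr.
  have fs' : smooth_near f (mulmxr (pid_mx k) (chart_map (restrict_chart A k c) x)).
    by rewrite /= (slice_pid sc (inA x) Dx).
  apply: (smooth_near_comp _ fs'); apply: smooth_near_mulmxr; exact: smooth_near_id.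
have vc := @set_val_continuous _ A x.
have h1 := near_continuous vc fE.
have h2 := near_continuous vc (near_open Do Dx (fun _ h => h)).
by apply: filterS2 h1 h2 => y fy Dy /=; rewrite (slice_pid sc (inA y) Dy) fy.
Qed.

Lemma sub_smooth_atlas :
  (forall x, A x -> exists k c, slice_chart A k c /\ chart_dom c x) ->
  smooth_atlas (sub_space A).
Proof.
move=> h; split.
- move=> x; have [k [c [sc Dx]]] := h _ (set_mem (valP x)).
  by exists (restrict_chart A k c) => //; exists k, c.
- by move=> _ [k [c [sc ->]]]; exact: restrict_is_chart.
- move=> _ _ [k [c [sc ->]]] [k' [c' [sc' ->]]]; apply: smooth_transition_of.
    exact: restrict_is_chart.
  by move=> x; exact: restrict_transition.
Qed.

End SubManifold.

(** * Embedded submanifolds: inclusion, lifts and local retractions *)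

Section Embedded.
Context {R : realType} {N : premanifold R} {A : set N}.
Hypothesis EA : embedded_submanifold A.

Let hN : smooth_atlas N := manifold_smooth_atlas EA.1.

Let inA (x : set_type A) : A (val x).
Proof. exact: set_mem (valP x). Qed.

Lemma embedded_cover x : A x -> exists k c, slice_chart A k c /\ chart_dom c x.
Proof. by have [_ [k h]] := EA; move=> /h[c sc Dx]; exists k, c. Qed.

Lemma embedded_smooth_atlas : smooth_atlas (sub_space A).
Proof. exact: sub_smooth_atlas embedded_cover. Qed.

Lemma restrict_maximal k (c : chart R N) : slice_chart A k c ->
  @maximal_atlas R (sub_space A) (restrict_chart A k c).
Proof. by move=> sc; apply: atlas_maximal embedded_smooth_atlas _; exists k, c. Qed.

Lemma smooth_at_val (x : sub_space A) : smooth_at (val : sub_space A -> N) x.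
Proof.
have [k [c [sc Dx]]] := embedded_cover (inA x).
have [mc kc _] := sc; have [[Do _ _ _] _] := mc.
have fs := smooth_near_mulmxr (@pid_mx R k (chart_dim c) k)
  (smooth_near_id (chart_map (restrict_chart A k c) x)).
exists (restrict_chart A k c), c, (fun w : 'rV[R]_k => w *m pid_mx k); split.
  exact (And5 (restrict_maximal sc) mc Dx Dx fs).
have h := near_continuous (@set_val_continuous _ A x) (near_open Do Dx (fun _ h => h)).
by apply: filterS h => y Dy; split=> //=; rewrite (slice_pid sc (inA y) Dy).
Qed.

(** In slice charts the lift is the truncation of a smooth map. This is how all maps into composable
    tuples, squares and layers are shown to be smooth. *)
Lemma smooth_at_lift (N' : premanifold R) (G : N' -> sub_space A) x :
  smooth_atlas N' -> smooth_at (fun y => val (G y) : N) x -> smooth_at G x.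
Proof.
move=> hN' Gs; have [k [c [sc Dx]]] := embedded_cover (inA (G x)).
have [mc kc _] := sc.
have [c' ac' D'x] := atlas_cover hN' x; have mc' := atlas_maximal hN' ac'.
have [f [fs fE]] := smooth_at_charts hN' hN mc' mc D'x Dx Gs.
exists c', (restrict_chart A k c), (fun w => f w *m pid_mx k); split.
  exact (And5 mc' (restrict_maximal sc) D'x Dx (smooth_near_mulmxr (pid_mx k) fs)).
by apply: filterS fE => y [Dy fy]; split=> //=; rewrite fy.
Qed.

(** The atlas of [sub_space] contains slice charts for any k; comparison with a chart of the uniform
    k0 at a common point rules out other values. *)
Lemma sub_has_dim : exists k, has_dim (sub_space A) k.
Proof.
have [_ [k0 h0]] := EA; exists k0 => _ [k [c [sc ->]]] [x Dx].
have [c0 sc0 D0x] := h0 _ (inA x).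
have hS := embedded_smooth_atlas.
have D0 := chart_local_diffeo x hS (restrict_maximal sc0) D0x.
exact: (chart_dim_unique hS D0 (restrict_maximal sc) Dx).
Qed.

Lemma embedded_manifold : manifold (sub_space A).
Proof.
have [[hN1 hN2 _ _ _ _] _] := EA; have [h1 h2 h3] := embedded_smooth_atlas.
split=> //.
- exact: sub_hausdorff.
- exact: sub_second_countable.
- exact: sub_has_dim.
Qed.

(** Being obtained from a single slice chart, [r] inverts the inclusion only near [x], which
    suffices for statements about germs. *)
Lemma embedded_retraction (x : sub_space A) : exists r : N -> sub_space A,
  smooth_at r (val x) /\
  \forall y \near val x, forall z : sub_space A, val z = y -> r y = z.
Proof.
have [k [c [sc Dx]]] := embedded_cover (inA x).
have [mc kc sl] := sc; have [cc _] := mc; have [Do _ ct _] := cc.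
pose p y := slice_retraction k c (val x) y.
have e := slice_pid sc (inA x) Dx.
have mcont := @mulmxr_continuous R _ _ (@pid_mx R (chart_dim c) k k) (chart_map c (val x)).
have hn := near_continuous (ct _ Dx) (near_continuous mcont (slice_inv_near (val x) sc (inA x) Dx)).
pose r y : sub_space A := insubd x (p y).
have rE : \forall y \near val x, p y = val (r y).
  by apply: filterS hn => y [Ap _ _]; rewrite /r insubdK//; exact: mem_set.
exists r; split.
  apply: smooth_at_lift => //; apply: smooth_at_eq rE _.
  have he := @euclid_smooth_atlas R.
  have cs : @smooth_at R N (euclid (chart_dim c))
      (fun y => chart_map c y *m @pid_mx R (chart_dim c) k k *m pid_mx k) (val x).
    apply: (smooth_at_euclid_comp (g := fun w => w *m pid_mx k *m pid_mx k) hN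
      (smooth_at_chart hN mc Dx)).
    do 2![apply: smooth_near_mulmxr]; exact: smooth_near_id.
  apply: (smooth_at_comp hN (he _) hN cs); rewrite e.
  exact: smooth_at_chart_inv.
apply: filterS2 rE (near_open Do Dx (fun _ h => h)) => y + + z zy.
rewrite -zy => rz Dz; apply: val_inj; rewrite -rz /p /slice_retraction.
by rewrite (slice_pid sc (inA z) Dz) chart_mapK.
Qed.

End Embedded.

Lemma pair_fst_continuous (T T' : topologicalType) : continuous (fst : T * T' -> T).
Proof. by move=> z; exact: cvg_fst. Qed.

Lemma pair_snd_continuous (T T' : topologicalType) : continuous (snd : T * T' -> T').
Proof. by move=> z; exact: cvg_snd. Qed.

Lemma near_fst (T T' : topologicalType) (x : T * T') (P : T -> Prop) :
  (\forall y \near x.1, P y) -> \forall z \near x, P z.1.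
Proof. by move=> h; apply: (cvg_fst h). Qed.

Lemma near_snd (T T' : topologicalType) (x : T * T') (P : T' -> Prop) :
  (\forall y \near x.2, P y) -> \forall z \near x, P z.2.
Proof. by move=> h; apply: (cvg_snd h). Qed.

Section RowContinuity.
Context {R : realType} {T : topologicalType}.

Lemma continuous_rV n (f : T -> 'rV[R]_n) x :
  (forall j, {for x, continuous (fun y => f y ord0 j)}) -> {for x, continuous f}.
Proof. by move=> h; apply: cvg_mx => i j; rewrite ord1; exact: h. Qed.

Lemma continuous_coord n (f : T -> 'rV[R]_n) j x :
  {for x, continuous f} -> {for x, continuous (fun y => f y ord0 j)}.
Proof.
move=> fc; exact: (@continuous_comp _ _ R f (fun N : 'rV[R]_n => N ord0 j) x fc
                     (@coord_continuous _ _ _ ord0 j _)).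
Qed.

Lemma continuous_row_mx n p (f : T -> 'rV[R]_n) (g : T -> 'rV[R]_p) x :
  {for x, continuous f} -> {for x, continuous g} ->
  {for x, continuous (fun y => row_mx (f y) (g y))}.
Proof.
move=> fc gc; apply: continuous_rV => j; case: (split_ordP j) => k ->.
  have E y : setT y -> f y ord0 k = row_mx (f y) (g y) ord0 (lshift p k).
    by rewrite row_mxEl.
  exact (near_eq_continuous (near_open openT I E) (@continuous_coord _ f k x fc)).
have E y : setT y -> g y ord0 k = row_mx (f y) (g y) ord0 (rshift n k).
  by rewrite row_mxEr.
exact (near_eq_continuous (near_open openT I E) (@continuous_coord _ g k x gc)).
Qed.

Lemma continuous_mxrow n (p : 'I_n -> nat) (f : forall i, T -> 'rV[R]_(p i)) x :
  (forall i, {for x, continuous (f i)}) ->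
  {for x, continuous (fun y => \mxrow_i f i y)}.
Proof.
move=> fc; apply: continuous_rV => j.
have E y : setT y ->
    f (tagnat.sig1 j) y ord0 (tagnat.sig2 j) = (\mxrow_i f i y) ord0 j by rewrite mxE.
exact (near_eq_continuous (near_open openT I E) (@continuous_coord _ (f (tagnat.sig1 j)) (tagnat.sig2 j) x (fc _))).
Qed.

End RowContinuity.

(** * Products of two premanifolds *)

Section ProductManifold.
Context {R : realType} {N N' : premanifold R}.
Local Notation NN := (prod_space N N').

Lemma prod_is_chart (c : chart R N) (c' : chart R N') :
  is_chart c -> is_chart c' -> is_chart (prod_chart c c').
Proof.
move=> cc cc'; have [Do _ ct _] := cc; have [D'o _ ct' _] := cc'.
have [[[x0 x0'] _]|no] := pselect (exists x0 : N * N', True); last first.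
  by apply: empty_is_chart => x; apply: no; exists x.
pose g (w : 'rV[R]_(chart_dim c + chart_dim c')) : N * N' :=
  (chart_inv c x0 (lsubmx w), chart_inv c' x0' (rsubmx w)).
apply: (@is_chart_inverse R (N * N')%type (prod_chart c c') g).
  rewrite openE => -[x y] [/= Dx D'y]; exists (chart_dom c, chart_dom c') => //=.
  by split; exact: open_nbhs_nbhs.
move=> [x x'] [/= Dx D'x'].
pose w0 := row_mx (chart_map c x) (chart_map c' x').
have lc := smooth_near_continuous (smooth_near_lsubmx (smooth_near_id w0)).
have rc := smooth_near_continuous (smooth_near_rsubmx (smooth_near_id w0)).
have ci := chart_inv_continuous cc (x0 := x0) Dx.
have ci' := chart_inv_continuous cc' (x0 := x0') D'x'.
have h1 := chart_invK cc x0 Dx; have h2 := chart_invK cc' x0' D'x'.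
have el : chart_map c x = lsubmx w0 by rewrite row_mxKl.
have er : chart_map c' x' = rsubmx w0 by rewrite row_mxKr.
rewrite el in ci h1; rewrite er in ci' h2.
split.
- by rewrite /g /= row_mxKl row_mxKr !chart_mapK.
- apply: continuous_row_mx.
    exact (continuous_comp (@pair_fst_continuous _ _ (x, x')) (ct x Dx)).
  exact (continuous_comp (@pair_snd_continuous _ _ (x, x')) (ct' x' D'x')).
- exact (continuous_pair_at (continuous_comp lc ci) (continuous_comp rc ci')).
- apply: filterS2 (near_continuous lc h1) (near_continuous rc h2) => w wl wr /=.
  by rewrite wl wr hsubmxK.
Qed.

Lemma prod_near_transition (c1 c2 : chart R N) (c1' c2' : chart R N') (x : NN) :
  near_transition c1 c2 x.1 -> near_transition c1' c2' x.2 ->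
  near_transition (prod_chart c1 c1') (prod_chart c2 c2') x.
Proof.
move=> [f [fs fE]] [g [gs gE]].
exists (fun w : 'rV[R]_(chart_dim c1 + chart_dim c1') =>
  row_mx (f (lsubmx w)) (g (rsubmx w))); split.
  pose w0 := row_mx (chart_map c1 x.1) (chart_map c1' x.2).
  have el : chart_map c1 x.1 = lsubmx w0 by rewrite row_mxKl.
  have er : chart_map c1' x.2 = rsubmx w0 by rewrite row_mxKr.
  rewrite el in fs; rewrite er in gs.
  apply: smooth_near_row_mx.
    exact (smooth_near_comp (smooth_near_lsubmx (smooth_near_id w0)) fs).
  exact (smooth_near_comp (smooth_near_rsubmx (smooth_near_id w0)) gs).
apply: filterS2 (near_fst fE) (near_snd gE) => y fy gy.
by rewrite /= row_mxKl row_mxKr fy gy.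
Qed.

Hypotheses (hN : smooth_atlas N) (hN' : smooth_atlas N').

Lemma prod_smooth_atlas : smooth_atlas NN.
Proof.
split.
- move=> [x x']; have [c ac Dx] := atlas_cover hN x.
  have [c' ac' D'x'] := atlas_cover hN' x'.
  by exists (prod_chart c c') => //; exists c => //; exists c'.
- move=> _ [c ac [c' ac' <-]].
  by apply: prod_is_chart; [exact: (atlas_chart hN)|exact: (atlas_chart hN')].
- move=> _ _ [c1 ac1 [c1' ac1' <-]] [c2 ac2 [c2' ac2' <-]].
  apply: smooth_transition_of.
    by apply: prod_is_chart; [exact: (atlas_chart hN)|exact: (atlas_chart hN')].
  move=> x [D1 D1'] [D2 D2']; apply: prod_near_transition.
    by apply: near_transition_of => //; try exact: (atlas_chart hN); exact: (atlas_compat hN).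
  by apply: near_transition_of => //; try exact: (atlas_chart hN'); exact: (atlas_compat hN').
Qed.

Lemma prod_has_dim d d' : has_dim N d -> has_dim N' d' -> has_dim NN (d + d').
Proof.
move=> hd hd' _ [c ac [c' ac' <-]] [[x x'] [/= Dx D'x']].
by rewrite /= (hd c)// ?(hd' c')//; [exists x'|exists x].
Qed.

Lemma smooth_at_fst (x : NN) : smooth_at (fst : NN -> N) x.
Proof.
case: x => x x'; have [c ac Dx] := atlas_cover hN x.
have [c' ac' D'x'] := atlas_cover hN' x'.
have mcc : @maximal_atlas R NN (prod_chart c c').
  by apply: atlas_maximal prod_smooth_atlas _; exists c => //; exists c'.
have mc := atlas_maximal hN ac; have [[Do _ _ _] _] := mc.
exists (prod_chart c c'), c, (fun w => lsubmx w); split.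
  exact (And5 mcc mc (conj Dx D'x') Dx (smooth_near_lsubmx (smooth_near_id _))).
apply: filterS (near_fst (x := (x, x')) (near_open Do Dx (fun _ h => h))) => y Dy.
by split=> //=; rewrite row_mxKl.
Qed.

Lemma smooth_at_snd (x : NN) : smooth_at (snd : NN -> N') x.
Proof.
case: x => x x'; have [c ac Dx] := atlas_cover hN x.
have [c' ac' D'x'] := atlas_cover hN' x'.
have mcc : @maximal_atlas R NN (prod_chart c c').
  by apply: atlas_maximal prod_smooth_atlas _; exists c => //; exists c'.
have mc := atlas_maximal hN' ac'; have [[Do _ _ _] _] := mc.
exists (prod_chart c c'), c', (fun w => rsubmx w); split.
  exact (And5 mcc mc (conj Dx D'x') D'x' (smooth_near_rsubmx (smooth_near_id _))).
apply: filterS (near_snd (x := (x, x')) (near_open Do D'x' (fun _ h => h))) => y Dy.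
by split=> //=; rewrite row_mxKr.
Qed.

Lemma smooth_at_pair (P : premanifold R) (F : P -> N) (G : P -> N') x :
  smooth_atlas P -> smooth_at F x -> smooth_at G x ->
  smooth_at (fun y => (F y, G y) : NN) x.
Proof.
move=> hP Fs Gs; have [c0 ac0 D0x] := atlas_cover hP x.
have mc0 := atlas_maximal hP ac0.
have [c ac Dx] := atlas_cover hN (F x); have mc := atlas_maximal hN ac.
have [c' ac' D'x'] := atlas_cover hN' (G x); have mc' := atlas_maximal hN' ac'.
have mcc : @maximal_atlas R NN (prod_chart c c').
  by apply: atlas_maximal prod_smooth_atlas _; exists c => //; exists c'.
have [f [fs fE]] := smooth_at_charts hP hN mc0 mc D0x Dx Fs.
have [g [gs gE]] := smooth_at_charts hP hN' mc0 mc' D0x D'x' Gs.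
exists c0, (prod_chart c c'), (fun w => row_mx (f w) (g w)); split.
  exact (And5 mc0 mcc D0x (conj Dx D'x') (smooth_near_row_mx fs gs)).
by apply: filterS2 fE gE => y [Dy fy] [D'y gy]; split=> //=; rewrite fy gy.
Qed.

End ProductManifold.

Lemma prod_manifold (R : realType) (N N' : premanifold R) :
  manifold N -> manifold N' -> manifold (prod_space N N').
Proof.
move=> mN mN'; have hN := manifold_smooth_atlas mN; have hN' := manifold_smooth_atlas mN'.
have [h1 h2 h3] := prod_smooth_atlas hN hN'.
have [hN1 hN2 _ _ _ [d hd]] := mN; have [hN1' hN2' _ _ _ [d' hd']] := mN'.
split=> //.
- exact: prod_hausdorff.
- exact: prod_second_countable.
- by exists (d + d')%N; exact: prod_has_dim.
Qed.

(** * Finite products of families *)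

Section PiManifold.
Context {R : realType} {n : nat} (N : 'I_n -> premanifold R).
Local Notation P := (pi_space N).

Lemma pi_is_chart (c : forall i, chart R (N i)) :
  (forall i, is_chart (c i)) -> @is_chart R P (pi_chart c).
Proof.
move=> cc.
have [[x0 _]|no] := pselect (exists x0 : P, True); last first.
  by apply: empty_is_chart => x; apply: no; exists x.
pose g (w : 'rV[R]_(\sum_i chart_dim (c i))) : P :=
  fun i => chart_inv (c i) (x0 i) (submxrow w i).
apply: (@is_chart_inverse R P (pi_chart c) g).
  by apply: (@open_pi n N (fun i => chart_dom (c i))) => i; have [] := cc i.
move=> x Dx.
pose w0 := \mxrow_i chart_map (c i) (x i).
have wi i : chart_map (c i) (x i) = submxrow w0 i by rewrite mxrowK.
have sc i := smooth_near_continuous (smooth_near_submxrow i (smooth_near_id w0)).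
have ci i := chart_inv_continuous (cc i) (x0 := x0 i) (Dx i).
have hi i := chart_invK (cc i) (x0 i) (Dx i).
split.
- apply: functional_extensionality_dep => i.
  by rewrite /g /= mxrowK chart_mapK//; exact: Dx.
- apply: continuous_mxrow => i; have [_ _ ct _] := cc i.
  exact (continuous_comp (@pi_proj_continuous n N i x) (ct _ (Dx i))).
- apply: (@continuous_pi n N) => i; have := ci i; rewrite wi => cii.
  exact (continuous_comp (sc i) cii).
- have h i : \forall w \near w0,
      chart_map (c i) (chart_inv (c i) (x0 i) (submxrow w i)) = submxrow w i.
    by have := hi i; rewrite wi => hii; exact (near_continuous (sc i) hii).
  apply: filterS (@filter_forall _ _ _ _ (nbhs_filter w0) h) => w hw /=.
  by rewrite -[RHS]submxrowK; apply: eq_mxrow => i; rewrite /g hw.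
Qed.

Lemma pi_near_transition (c c' : forall i, chart R (N i)) (x : P) :
  (forall i, near_transition (c i) (c' i) (x i)) ->
  near_transition (pi_chart c : chart R P) (pi_chart c') x.
Proof.
move=> h; pose f i := sval (cid (h i)).
have fs i : smooth_near (f i) (chart_map (c i) (x i)) := (svalP (cid (h i))).1.
have fE i : \forall y \near x i, f i (chart_map (c i) y) = chart_map (c' i) y
  := (svalP (cid (h i))).2.
exists (fun w : 'rV[R]_(\sum_i chart_dim (c i)) => \mxrow_i f i (submxrow w i)); split.
  pose w0 := \mxrow_i chart_map (c i) (x i).
  have wi i : chart_map (c i) (x i) = submxrow w0 i by rewrite mxrowK.
  apply: smooth_near_mxrow => i; have := fs i; rewrite wi => fsi.
  exact (smooth_near_comp (smooth_near_submxrow i (smooth_near_id w0)) fsi).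
have hi i : \forall y \near x, f i (chart_map (c i) (y i)) = chart_map (c' i) (y i).
  exact (near_continuous (@pi_proj_continuous n N i x) (fE i)).
apply: filterS (@filter_forall _ _ _ _ (nbhs_filter x) hi) => y hy /=.
by apply: eq_mxrow => i; rewrite mxrowK.
Qed.

Hypothesis hN : forall i, smooth_atlas (N i).

Lemma pi_atlas_at (x : P) : exists c : forall i, chart R (N i),
  forall i, atlas (c i) /\ chart_dom (c i) (x i).
Proof.
have h i : exists c, atlas c /\ chart_dom c (x i).
  by have [c ac Dx] := atlas_cover (hN i) (x i); exists c.
by exists (fun i => sval (cid (h i))) => i; exact: (svalP (cid (h i))).
Qed.

Lemma pi_smooth_atlas : smooth_atlas P.
Proof.
split.
- move=> x; have [c hc] := pi_atlas_at x.
  exists (pi_chart c); first by exists c => // i; have [] := hc i.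
  by move=> i; have [] := hc i.
- move=> _ [c ac <-]; apply: pi_is_chart => i.
  exact: (atlas_chart (hN i) (ac i)).
- move=> _ _ [c ac <-] [c' ac' <-]; apply: smooth_transition_of.
    by apply: pi_is_chart => i; exact: (atlas_chart (hN i) (ac i)).
  move=> x Dx D'x; apply: pi_near_transition => i.
  exact (near_transition_of (atlas_chart (hN i) (ac i)) (atlas_chart (hN i) (ac' i))
    (atlas_compat (hN i) (ac i) (ac' i)) (Dx i) (D'x i)).
Qed.

Lemma pi_maximal (c : forall i, chart R (N i)) : (forall i, atlas (c i)) ->
  maximal_atlas (pi_chart c : chart R P).
Proof. by move=> ac; apply: atlas_maximal pi_smooth_atlas _; exists c. Qed.

Lemma pi_has_dim (d : 'I_n -> nat) : (forall i, has_dim (N i) (d i)) ->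
  has_dim P (\sum_i d i).
Proof.
move=> hd _ [c ac <-] [x Dx] /=; apply: eq_bigr => i _.
by apply: hd => //; exists (x i).
Qed.

Lemma smooth_at_proj i (x : P) : smooth_at (fun y : P => y i) x.
Proof.
have [c hc] := pi_atlas_at x; have ac j : atlas (c j) by have [] := hc j.
have Dx j : chart_dom (c j) (x j) by have [] := hc j.
have mc := atlas_maximal (hN i) (ac i); have [[Do _ _ _] _] := mc.
exists (pi_chart c), (c i), (fun w => submxrow w i); split.
  exact (And5 (pi_maximal ac) mc Dx (Dx i) (smooth_near_submxrow i (smooth_near_id _))).
have h := near_continuous (@pi_proj_continuous n N i x)
  (near_open Do (Dx i) (fun _ h => h)).
by apply: filterS h => y Dy; split=> //=; rewrite mxrowK.
Qed.

Lemma smooth_at_tuple (Q : premanifold R) (F : Q -> P) x :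
  smooth_atlas Q -> (forall i, smooth_at (fun y => F y i) x) -> smooth_at F x.
Proof.
move=> hQ Fs; have [c0 ac0 D0x] := atlas_cover hQ x.
have mc0 := atlas_maximal hQ ac0.
have [c hc] := pi_atlas_at (F x); have ac j : atlas (c j) by have [] := hc j.
have Dx j : chart_dom (c j) (F x j) by have [] := hc j.
have h i := smooth_at_charts hQ (hN i) mc0 (atlas_maximal (hN i) (ac i)) D0x (Dx i) (Fs i).
pose f i := sval (cid (h i)).
have fs i : smooth_near (f i) (chart_map c0 x) := (svalP (cid (h i))).1.
have fE i := (svalP (cid (h i))).2.
exists c0, (pi_chart c), (fun w => \mxrow_i f i w); split.
  exact (And5 mc0 (pi_maximal ac) D0x Dx (smooth_near_mxrow fs)).
apply: filterS (@filter_forall _ _ _ _ (nbhs_filter x) fE) => y hy; split=> /=.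
  by move=> i; have [] := hy i.
by apply: eq_mxrow => i; have [] := hy i.
Qed.

End PiManifold.

Lemma pi_manifold (R : realType) n (N : 'I_n -> premanifold R) :
  (forall i, manifold (N i)) -> manifold (pi_space N).
Proof.
move=> mN; have hN i := manifold_smooth_atlas (mN i).
have [h1 h2 h3] := pi_smooth_atlas hN.
have hd i : exists d, has_dim (N i) d by have [_ _ _ _ _ hd] := mN i.
split=> //.
- by apply: (@pi_hausdorff n N) => i; have [] := mN i.
- by apply: (@pi_second_countable n N) => i; have [] := mN i.
- exists (\sum_i sval (cid (hd i)))%N; apply: pi_has_dim => i.
  exact: (svalP (cid (hd i))).
Qed.

Lemma diff_cstE (R : realType) (V W : normedModType R) (c : W) (x v : V) :
  'd (cst c) x v = 0.
Proof. by rewrite diff_cst. Qed.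

(** * Local sections of submersions *)

Section Sections.
Context {R : realType}.

Let he := @euclid_smooth_atlas R.

Definition local_section (N N' : premanifold R) (F : N -> N') (s : N' -> N) x :=
  [/\ smooth_at s (F x), s (F x) = x & \forall m \near F x, F (s m) = m].

Lemma surjective_right_inverse n m (D : 'M[R]_(n, m)) :
  (forall w : 'rV[R]_m, exists v : 'rV[R]_n, v *m D = w) -> exists Q, Q *m D = 1%:M.
Proof.
move=> h; pose v i := sval (cid (h (delta_mx ord0 i))).
exists (\matrix_i v i); apply/row_matrixP => i.
by rewrite row_mul rowK row1; exact: (svalP (cid (h _))).
Qed.

(** A right inverse [Q] of the differential defines the affine map [l] with l (f a) = a, along which
    [f] has the identity as differential. The inverse function theorem corrects [l] to a section. *)
Lemma local_section_euclid n m (f : 'rV[R]_n -> 'rV[R]_m) a :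
  smooth_near f a -> (forall w, exists v, 'd f a v = w) ->
  exists s, @local_section (euclid n) (euclid m) f s a.
Proof.
move=> fs fsurj; have [|Q QD] := @surjective_right_inverse _ _ (lin1_mx ('d f a)).
  by move=> w; have [v <-] := fsurj w; exists v; rewrite mul_rV_lin1.
pose l w := (a - f a *m Q) + w *m Q.
have lfa : l (f a) = a by rewrite /l subrK.
have ls w : smooth_near l w.
  apply: smooth_nearD; first exact: smooth_near_cst.
  by apply: smooth_near_mulmxr; exact: smooth_near_id.
have ld w : 'd l (f a) w = w *m Q.
  have di : differentiable (id : 'rV[R]_m -> 'rV[R]_m) (f a) by [].
  have [d1 e1] := diff_mulmxr Q di.
  have dc := differentiable_cst (a - f a *m Q) (f a : 'rV[R]_m).
  have e2 := etrans (congr1 (fun F => F w) e1) (congr1 (mulmx^~ Q) (diff_idE _ w)).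
  refine (etrans (diffDE w dc d1) (etrans (congr2 +%R (diff_cstE _ _ w) e2) _)).
  exact: add0r.
have fs' : smooth_near f (l (f a)) by rewrite lfa.
have fls : smooth_near (f \o l) (f a) by exact: smooth_near_comp.
have fld w : 'd (f \o l) (f a) w *m 1%:M = w.
  rewrite mulmx1 (diff_compE w (smooth_near_differentiable (ls _))
    (smooth_near_differentiable fs')) ld lfa.
  by rewrite -mul_rV_lin1 -mulmxA QD mulmx1.
have [g [_ gs K K']] := local_inverse erefl fls fld.
have flfa : (f \o l) (f a) = f a by rewrite /= lfa.
rewrite flfa in gs K'.
have gfa : g (f a) = f a by have := nbhs_singleton K; rewrite flfa.
exists (l \o g); split.
- apply: (smooth_at_comp (he m) (he m) (he n) gs).
  by apply/smooth_at_euclid; exact: ls.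
- by rewrite /= gfa lfa.
- exact: K'.
Qed.

Lemma submersion_section (N N' : premanifold R) (F : N -> N') :
  smooth_atlas N -> smooth_atlas N' -> submersion F ->
  forall x, exists s, local_section F s x.
Proof.
move=> hN hN' subF x.
have [c [c' [f [[mc mc' dd fE fs] Dx fsurj]]]] := subF x.
have [cc _] := mc; have [Do inj ct om] := cc.
have [cc' _] := mc'; have [D'o inj' ct' om'] := cc'.
have D'x := dd x Dx.
have fn : smooth_near f (chart_map c x).
  by exists (chart_map c @` chart_dom c); split=> //; exact: om.
have [s [ss sf fsK]] := local_section_euclid fn fsurj.
rewrite fE// in ss sf fsK.
have h1 := chart_invK cc x Dx.
have Dn := near_open Do Dx (fun _ h => h); rewrite -(chart_mapK cc x Dx) in Dn.
have h2 := near_continuous (chart_inv_continuous cc (x0 := x) Dx) Dn.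
rewrite -sf in h1 h2.
have sc := smooth_at_continuous ss.
have h1' := near_continuous (ct' _ D'x) (near_continuous sc h1).
have h2' := near_continuous (ct' _ D'x) (near_continuous sc h2).
have h3 := near_continuous (ct' _ D'x) fsK.
have h4 := near_open D'o D'x (fun _ h => h).
exists (fun m => chart_inv c x (s (chart_map c' m))); split.
- apply: (smooth_at_comp (F := s \o chart_map c') hN' (he _) hN); last first.
    by rewrite /= sf; exact: smooth_at_chart_inv.
  by apply: (smooth_at_comp hN' (he _) (he _) (smooth_at_chart hN' mc' D'x)).
- by rewrite sf chart_mapK.
- apply: filterS2 (filterI h1' h2') (filterI h3 h4) => m [e1 Ds] [e3 Dm].
  by apply: inj'; rewrite ?inE; [exact: dd|exact: Dm|rewrite -fE// e1].
Qed.

Lemma submersion_smooth_at (N N' : premanifold R) (F : N -> N') x :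
  submersion F -> smooth_at F x.
Proof.
move=> subF; have : smooth_map F; last by move/smooth_mapP.
by move=> y; have [c [c' [f [rep Dy _]]]] := subF y; exists c, c', f.
Qed.

End Sections.

(** * Transverse equalizers *)

Section Equalizer.
Context {R : realType} {N M : premanifold R} {r : nat} (u v : 'I_r -> N -> M).
Hypotheses (mN : manifold N) (mM : manifold M).
Hypotheses (us : forall i x, smooth_at (u i) x) (vs : forall i x, smooth_at (v i) x).

Let hN := manifold_smooth_atlas mN.
Let hM := manifold_smooth_atlas mM.
Let he := @euclid_smooth_atlas R.

(* Transversality of (u, v) to the diagonal, without tangent vectors: any
   smooth family tau of perturbations of the identity near u i x can be
   realised as the discrepancy between u and v along a smooth family s of
   points through x. *)
Definition transverse_at (x : N) :=
  forall (E : premanifold R) (e0 : E) (tau : 'I_r -> E -> M -> M),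
    smooth_atlas E ->
    (forall i (a : E -> M), smooth_at a e0 -> a e0 = u i x ->
       smooth_at (fun e => tau i e (a e)) e0) ->
    (forall i, tau i e0 (u i x) = u i x) ->
    exists s : E -> N, [/\ smooth_at s e0, s e0 = x &
      \forall e \near e0, forall i, u i (s e) = tau i e (v i (s e))].

(** Transversality is applied with all r discrepancies, read in charts, as the parameter. The
    resulting family [s] is a right inverse of the map [f] of coordinate differences, so
    [embedded_zero_set] applies. *)
Lemma embedded_equalizer :
  (forall x, (forall i, u i x = v i x) -> transverse_at x) ->
  embedded_submanifold [set x | forall i, u i x = v i x].
Proof.
move=> tr; have [_ _ _ _ _ [d hd]] := mN; have [_ _ _ _ _ [m hm]] := mM.
apply: (@embedded_zero_set R N _ d (\sum_(i < r) m)%N) => // x Ax.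
have ch i := has_dim_chart (u i x) hM hm.
pose psi i := sval (cid (ch i)).
pose psi' i := sval (cid (svalP (cid (ch i)))).
have D i : local_diffeo (psi i) (psi' i) (u i x) := svalP (cid (svalP (cid (ch i)))).
have sub0 i : submxrow (0 : 'rV[R]_(\sum_(i < r) m)) i = 0.
  by apply/rowP => j; rewrite !mxE.
pose E := @euclid R (\sum_(i < r) m)%N.
(* In the chart [psi i], the i-th perturbation is translation by the i-th block of the parameter. *)
pose tau i (w : E) z := psi' i (psi i z + submxrow (w : 'rV[R]_(\sum_(i < r) m)) i).
have taus i (a : E -> M) : smooth_at a 0 -> a 0 = u i x ->
    smooth_at (fun e => tau i e (a e)) (0 : 'rV[R]_(\sum_(i < r) m)).
  move=> sa a0; have [p1 p2 p3 p4] := D i.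
  have b1 : @smooth_at R E (@euclid R m) (psi i \o a) 0.
    by have p1' := p1; rewrite -a0 in p1'; exact (smooth_at_comp (he _) hM (he _) sa p1').
  have b2 : @smooth_at R E (@euclid R m)
      (fun e => psi i (a e) + submxrow (e : 'rV[R]_(\sum_(i < r) m)) i) 0.
    apply/smooth_at_euclid; apply: smooth_nearD; first exact/smooth_at_euclid.
    by apply: smooth_near_submxrow; exact: smooth_near_id.
  apply: (smooth_at_comp (he _) (he _) hM b2).
  by rewrite a0 sub0 addr0.
have tau0 i : tau i (0 : 'rV[R]_(\sum_(i < r) m)) (u i x) = u i x.
  by have [_ _ /nbhs_singleton K _] := D i; rewrite /tau sub0 addr0.
have [s [ss s0 sE]] := tr x Ax E (0 : 'rV[R]_(\sum_(i < r) m)) tau (he _) taus tau0.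
pose f y : 'rV[R]_(\sum_(i < r) m) := \mxrow_i (psi i (u i y) - psi i (v i y)).
have pus i : @smooth_at R N (@euclid R m) (fun y => psi i (u i y)) x.
  have [p1 _ _ _] := D i.
  exact: (smooth_at_comp hN hM (he _) (us i x) p1).
have pvs i : @smooth_at R N (@euclid R m) (fun y => psi i (v i y)) x.
  have [p1 _ _ _] := D i; rewrite Ax in p1.
  exact: (smooth_at_comp hN hM (he _) (vs i x) p1).
have fs : @smooth_at R N E f x.
  have [c ac Dx] := atlas_cover hN x; have mc := atlas_maximal hN ac.
  (* [smooth_near_mxrow] lives on row spaces, so [f] is first pulled back along a chart. *)
  pose g w := f (chart_inv c x w).
  have gs : @smooth_at R (@euclid R (chart_dim c)) E g (chart_map c x).
    have cs := smooth_at_chart_inv x hN mc Dx; have [cc _] := mc.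
    apply/smooth_at_euclid; apply: smooth_near_mxrow => i.
    apply: smooth_nearB; apply/smooth_at_euclid.
      have p := pus i; rewrite -(chart_mapK cc x Dx) in p.
      exact (smooth_at_comp (he _) hN (he m) cs p).
    have p := pvs i; rewrite -(chart_mapK cc x Dx) in p.
    exact (smooth_at_comp (he _) hN (he m) cs p).
  have [cc _] := mc; have [Do _ _ _] := cc.
  apply: smooth_at_eq (smooth_at_comp hN (he _) (he _) (smooth_at_chart hN mc Dx) gs).
  by apply: (near_open Do Dx) => y Dy; rewrite /= /g chart_mapK.
have fx : f x = 0.
  apply/rowP => j; rewrite !mxE.
  by rewrite Ax subrr.
exists f, s; rewrite fx; split=> //.
- have h i : \forall w \near (0 : 'rV[R]_(\sum_(i < r) m)),
      psi i (tau i w (v i (s w))) = psi i (v i (s w)) + submxrow (w : 'rV[R]_(\sum_(i < r) m)) i.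
    have [p1 p2 p3 p4] := D i; rewrite Ax in p1 p4.
    have c1 : @smooth_at R E (@euclid R m) (fun w => psi i (v i (s w))) 0.
      apply: (smooth_at_comp (F := s) (G := fun y => psi i (v i y)) (he _) hN (he _) ss).
      by rewrite s0; exact: pvs.
    have c2 : @smooth_at R E (@euclid R m)
        (fun w => psi i (v i (s w)) + submxrow (w : 'rV[R]_(\sum_(i < r) m)) i) 0.
      apply/smooth_at_euclid; apply: smooth_nearD; first exact/smooth_at_euclid.
      by apply: smooth_near_submxrow; exact: smooth_near_id.
    have e0 : psi i (v i x) = psi i (v i (s 0)) + submxrow (0 : 'rV[R]_(\sum_(i < r) m)) i.
      by rewrite s0 sub0 addr0.
    rewrite e0 in p4; exact (near_continuous (smooth_at_continuous c2) p4).
  apply: filterS2 sE (@filter_forall _ _ _ _ (nbhs_filter _) h) => w w1 w2.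
  rewrite /f -[RHS]submxrowK; apply: eq_mxrow => i.
  by rewrite w1 w2 addrAC subrr add0r.
- have h i : \forall y \near x, psi' i (psi i (u i y)) = u i y /\
      psi' i (psi i (v i y)) = v i y.
    have [_ _ K _] := D i; have K' := K; rewrite Ax in K'.
    exact: (filterI (near_continuous (smooth_at_continuous (us i x)) K)
                    (near_continuous (smooth_at_continuous (vs i x)) K')).
  apply: filterS (@filter_forall _ _ _ _ (nbhs_filter _) h) => y hy.
  split=> [Ay|fy i].
    apply/rowP => j; rewrite !mxE.
    by rewrite Ay subrr.
  have := congr1 (fun w => submxrow w i) fy; rewrite mxrowK sub0 => /subr0_eq e.
  by have [<- <-] := hy i; rewrite e.
Qed.

End Equalizer.

(** * Composable chains and matrices *)

Section LieGroupoid.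
Context {R : realType} {G M : premanifold R} {A : groupoid G M}.
Hypothesis lieA : lie_groupoid A.

Let hG : smooth_atlas G := manifold_smooth_atlas (lie_arr lieA).
Let hM : smooth_atlas M := manifold_smooth_atlas (lie_obj lieA).

Lemma smooth_at_src x : smooth_at (src A) x.
Proof. exact: submersion_smooth_at (lie_src lieA). Qed.

Lemma smooth_at_tgt x : smooth_at (tgt A) x.
Proof. exact: submersion_smooth_at (lie_tgt lieA). Qed.

(** Indexing the equations by the gaps between neighbours gives the family that [embedded_equalizer]
    expects. The target of the later arrow stands on the left, as it is the side to be solved
    for. *)
Lemma composable_ordP r (g : 'I_r.+1 -> G) :
  (forall i j : 'I_r.+1, j = i.+1 :> nat -> src A (g i) = tgt A (g j)) <->
  (forall i : 'I_r, tgt A (g (lift ord0 i)) = src A (g (widen_ord (leqnSn r) i))).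
Proof.
split=> [h i|h i j ji]; first by symmetry; apply: h.
have ir : (i < r)%N by rewrite -ltnS -ji ltn_ord.
have := h (Ordinal ir); rewrite (_ : lift ord0 _ = j); last by apply/val_inj.
by rewrite (_ : widen_ord _ _ = i)//; apply/val_inj.
Qed.

(* Local sections of the target map propagate a smooth deformation of the
   first arrow along a chain of arrows. *)
Lemma deform_chain r (x : 'I_r.+1 -> G) (E : premanifold R) (e0 : E) (a0 : E -> G)
    (T : 'I_r -> E -> M -> M) :
  smooth_atlas E -> smooth_at a0 e0 -> a0 e0 = x ord0 ->
  (forall i (a : E -> M), smooth_at a e0 -> a e0 = tgt A (x (lift ord0 i)) ->
     smooth_at (fun e => T i e (a e)) e0) ->
  (forall i, T i e0 (tgt A (x (lift ord0 i))) = tgt A (x (lift ord0 i))) ->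
  (forall i, tgt A (x (lift ord0 i)) = src A (x (widen_ord (leqnSn r) i))) ->
  exists s : E -> pi_space (fun _ : 'I_r.+1 => G),
    [/\ smooth_at s e0, s e0 = x, forall e, s e ord0 = a0 e &
      \forall e \near e0, forall i, tgt A (s e (lift ord0 i)) =
        T i e (src A (s e (widen_ord (leqnSn r) i)))].
Proof.
move=> hE a0s a0e Ts T0 xc.
have sec j := submersion_section hG hM (lie_tgt lieA) (x j).
pose sg j := sval (cid (sec j)).
have sgP j : local_section (tgt A) (sg j) (x j) := svalP (cid (sec j)).
(* The recursion runs over natural numbers; outside the range of [T] the identity is used, and only
   indices in range matter. *)
pose T' k e z := if insub k is Some i then T i e z else z.
pose c := fix c k e := if k is k'.+1 then sg (inord k) (T' k' e (src A (c k' e)))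
                      else a0 e.
have T'E (i : 'I_r) e z : T' i e z = T i e z by rewrite /T' valK.
have xl (i : 'I_r) : x (inord i.+1) = x (lift ord0 i).
  by congr x; apply/val_inj; rewrite /= inordK// ltnS ltn_ord.
have xw (i : 'I_r) : x (inord i) = x (widen_ord (leqnSn r) i).
  by congr x; apply/val_inj; rewrite /= inordK// ltnS ltnW.
have step (i : 'I_r) : smooth_at (c i) e0 -> c i e0 = x (inord i) ->
    smooth_at (fun e => T i e (src A (c i e))) e0 /\
    T i e0 (src A (c i e0)) = tgt A (x (lift ord0 i)).
  move=> cs ce; have se : src A (c i e0) = tgt A (x (lift ord0 i)).
    by rewrite ce xw xc.
  split; last by rewrite se T0.
  apply: (Ts i (fun e => src A (c i e))) => //.
  exact (smooth_at_comp hE hG hM cs (smooth_at_src _)).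
have cP k : (k <= r)%N -> smooth_at (c k) e0 /\ c k e0 = x (inord k).
  elim: k => [_|k IH kr]; first by rewrite -[inord 0](_ : ord0 = _)//; apply/val_inj; rewrite /= inordK.
  have [cs ce] := IH (ltnW kr).
  pose i := Ordinal kr; have [h1 h2] := step i cs ce.
  have [ss sE _] := sgP (inord k.+1); rewrite (xl i) -h2 in ss sE.
  have fe e : c k.+1 e = sg (inord k.+1) (T i e (src A (c k e))) by rewrite /= -T'E.
  split; last by rewrite fe sE -(xl i).
  rewrite (funext fe); exact (smooth_at_comp hE hM hG h1 ss).
exists (fun e j => c j e); split.
- apply: smooth_at_tuple => // j; have [] := cP j; first by rewrite -ltnS ltn_ord.
  by [].
- apply: functional_extensionality_dep => j.
  by have [|_ ->] := cP j; [rewrite -ltnS ltn_ord|rewrite inord_val].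
- by [].
- have h (i : 'I_r) : \forall e \near e0, tgt A (c (lift ord0 i) e) =
        T i e (src A (c (widen_ord (leqnSn r) i) e)).
    have [cs ce] := cP i (ltnW (ltn_ord i)); have [h1 h2] := step i cs ce.
    have [_ _ sK] := sgP (inord i.+1); rewrite (xl i) -h2 in sK.
    apply: filterS (near_continuous (smooth_at_continuous h1) sK) => e.
    by rewrite /= T'E.
  exact: (@filter_forall _ _ _ _ (nbhs_filter e0) h).
Qed.

Lemma composable_embedded r :
  embedded_submanifold [set g : pi_space (fun _ : 'I_r.+1 => G) |
    forall i j : 'I_r.+1, j = i.+1 :> nat -> src A (g i) = tgt A (g j)].
Proof.
pose u (i : 'I_r) (g : pi_space (fun _ : 'I_r.+1 => G)) := tgt A (g (lift ord0 i)).
pose v (i : 'I_r) (g : pi_space (fun _ : 'I_r.+1 => G)) :=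
  src A (g (widen_ord (leqnSn r) i)).
have -> : [set g : pi_space (fun _ : 'I_r.+1 => G) |
    forall i j : 'I_r.+1, j = i.+1 :> nat -> src A (g i) = tgt A (g j)] =
    [set g | forall i, u i g = v i g].
  by apply/seteqP; split=> g /composable_ordP.
have hP := @pi_smooth_atlas R _ (fun _ : 'I_r.+1 => G) (fun=> hG).
apply: embedded_equalizer.
- by apply: pi_manifold => _; exact: lie_arr lieA.
- exact: lie_obj lieA.
- move=> i x; exact (smooth_at_comp hP hG hM (smooth_at_proj (fun=> hG) _ x) (smooth_at_tgt _)).
- move=> i x; exact (smooth_at_comp hP hG hM (smooth_at_proj (fun=> hG) _ x) (smooth_at_src _)).
- move=> x Ax E e0 tau hE taus tau0.
  (* The first arrow stays fixed; all discrepancies are taken up by the later ones. *)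
  have [s [ss s0 _ sE]] := deform_chain hE (smooth_at_cst (x ord0) e0 hE hG) erefl
    taus tau0 Ax.
  by exists s.
Qed.

(** [lie_mul] is stated on pairs, whose encoding differs from that of composable tuples of length
    two. *)
Lemma composable_pairs_embedded :
  embedded_submanifold [set p : prod_space G G | src A p.1 = tgt A p.2].
Proof.
have -> : [set p : prod_space G G | src A p.1 = tgt A p.2] =
    [set p | forall i : 'I_1, tgt A p.2 = src A p.1].
  by apply/seteqP; split=> p /=; [move=> -> //|move=> /(_ ord0) ->].
have hP := prod_smooth_atlas hG hG.
apply: (@embedded_equalizer _ (prod_space G G) M 1 (fun _ p => tgt A p.2) (fun _ p => src A p.1)).
- by apply: prod_manifold; exact: lie_arr lieA.
- exact: lie_obj lieA.
- move=> _ x; exact (smooth_at_comp hP hG hM (smooth_at_snd hG hG x) (smooth_at_tgt _)).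
- move=> _ x; exact (smooth_at_comp hP hG hM (smooth_at_fst hG hG x) (smooth_at_src _)).
- move=> x Ax E e0 tau hE taus tau0.
  have [s [ss s0 sK]] := submersion_section hG hM (lie_tgt lieA) x.2.
  have h1 := taus ord0 (fun=> src A x.1) (smooth_at_cst _ e0 hE hM) (esym (Ax ord0)).
  have h2 : tau ord0 e0 (src A x.1) = tgt A x.2 by rewrite -(Ax ord0) tau0.
  rewrite -h2 in ss s0 sK.
  exists (fun e => (x.1, s (tau ord0 e (src A x.1)))); split.
  + apply: smooth_at_pair => //; first exact: smooth_at_cst.
    exact (smooth_at_comp hE hM hG h1 ss).
  + by rewrite s0; case: (x).
  + apply: filterS (near_continuous (smooth_at_continuous h1) sK) => e he i /=.
    by rewrite he (ord1 i).
Qed.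

(** The product is smooth only on the subspace of composable pairs, so the pair of factors is lifted
    there, with a default away from [e0]. *)
Lemma smooth_at_gmul (E : premanifold R) (a b : E -> G) e0 : smooth_atlas E ->
  smooth_at a e0 -> smooth_at b e0 ->
  (\forall e \near e0, src A (a e) = tgt A (b e)) ->
  smooth_at (fun e => gmul A (a e) (b e)) e0.
Proof.
move=> hE sa sb ab; have EP := composable_pairs_embedded.
pose S := [set p : prod_space G G | src A p.1 = tgt A p.2].
have hS : smooth_atlas (sub_space S) := embedded_smooth_atlas EP.
have ab0 : S (a e0, b e0) := nbhs_singleton ab.
pose p0 : sub_space S := exist _ (a e0, b e0) (mem_set ab0).
pose p e : sub_space S := insubd p0 (a e, b e).
have pE : \forall e \near e0, ((a e, b e) : prod_space G G) = val (p e).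
  by apply: filterS ab => e abe; rewrite /p insubdK//; exact: mem_set.
have ps : smooth_at p e0.
  exact (smooth_at_lift EP hE (smooth_at_eq pE (smooth_at_pair hG hG hE sa sb))).
have /smooth_mapP ms := lie_mul lieA.
have := smooth_at_comp hE hS hG ps (ms (p e0)).
by apply: smooth_at_eq; apply: filterS pE => e /= <-.
Qed.

Lemma smooth_at_ginv x : smooth_at (ginv A) x.
Proof. by move: x; apply/smooth_mapP; exact: lie_inv lieA. Qed.

(** The chain is deformed with its prescribed target as the parameter and no perturbation: the first
    arrow follows a section of the target map and the others follow it. This lets a whole column be
    attached to a moving point. *)
Lemma composable_tgt_section r (x : composable_space A r.+1) :
  exists s, local_section (fun k : composable_space A r.+1 => tgt A (val k ord0)) s x.
Proof.
have EC := composable_embedded r.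
pose S := [set g : pi_space (fun _ : 'I_r.+1 => G) |
    forall i j : 'I_r.+1, j = i.+1 :> nat -> src A (g i) = tgt A (g j)].
have xS : S (val x) by exact: set_mem (valP x).
have [s0 [ss0 s0x s0K]] := submersion_section hG hM (lie_tgt lieA) (val x ord0).
have xc := (composable_ordP (val x)).1 xS.
have [s [ss sx s1 sE]] := deform_chain (T := fun _ _ z => z) hM ss0 s0x
  (fun _ _ sa _ => sa) (fun _ => erefl) xc.
pose t z : composable_space A r.+1 := insubd x (s z).
have tE : \forall z \near tgt A (val x ord0), s z = val (t z).
  apply: filterS sE => z sz; rewrite /t insubdK//; apply: mem_set.
  by apply/composable_ordP => i; rewrite sz.
exists t; split.
- exact (smooth_at_lift EC hM (smooth_at_eq tE ss)).
- by apply: val_inj; rewrite -(nbhs_singleton tE) sx.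
- by apply: filterS2 tE s0K => z <-; rewrite s1.
Qed.

End LieGroupoid.

(** * The comma space and the space of matrices *)

Section CommaMatrix.
Context {R : realType} {K G M : premanifold R}.
Context {B : groupoid K M} {A : groupoid G M}.
Hypotheses (lieA : lie_groupoid A) (lieB : lie_groupoid B).

Let hG : smooth_atlas G := manifold_smooth_atlas (lie_arr lieA).
Let hK : smooth_atlas K := manifold_smooth_atlas (lie_arr lieB).
Let hM : smooth_atlas M := manifold_smooth_atlas (lie_obj lieA).

(** With the middle arrow fixed, the two outer arrows move independently along sections of the
    source map of K, one for each equation. *)
Lemma comma_embedded : embedded_submanifold (comma_set B A).
Proof.
pose N := prod_space (prod_space K G) K.
have hKG := prod_smooth_atlas hK hG; have hN := prod_smooth_atlas hKG hK.
pose u (i : 'I_2) (p : N) := if i == ord0 then src B p.1.1 else src B p.2.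
pose v (i : 'I_2) (p : N) := if i == ord0 then tgt A p.1.2 else src A p.1.2.
have -> : comma_set B A = [set p | forall i, u i p = v i p].
  apply/seteqP; split=> p /=; first by move=> [h1 h2] i; rewrite /u /v; case: eqP.
  by move=> h; split; [exact: (h ord0)|exact: (h ord_max)].
have f11 (x : N) : smooth_at (fun p : N => p.1.1) x.
  exact (smooth_at_comp hN hKG hK (smooth_at_fst hKG hK x) (smooth_at_fst hK hG _)).
have f12 (x : N) : smooth_at (fun p : N => p.1.2) x.
  exact (smooth_at_comp hN hKG hG (smooth_at_fst hKG hK x) (smooth_at_snd hK hG _)).
have f2 (x : N) : smooth_at (fun p : N => p.2) x by exact: smooth_at_snd.
apply: embedded_equalizer.
- apply: prod_manifold; last exact: lie_arr lieB.
  by apply: prod_manifold; [exact: lie_arr lieB|exact: lie_arr lieA].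
- exact: lie_obj lieA.
- move=> i x; rewrite /u; case: eqP => _.
    exact (smooth_at_comp hN hK hM (f11 x) (smooth_at_src lieB _)).
  exact (smooth_at_comp hN hK hM (f2 x) (smooth_at_src lieB _)).
- move=> i x; rewrite /v; case: eqP => _.
    exact (smooth_at_comp hN hG hM (f12 x) (smooth_at_tgt lieA _)).
  exact (smooth_at_comp hN hG hM (f12 x) (smooth_at_src lieA _)).
- move=> x Ax E e0 tau hE taus tau0.
  have [s [ss s0 sK]] := submersion_section hK hM (lie_src lieB) x.1.1.
  have [s' [ss' s'0 s'K]] := submersion_section hK hM (lie_src lieB) x.2.
  have c1 i := taus i (fun=> v i x) (smooth_at_cst _ e0 hE hM) (esym (Ax i)).
  have c2 i : tau i e0 (v i x) = u i x by rewrite -Ax tau0.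
  have t1 : tau ord0 e0 (tgt A x.1.2) = src B x.1.1 := c2 ord0.
  have t2 : tau ord_max e0 (src A x.1.2) = src B x.2 := c2 ord_max.
  have d1 : smooth_at (fun e => tau ord0 e (tgt A x.1.2)) e0 := c1 ord0.
  have d2 : smooth_at (fun e => tau ord_max e (src A x.1.2)) e0 := c1 ord_max.
  rewrite -t1 in ss s0 sK; rewrite -t2 in ss' s'0 s'K.
  exists (fun e => ((s (tau ord0 e (tgt A x.1.2)), x.1.2), s' (tau ord_max e (src A x.1.2)))).
  split.
  + apply: smooth_at_pair => //; last exact (smooth_at_comp hE hM hK d2 ss').
    apply: smooth_at_pair => //; last exact: smooth_at_cst.
    exact (smooth_at_comp hE hM hK d1 ss).
  + by rewrite s0 s'0; case: (x) => -[].
  + apply: filterS2 (near_continuous (smooth_at_continuous d1) sK)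
      (near_continuous (smooth_at_continuous d2) s'K) => e e1 e2 i.
    rewrite /u /v /=; case: eqP => [->|i0]; first exact: e1.
    rewrite (_ : i = ord_max); first exact: e2.
    by apply/val_inj; case: i i0 => -[|[|]] //= ? h; case: h; apply/val_inj.
Qed.

Definition column_space r := pi_space (fun j : 'I_r => composable_space B j.+1).

Lemma column_manifold r : manifold (column_space r).
Proof. by apply: pi_manifold => j; exact: embedded_manifold (composable_embedded lieB j). Qed.

Lemma row_manifold r : manifold (composable_space A r.+1).
Proof. exact: embedded_manifold (composable_embedded lieA r). Qed.

Lemma matrix_ambient_manifold r : manifold (matrix_ambient B A r.+1).
Proof. by apply: prod_manifold; [exact: row_manifold|exact: column_manifold]. Qed.

Lemma smooth_at_row_entry r (j : 'I_r.+1) (x : composable_space A r.+1) :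
  smooth_at (fun g : composable_space A r.+1 => val g j) x.
Proof.
have hP := @pi_smooth_atlas R _ (fun _ : 'I_r.+1 => G) (fun=> hG).
exact (smooth_at_comp (manifold_smooth_atlas (row_manifold r)) hP hG
  (smooth_at_val (composable_embedded lieA r) x) (smooth_at_proj (fun=> hG) j _)).
Qed.

Lemma smooth_at_column_entry r (j : 'I_r) (i : 'I_j.+1) (x : column_space r) :
  smooth_at (fun k : column_space r => val (k j) i) x.
Proof.
have hC (j' : 'I_r) : smooth_atlas (composable_space B (nat_of_ord j').+1).
  exact: embedded_smooth_atlas (composable_embedded lieB j').
have hP := @pi_smooth_atlas R _ (fun _ : 'I_j.+1 => K) (fun=> hK).
have h1 := smooth_at_comp (hC j) hP hK (smooth_at_val (composable_embedded lieB j) (x j))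
  (smooth_at_proj (fun=> hK) i _).
exact (smooth_at_comp (manifold_smooth_atlas (column_manifold r)) (hC j) hK
  (smooth_at_proj (fun j : 'I_r => hC j) j x) h1).
Qed.

(** The j-th equation is solved by moving the j-th column alone, the top row staying fixed. *)
Lemma matrix_embedded r : embedded_submanifold (matrix_set B A r.+1).
Proof.
pose N := matrix_ambient B A r.+1.
have mN : manifold N := matrix_ambient_manifold r; have hN := manifold_smooth_atlas mN.
have hR := manifold_smooth_atlas (row_manifold r).
have hC := manifold_smooth_atlas (column_manifold r.+1).
have hC1 (j : 'I_r.+1) : smooth_atlas (composable_space B j.+1).
  exact: embedded_smooth_atlas (composable_embedded lieB j).
apply: (@embedded_equalizer R N M r.+1 (fun j m => tgt B (val (m.2 j) ord0))
  (fun j m => src A (val m.1 j)) mN (lie_obj lieA)).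
- move=> j x.
  have h := smooth_at_comp hN hC hK (smooth_at_snd hR hC x) (smooth_at_column_entry ord0 _).
  exact (smooth_at_comp hN hK hM (h j) (smooth_at_tgt lieB _)).
- move=> j x.
  have h := smooth_at_comp hN hR hG (smooth_at_fst hR hC x) (smooth_at_row_entry j _).
  exact (smooth_at_comp hN hG hM h (smooth_at_src lieA _)).
- move=> x Ax E e0 tau hE taus tau0.
  have sec (j : 'I_r.+1) := composable_tgt_section lieB (x.2 j).
  pose s j := sval (cid (sec j)).
  have sP (j : 'I_r.+1) : local_section (fun k : composable_space B j.+1 => tgt B (val k ord0)) (s j) (x.2 j)
    := svalP (cid (sec j)).
  have d j := taus j (fun=> src A (val x.1 j)) (smooth_at_cst _ e0 hE hM) (esym (Ax j)).
  have t j : tau j e0 (src A (val x.1 j)) = tgt B (val (x.2 j) ord0) by rewrite -Ax tau0.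
  exists (fun e => (x.1, fun j => s j (tau j e (src A (val x.1 j))))); split.
  + apply: smooth_at_pair => //; first exact: smooth_at_cst.
    apply: smooth_at_tuple => // j; have [sj _ _] := sP j; rewrite -t in sj.
    exact (smooth_at_comp hE hM (hC1 j) (d j) sj).
  + have e2 : (fun j => s j (tau j e0 (src A (val x.1 j)))) = x.2.
      apply: functional_extensionality_dep => j; have [_ sj _] := sP j.
      by rewrite t.
    by rewrite e2; exact (esym (surjective_pairing x)).
  + have h j : \forall e \near e0, tgt B (val (s j (tau j e (src A (val x.1 j)))) ord0) =
        tau j e (src A (val x.1 j)).
      have [_ _ sj] := sP j; rewrite -t in sj.
      exact (near_continuous (smooth_at_continuous (d j)) sj).
    exact: (@filter_forall _ _ _ _ (nbhs_filter e0) h).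
Qed.

End CommaMatrix.

(** * The layers of the bar construction *)

Section Parametrization.
Context {R : realType} {P N Q : premanifold R} (S : set N).
Context (iota : P -> Q) (F : P -> N) (E : N -> Q).
Hypotheses (mP : manifold P) (mN : manifold N) (hQ : smooth_atlas Q).
Hypothesis retr : forall p : P, exists L : Q -> P, smooth_at L (iota p) /\
  \forall q \near iota p, forall p', iota p' = q -> L q = p'.
Hypotheses (Fs : forall p, smooth_at F p) (Es : forall w, smooth_at E w).
Hypotheses (EF : forall p, E (F p) = iota p) (SF : forall p, S (F p)).
Hypothesis Fsurj : forall w, S w -> exists p, F p = w.

(* E left inverts F up to iota, which is an embedding: composing with local
   retractions of iota yields the local retractions that embedded_image wants,
   and these also show that the inverse of F is smooth. *)
Lemma parametrized_submanifold : embedded_submanifold S /\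
  exists f : P -> sub_space S, diffeomorphism f /\ forall p, val (f p) = F p.
Proof.
have hP := manifold_smooth_atlas mP; have hN := manifold_smooth_atlas mN.
have [_ _ _ _ _ [p hp]] := mP; have [_ _ _ _ _ [d hd]] := mN.
have inv w : S w -> exists q (L : N -> P), [/\ F q = w, smooth_at L w &
    \forall y \near w, forall q', F q' = y -> L y = q'].
  move=> /Fsurj[q <-]; have [L [Ls Lq]] := retr q; exists q, (L \o E).
  rewrite -EF in Ls Lq; split=> //; first exact: (smooth_at_comp hN hQ hP).
  apply: filterS (near_continuous (smooth_at_continuous (Es _)) Lq) => y h q' Fq'.
  by apply: h; rewrite -Fq' EF.
have ES : embedded_submanifold S by exact: (embedded_image mN hd hP hp Fs SF inv).
have hS := embedded_smooth_atlas ES.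
split=> //; pose f p : sub_space S := exist _ (F p) (mem_set (SF p)).
exists f; split=> //; split.
  by apply/smooth_mapP => q; apply: (smooth_at_lift ES hP); exact: Fs.
have ex (w : sub_space S) : exists q, F q = val w by exact: Fsurj (set_mem (valP w)).
pose f' w := sval (cid (ex w)).
have f'P w : F (f' w) = val w := svalP (cid (ex w)).
have iinj : injective iota.
  move=> a b ab; have [L [_ La]] := retr a.
  have h := nbhs_singleton La.
  by rewrite -(h a erefl) (h b (esym ab)).
have Finj : injective F by move=> a b ab; apply: iinj; rewrite -!EF ab.
exists f'; split.
- apply/smooth_mapP => w; have [q [L [Fq Ls Lq]]] := inv _ (set_mem (valP w)).
  apply: smooth_at_eq (smooth_at_comp hS hN hP (smooth_at_val ES w) Ls).
  apply: filterS (near_continuous (@set_val_continuous _ S w) Lq) => y h /=.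
  by apply: h; rewrite f'P.
- by move=> q; apply: Finj; rewrite f'P.
- by move=> w; apply: val_inj; rewrite /= f'P.
Qed.

End Parametrization.

(** * Entries of a matrix and edges of its squares *)

Section MatrixEntries.
Context {R : realType} {K G M : premanifold R}.
Context {B : groupoid K M} {A : groupoid G M} (Phi : groupoid_morphism B A).
Hypotheses (lieA : lie_groupoid A) (lieB : lie_groupoid B).
Context {r : nat}.

Let hG : smooth_atlas G := manifold_smooth_atlas (lie_arr lieA).
Let hK : smooth_atlas K := manifold_smooth_atlas (lie_arr lieB).

Local Notation P := (sub_space (matrix_set B A r.+1)).

(** No equations are imposed, so edges read off from an arbitrary point of the ambient space of the
    layer form an element of it. *)
Definition free_matrices : premanifold R :=
  prod_space (pi_space (fun _ : 'I_r.+1 => G))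
             (pi_space (fun j : 'I_r.+1 => pi_space (fun _ : 'I_j.+1 => K))).

Definition matrix_entries (m : P) : free_matrices :=
  (val (val m).1, fun j => val ((val m).2 j)).

Let hP : smooth_atlas P := embedded_smooth_atlas (matrix_embedded lieA lieB r).

Lemma free_matrices_manifold : manifold free_matrices.
Proof.
apply: prod_manifold; first by apply: pi_manifold => _; exact: lie_arr lieA.
by apply: pi_manifold => j; apply: pi_manifold => _; exact: lie_arr lieB.
Qed.

(** Works in two stages: the row and each column are retracted onto composable tuples, then the
    result onto the matrices. *)
Lemma matrix_retraction (m : P) : exists L : free_matrices -> P,
  smooth_at L (matrix_entries m) /\
  \forall q \near matrix_entries m, forall m', matrix_entries m' = q -> L q = m'.
Proof.
have hPG := @pi_smooth_atlas R _ (fun _ : 'I_r.+1 => G) (fun=> hG).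
have hPK (j : 'I_r.+1) := @pi_smooth_atlas R _ (fun _ : 'I_j.+1 => K) (fun=> hK).
have hPPK := @pi_smooth_atlas R _ (fun j : 'I_r.+1 => pi_space (fun _ : 'I_j.+1 => K)) hPK.
have hQ := manifold_smooth_atlas free_matrices_manifold.
have hR := manifold_smooth_atlas (row_manifold lieA r).
have hC := manifold_smooth_atlas (column_manifold lieB r.+1).
have hC1 (j : 'I_r.+1) : smooth_atlas (composable_space B j.+1).
  exact: embedded_smooth_atlas (composable_embedded lieB j).
have hN := manifold_smooth_atlas (matrix_ambient_manifold lieA lieB r).
have [r0 [r0s r0P]] := embedded_retraction (composable_embedded lieA r) (val m).1.
have rc (j : 'I_r.+1) := embedded_retraction (composable_embedded lieB j) ((val m).2 j).
pose r1 j := sval (cid (rc j)).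
have r1s (j : 'I_r.+1) : smooth_at (r1 j) (val ((val m).2 j)) := (svalP (cid (rc j))).1.
have r1P (j : 'I_r.+1) : \forall y \near val ((val m).2 j),
    forall z : composable_space B j.+1, val z = y -> r1 j y = z := (svalP (cid (rc j))).2.
have [r2 [r2s r2P]] := embedded_retraction (matrix_embedded lieA lieB r) m.
pose q0 := matrix_entries m.
pose l (q : free_matrices) : matrix_ambient B A r.+1 := (r0 q.1, fun j => r1 j (q.2 j)).
have p1 : smooth_at (fun q : free_matrices => q.1) q0 by exact: smooth_at_fst.
have p2 : smooth_at (fun q : free_matrices => q.2) q0 by exact: smooth_at_snd.
have p2j (j : 'I_r.+1) : smooth_at (fun q : free_matrices => q.2 j) q0.
  exact (smooth_at_comp hQ hPPK (hPK j) p2 (smooth_at_proj hPK j _)).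
have lq : l q0 = val m.
  have e1 : r0 q0.1 = (val m).1 by exact (nbhs_singleton r0P _ erefl).
  have e2 : (fun j => r1 j (q0.2 j)) = (val m).2.
    by apply: functional_extensionality_dep => j; exact (nbhs_singleton (r1P j) _ erefl).
  by rewrite /l e1 e2; exact (esym (surjective_pairing _)).
have ls : smooth_at l q0.
  apply: (smooth_at_pair hR hC hQ); first exact (smooth_at_comp hQ hPG hR p1 r0s).
  apply: smooth_at_tuple => // j; exact (smooth_at_comp hQ (hPK j) (hC1 j) (p2j j) (r1s j)).
exists (r2 \o l); split.
  by rewrite -lq in r2s; exact (smooth_at_comp hQ hN hP ls r2s).
rewrite -lq in r2P.
have h0 := near_continuous (smooth_at_continuous p1) r0P.
have h1 (j : 'I_r.+1) := near_continuous (smooth_at_continuous (p2j j)) (r1P j).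
have h2 := near_continuous (smooth_at_continuous ls) r2P.
apply: filterS2 (filterI h0 h2) (@filter_forall _ _ _ _ (nbhs_filter q0) h1).
move=> q [e0 e2] e1 m' mq; apply: e2.
have x1 : r0 q.1 = (val m').1 by apply: e0; rewrite -mq.
have x2 : (fun j => r1 j (q.2 j)) = (val m').2.
  by apply: functional_extensionality_dep => j; apply: e1; rewrite -mq.
by rewrite /l x1 x2; exact (surjective_pairing _).
Qed.

Lemma matrix_entries_surj (q : free_matrices) :
  (forall i j : 'I_r.+1, j = i.+1 :> nat -> src A (q.1 i) = tgt A (q.1 j)) ->
  (forall (c : 'I_r.+1) (i j : 'I_c.+1), j = i.+1 :> nat ->
     src B (q.2 c i) = tgt B (q.2 c j)) ->
  (forall j, tgt B (q.2 j ord0) = src A (q.1 j)) ->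
  exists m, matrix_entries m = q.
Proof.
move=> h1 h2 h3.
pose x1 : composable_space A r.+1 := exist _ q.1 (mem_set (h1 : [set g : pi_space (fun _ : 'I_r.+1 => G) |
    forall i j : 'I_r.+1, j = i.+1 :> nat -> src A (g i) = tgt A (g j)] q.1)).
pose x2 (c : 'I_r.+1) : composable_space B c.+1 := exist _ (q.2 c)
  (mem_set (h2 c : [set g : pi_space (fun _ : 'I_c.+1 => K) |
    forall i j : 'I_c.+1, j = i.+1 :> nat -> src B (g i) = tgt B (g j)] (q.2 c))).
have h : matrix_set B A r.+1 (x1, x2) by move=> j; exact: h3.
by exists (exist _ (x1, x2) (mem_set h)); exact (esym (surjective_pairing q)).
Qed.

Variable m : P.
Local Notation g := (matrix_g (val m)).
Local Notation k := (matrix_k (val m)).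
Local Notation C := (column_prod Phi (val m)).

Lemma matrix_gE (j : 'I_r.+1) : g j = (matrix_entries m).1 j.
Proof. by rewrite /matrix_g inord_val. Qed.

Lemma matrix_kE (j : 'I_r.+1) (i : 'I_j.+1) : k i j = (matrix_entries m).2 j i.
Proof.
rewrite /matrix_k /=; have -> : inord j = j by rewrite inord_val.
by rewrite inord_val.
Qed.

Lemma matrix_g_comp j : (j < r)%N -> src A (g j) = tgt A (g j.+1).
Proof.
move=> jr; have h := set_mem (valP (val m).1); apply: h.
by rewrite /= !inordK// ltnW.
Qed.

Lemma matrix_k_comp i j : (i < j)%N -> (j <= r)%N -> src B (k i j) = tgt B (k i.+1 j).
Proof.
move=> ij jr; have h := set_mem (valP ((val m).2 (inord j))); apply: h.
have jE : (inord j : 'I_r.+1) = j :> nat by rewrite inordK.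
by rewrite /= !inordK ?jE// ltnS// ltnW.
Qed.

Lemma matrix_kg j : (j <= r)%N -> tgt B (k 0 j) = src A (g j).
Proof.
move=> jr; have h := set_mem (valP m); rewrite -(h (inord j)).
by congr (tgt B (val _ _)); apply/val_inj; rewrite /= inordK.
Qed.

Let Fs x : src A (Phi x) = src B x := functor_src (mor_functor Phi) x.
Let Ft x : tgt A (Phi x) = tgt B x := functor_tgt (mor_functor Phi) x.

Lemma column_prod0 j : C 0 j = gunit A (tgt B (k 0 j)).
Proof. by []. Qed.

Lemma column_prodS i j : C i.+1 j = gmul A (C i j) (Phi (k i j)).
Proof. by rewrite /column_prod -[in iota 0 i.+1]addn1 iotaD map_cat foldl_cat. Qed.

Lemma column_prod_ends i j : (i <= j)%N -> (j <= r)%N ->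
  tgt A (C i j) = tgt B (k 0 j) /\ src A (C i j) = tgt B (k i j).
Proof.
move=> + jr; elim: i => [|i IH] ij; first by rewrite column_prod0 tgt_unit src_unit.
have [h1 h2] := IH (ltnW ij); rewrite column_prodS.
by rewrite tgt_mul ?src_mul ?Ft// Fs h1 matrix_k_comp.
Qed.

Definition top_edge i j : G :=
  gmul A (gmul A (ginv A (C i j)) (g j.+1)) (C i j.+1).

(** Squares are stored by their bottom edge, whereas a matrix prescribes the top one; this solves
    [comma_top] for the bottom. *)
Definition bottom_edge i j : G :=
  gmul A (gmul A (ginv A (Phi (k i j))) (top_edge i j)) (Phi (k i j.+1)).

Section Edges.
Variables i j : nat.
Hypotheses (ij : (i <= j)%N) (jr : (j < r)%N).

Lemma top_edge_comp : src A (ginv A (C i j)) = tgt A (g j.+1) /\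
  src A (gmul A (ginv A (C i j)) (g j.+1)) = tgt A (C i j.+1).
Proof.
have [a1 a2] := column_prod_ends ij (ltnW jr).
have [b1 b2] := column_prod_ends (leqW ij) jr.
have e : src A (ginv A (C i j)) = tgt A (g j.+1).
  by rewrite src_inv a1 matrix_kg ?matrix_g_comp// ltnW.
by rewrite src_mul// b1 matrix_kg.
Qed.

Lemma top_edge_ends :
  tgt A (top_edge i j) = tgt B (k i j) /\ src A (top_edge i j) = tgt B (k i j.+1).
Proof.
have [a1 a2] := column_prod_ends ij (ltnW jr).
have [b1 b2] := column_prod_ends (leqW ij) jr.
have [e1 e2] := top_edge_comp.
by rewrite /top_edge tgt_mul// tgt_mul// tgt_inv src_mul.
Qed.

Lemma bottom_edge_comp :
  src A (ginv A (Phi (k i j))) = tgt A (top_edge i j) /\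
  src A (gmul A (ginv A (Phi (k i j))) (top_edge i j)) = tgt A (Phi (k i j.+1)).
Proof.
have [t1 t2] := top_edge_ends.
have e : src A (ginv A (Phi (k i j))) = tgt A (top_edge i j) by rewrite src_inv Ft.
by rewrite src_mul// Ft.
Qed.

Lemma bottom_edge_ends : src B (k i j) = tgt A (bottom_edge i j) /\
  src B (k i j.+1) = src A (bottom_edge i j).
Proof.
have [e1 e2] := bottom_edge_comp.
by rewrite /bottom_edge tgt_mul// tgt_mul// tgt_inv src_mul// !Fs.
Qed.

(** Conjugating by a column product and then by the next entry is conjugating by the product
    extended by that entry. *)
Lemma bottom_edge_top : (i < j)%N -> bottom_edge i j = top_edge i.+1 j.
Proof.
move=> lij; have [a1 a2] := column_prod_ends ij (ltnW jr).
have [b1 b2] := column_prod_ends (leqW ij) jr.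
have [e1 e2] := top_edge_comp; have [f1 f2] := bottom_edge_comp.
rewrite /bottom_edge /top_edge !column_prodS ginvM ?Ft//.
have i1 : src A (ginv A (Phi (k i j))) = tgt A (ginv A (C i j)).
  by rewrite src_inv tgt_inv Ft a2.
have c1 : src A (gmul A (ginv A (C i j)) (g j.+1)) = tgt A (C i j.+1) := e2.
have t1 : tgt A (gmul A (ginv A (C i j)) (g j.+1)) = tgt A (ginv A (C i j)).
  by rewrite tgt_mul.
have c2 : src A (C i j.+1) = tgt A (Phi (k i j.+1)) by rewrite b2 Ft.
rewrite [in LHS]gmulA ?t1// [in LHS]gmulA//.
have i2 : src A (gmul A (ginv A (Phi (k i j))) (ginv A (C i j))) = tgt A (g j.+1).
  by rewrite src_mul.
have c3 : src A (gmul A (gmul A (ginv A (Phi (k i j))) (ginv A (C i j))) (g j.+1)) =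
    tgt A (C i j.+1) by rewrite src_mul// -e2 src_mul.
by rewrite -gmulA.
Qed.

End Edges.

End MatrixEntries.

(** * Smooth dependence of the edges on the matrix *)

Section SmoothEntries.
Context {R : realType} {K G M : premanifold R}.
Context {B : groupoid K M} {A : groupoid G M} (Phi : groupoid_morphism B A).
Hypotheses (lieA : lie_groupoid A) (lieB : lie_groupoid B).
Hypothesis smooth_Phi : smooth_map (mor_fun Phi).
Context {r : nat}.

Let hG : smooth_atlas G := manifold_smooth_atlas (lie_arr lieA).
Let hK : smooth_atlas K := manifold_smooth_atlas (lie_arr lieB).
Let hM : smooth_atlas M := manifold_smooth_atlas (lie_obj lieA).

Local Notation P := (sub_space (matrix_set B A r.+1)).

Let hP : smooth_atlas P := embedded_smooth_atlas (matrix_embedded lieA lieB r).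

Lemma smooth_at_matrix_g j (x : P) : smooth_at (fun m : P => matrix_g (val m) j) x.
Proof.
have hN := manifold_smooth_atlas (matrix_ambient_manifold lieA lieB r).
have hR := manifold_smooth_atlas (row_manifold lieA r).
have hC := manifold_smooth_atlas (column_manifold lieB r.+1).
have h := smooth_at_comp hN hR hG (smooth_at_fst hR hC (val x))
  (smooth_at_row_entry lieA (inord j) _).
exact (smooth_at_comp hP hN hG (smooth_at_val (matrix_embedded lieA lieB r) x) h).
Qed.

Lemma smooth_at_matrix_k i j (x : P) : smooth_at (fun m : P => matrix_k (val m) i j) x.
Proof.
have hN := manifold_smooth_atlas (matrix_ambient_manifold lieA lieB r).
have hR := manifold_smooth_atlas (row_manifold lieA r).
have hC := manifold_smooth_atlas (column_manifold lieB r.+1).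
have h := smooth_at_comp hN hC hK (smooth_at_snd hR hC (val x))
  (smooth_at_column_entry lieB (inord i : 'I_(inord j : 'I_r.+1).+1) _).
exact (smooth_at_comp hP hN hK (smooth_at_val (matrix_embedded lieA lieB r) x) h).
Qed.

Lemma smooth_at_everywhere_mul (E : premanifold R) (a b : E -> G) (x : E) :
  smooth_atlas E -> smooth_at a x -> smooth_at b x ->
  (forall e, src A (a e) = tgt A (b e)) -> smooth_at (fun e => gmul A (a e) (b e)) x.
Proof.
move=> hE sa sb ab; apply: (smooth_at_gmul lieA hE sa sb).
exact: (near_open openT I (fun e _ => ab e)).
Qed.

Lemma smooth_at_Phi (E : premanifold R) (a : E -> K) (x : E) :
  smooth_atlas E -> smooth_at a x -> smooth_at (fun e => Phi (a e)) x.
Proof.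
move=> hE sa; have /smooth_mapP h := smooth_Phi.
exact (smooth_at_comp hE hK hG sa (h _)).
Qed.

Lemma smooth_at_column_prod i j (x : P) : (i <= j)%N -> (j <= r)%N ->
  smooth_at (fun m : P => column_prod Phi (val m) i j) x.
Proof.
move=> + jr; elim: i => [|i IH] ij.
  have h1 := smooth_at_comp hP hK hM (smooth_at_matrix_k 0 j x) (smooth_at_tgt lieB _).
  have /smooth_mapP h2 := lie_unit lieA.
  exact (smooth_at_comp hP hM hG h1 (h2 _)).
rewrite (_ : (fun m : P => _) = (fun m : P =>
  gmul A (column_prod Phi (val m) i j) (Phi (matrix_k (val m) i j)))); last first.
  by apply/funext => m; exact: column_prodS.
apply: smooth_at_everywhere_mul => //; first exact (IH (ltnW ij)).
  exact (smooth_at_Phi hP (smooth_at_matrix_k i j x)).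
move=> m; have [_ ->] := column_prod_ends Phi m (ltnW ij) jr.
by rewrite (functor_tgt (mor_functor Phi)).
Qed.

Lemma smooth_at_top_edge i j (x : P) : (i <= j)%N -> (j < r)%N ->
  smooth_at (fun m : P => top_edge Phi m i j) x.
Proof.
move=> ij jr.
have c1 := smooth_at_column_prod x ij (ltnW jr).
have c2 := smooth_at_column_prod x (leqW ij) jr.
have v := smooth_at_comp hP hG hG c1 (smooth_at_ginv lieA _).
have e m := top_edge_comp Phi m ij jr.
have p := smooth_at_everywhere_mul hP v (smooth_at_matrix_g j.+1 x) (fun m => (e m).1).
exact (smooth_at_everywhere_mul hP p c2 (fun m => (e m).2)).
Qed.

Lemma smooth_at_bottom_edge i j (x : P) : (i <= j)%N -> (j < r)%N ->
  smooth_at (fun m : P => bottom_edge Phi m i j) x.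
Proof.
move=> ij jr.
have c1 := smooth_at_Phi hP (smooth_at_matrix_k i j x).
have c2 := smooth_at_Phi hP (smooth_at_matrix_k i j.+1 x).
have v := smooth_at_comp hP hG hG c1 (smooth_at_ginv lieA _).
have e m := bottom_edge_comp Phi m ij jr.
have p := smooth_at_everywhere_mul hP v (smooth_at_top_edge x ij jr) (fun m => (e m).1).
exact (smooth_at_everywhere_mul hP p c2 (fun m => (e m).2)).
Qed.

End SmoothEntries.

(** * Smooth maps from and to the comma space *)

Section SmoothComma.
Context {R : realType} {K G M : premanifold R}.
Context {B : groupoid K M} {A : groupoid G M} (Phi : groupoid_morphism B A).
Hypotheses (lieA : lie_groupoid A) (lieB : lie_groupoid B).
Hypothesis smooth_Phi : smooth_map (mor_fun Phi).

Let hG : smooth_atlas G := manifold_smooth_atlas (lie_arr lieA).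
Let hK : smooth_atlas K := manifold_smooth_atlas (lie_arr lieB).
Local Notation Lam := (comma_space B A).
Let EL := comma_embedded lieA lieB.
Let hL : smooth_atlas Lam := embedded_smooth_atlas EL.

Lemma smooth_at_comma_entries (x : Lam) : [/\ smooth_at comma_left x,
  smooth_at comma_bottom x & smooth_at comma_right x].
Proof.
have hKG := prod_smooth_atlas hK hG; have hN := prod_smooth_atlas hKG hK.
have v := smooth_at_val EL x.
have v1 := smooth_at_comp hL hN hKG v (smooth_at_fst hKG hK _).
split.
- exact (smooth_at_comp hL hKG hK v1 (smooth_at_fst hK hG _)).
- exact (smooth_at_comp hL hKG hG v1 (smooth_at_snd hK hG _)).
- exact (smooth_at_comp hL hN hK v (smooth_at_snd hKG hK _)).
Qed.

Lemma smooth_at_comma_top (x : Lam) : smooth_at (comma_top Phi) x.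
Proof.
have [l b k] := smooth_at_comma_entries x.
have fl := smooth_at_Phi lieA lieB smooth_Phi hL l.
have fk := smooth_at_Phi lieA lieB smooth_Phi hL k.
have v := smooth_at_comp hL hG hG fk (smooth_at_ginv lieA _).
have p := smooth_at_everywhere_mul lieA hL fl b (comma_src_left Phi).
apply: (smooth_at_everywhere_mul lieA hL p v) => y /=.
by rewrite src_mul ?comma_src_left//; exact: comma_src_right.
Qed.

Lemma smooth_at_comma_square (E : premanifold R) (kt : E -> K) (g : E -> G) (ks : E -> K)
    (h : forall e, src B (kt e) = tgt A (g e) /\ src B (ks e) = src A (g e)) x :
  smooth_atlas E -> smooth_at kt x -> smooth_at g x -> smooth_at ks x ->
  smooth_at (fun e => comma_square (h e)) x.
Proof.
move=> hE s1 s2 s3; apply: (smooth_at_lift EL hE).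
have hKG := prod_smooth_atlas hK hG.
exact (smooth_at_pair hKG hK hE (smooth_at_pair hK hG hE s1 s2) s3).
Qed.

End SmoothComma.

(** Going from the top edge to the bottom edge and back; [gmul_conjK] is the opposite round trip. *)
Lemma gmulV_conjK (G M : Type) (A : groupoid G M) (a g b : G) :
  tgt A a = tgt A g -> src A g = tgt A b ->
  gmul A (gmul A a (gmul A (gmul A (ginv A a) g) b)) (ginv A b) = g.
Proof.
move=> ag gb; have e : src A (gmul A (ginv A a) g) = tgt A b.
  by rewrite src_mul// src_inv.
rewrite -[gmul A (gmul A (ginv A a) g) b]gmulA ?src_inv// gmulVKg ?tgt_mul//.
exact: gmulgK.
Qed.

Lemma gmul_conjK (G M : Type) (A : groupoid G M) (a g b : G) :
  src A a = tgt A g -> src A b = src A g ->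
  gmul A (gmul A (ginv A a) (gmul A (gmul A a g) (ginv A b))) b = g.
Proof.
move=> ag bg; have e : src A g = tgt A (ginv A b) by rewrite tgt_inv.
rewrite -[gmul A (gmul A a g) _]gmulA// gmulKg ?tgt_mul//.
exact: gmulgVK.
Qed.

(** * The layer r = 1, without squares *)

Section FirstLayer.
Context {R : realType} {K G M : premanifold R}.
Context {B : groupoid K M} {A : groupoid G M} (Phi : groupoid_morphism B A).
Hypotheses (lieA : lie_groupoid A) (lieB : lie_groupoid B).

Lemma first_bar_layer :
  embedded_submanifold (bar_set (comma_double_groupoid Phi) 1) /\
  exists F : sub_space (matrix_set B A 1) -> bar (comma_double_groupoid Phi) 1,
    diffeomorphism F /\ forall m, represents Phi (val m) (val (F m)).
Proof.
pose P := sub_space (matrix_set B A 1).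
have mG := lie_arr lieA; have mK := lie_arr lieB.
have hG := manifold_smooth_atlas mG; have hK := manifold_smooth_atlas mK.
have mP : manifold P := embedded_manifold (matrix_embedded lieA lieB 0).
have hP := manifold_smooth_atlas mP; have hN := prod_smooth_atlas hG hK.
have mQ := @free_matrices_manifold R K G M B A lieA lieB 0.
pose F (m : P) : prod_space G K := (matrix_g (val m) 0, matrix_k (val m) 0 0).
(* Constant arrays suffice, each index type having a single element. *)
pose E (w : prod_space G K) : @free_matrices R K G 0 := (fun=> w.1, fun _ _ => w.2).
have Fs m : smooth_at F m.
  exact (smooth_at_pair hG hK hP (smooth_at_matrix_g lieA lieB 0 m)
    (smooth_at_matrix_k lieA lieB 0 0 m)).
have Es w : smooth_at E w.
  have hPK (j : 'I_1) := @pi_smooth_atlas R _ (fun _ : 'I_j.+1 => K) (fun=> hK).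
  apply: (smooth_at_pair (pi_smooth_atlas (fun=> hG)) (pi_smooth_atlas hPK) hN).
    by apply: smooth_at_tuple => // _; exact: smooth_at_fst.
  by do 2![apply: smooth_at_tuple => // ?]; exact: smooth_at_snd.
have EF m : E (F m) = matrix_entries m.
  congr pair; apply: functional_extensionality_dep => j.
    by transitivity (matrix_g (val m) j); [rewrite [j]ord1|exact: matrix_gE].
  apply: functional_extensionality_dep => i.
  transitivity (matrix_k (val m) i j); last exact: matrix_kE.
  have -> : i = 0%N :> nat by case: i => i /=; rewrite [j]ord1 ltnS leqn0 => /eqP.
  by rewrite [j]ord1.
have SF m : bar_set (comma_double_groupoid Phi) 1 (F m).
  by rewrite /bar_set /= (matrix_kg m (leqnn 0)).
have Fsurj w : bar_set (comma_double_groupoid Phi) 1 w -> exists m, F m = w.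
  move=> wS; have [|||m mE] := @matrix_entries_surj R K G M B A 0 (E w).
  - by move=> i j; rewrite [j]ord1.
  (* Vacuous, the only column having a single entry. *)
  - by move=> c i j ji; have := leq_trans (leq_ord j) (leq_ord c); rewrite ji.
  - by move=> j; exact: esym wS.
  exists m; have g0 := matrix_gE m ord0; have k0 := @matrix_kE _ _ _ _ _ _ _ m ord0 ord0.
  by rewrite /F -[X in matrix_g _ X]/(nat_of_ord (@ord0 0)) g0 k0 mE -surjective_pairing.
have [ES [f [fd fE]]] := parametrized_submanifold mP (prod_manifold mG mK)
  (manifold_smooth_atlas mQ) (matrix_retraction lieA lieB) Fs Es EF SF Fsurj.
split=> //; exists f; split=> // m.
by have := fE m => /= ->.
Qed.

End FirstLayer.

(** * The layers r = n + 2 *)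

Section HigherLayers.
Context {R : realType} {K G M : premanifold R}.
Context {B : groupoid K M} {A : groupoid G M} (Phi : groupoid_morphism B A).
Hypotheses (lieA : lie_groupoid A) (lieB : lie_groupoid B).
Hypothesis smooth_Phi : smooth_map (mor_fun Phi).
Context {n : nat}.

Local Notation P := (sub_space (matrix_set B A n.+2)).
Local Notation Lam := (comma_space B A).
Local Notation N := (prod_space (prod_space G (triangle n.+1 Lam)) K).
Local Notation D := (comma_double_groupoid Phi).

Let Fs x : src A (Phi x) = src B x := functor_src (mor_functor Phi) x.
Let Ft x : tgt A (Phi x) = tgt B x := functor_tgt (mor_functor Phi) x.

Definition bar_square (w : N) (i j : nat) : Lam := w.1.2 (inord j) (inord i).

Local Notation sq := bar_square.
Local Notation L := comma_left.
Local Notation Rt := comma_right.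
Local Notation b := comma_bottom.
Local Notation tp := (comma_top Phi).

Definition matrix_bar (m : P) : N :=
  ((matrix_g (val m) 0,
    fun (j : 'I_n.+1) (i : 'I_j.+1) =>
      comma_square (bottom_edge_ends Phi m (leq_ord i) (ltn_ord j))),
   matrix_k (val m) n.+1 n.+1).

(* Row and columns of the matrix of w: each entry k_(i,j) is read off as a left
   edge, except those of the last column, which are right edges. *)
Definition bar_row (w : N) (j : nat) : G :=
  if j is j'.+1 then tp (sq w 0 j') else w.1.1.

Definition bar_column (w : N) (i j : nat) : K :=
  if (j <= n)%N then L (sq w i j)
  else if (i <= n)%N then Rt (sq w i n) else w.2.

Definition bar_entries (w : N) : @free_matrices R K G n.+1 :=
  (fun j : 'I_n.+2 => bar_row w j, fun (j : 'I_n.+2) (i : 'I_j.+1) => bar_column w i j).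

Section FromMatrix.
Variable m : P.
Local Notation g := (matrix_g (val m)).
Local Notation k := (matrix_k (val m)).

Lemma top_edge0 j : (j <= n)%N -> top_edge Phi m 0 j = g j.+1.
Proof.
move=> jn; rewrite /top_edge !column_prod0 ginv_unit.
rewrite (matrix_kg m (ltnW (jn : j < n.+1)%N)) (matrix_g_comp m (jn : j < n.+1)%N) gmul1g.
by rewrite (matrix_kg m (jn : j.+1 <= n.+1)%N) gmulg1.
Qed.

Lemma square_matrix_bar i j : (i <= j)%N -> (j <= n)%N ->
  [/\ L (sq (matrix_bar m) i j) = k i j,
      b (sq (matrix_bar m) i j) = bottom_edge Phi m i j,
      Rt (sq (matrix_bar m) i j) = k i j.+1 &
      tp (sq (matrix_bar m) i j) = top_edge Phi m i j].
Proof.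
(* The type of the row index depends on the column index, so [inord] is resolved for the column
   first. *)
move=> ij jn; have eJ : (inord j : 'I_n.+1) = j :> nat by rewrite inordK.
have eI : (inord i : 'I_(inord j : 'I_n.+1).+1) = i :> nat by rewrite inordK// eJ.
have h1 : L (sq (matrix_bar m) i j) = k i j by rewrite /sq /L /= eI eJ.
have h2 : b (sq (matrix_bar m) i j) = bottom_edge Phi m i j by rewrite /sq /b /= eI eJ.
have h3 : Rt (sq (matrix_bar m) i j) = k i j.+1 by rewrite /sq /Rt /= eI eJ.
split=> //; rewrite /comma_top h1 h2 h3.
have [t1 t2] := top_edge_ends Phi m ij (jn : j < n.+1)%N.
by apply: gmulV_conjK; rewrite Ft.
Qed.

Lemma bar_column_matrix i j : (i <= j)%N -> (j <= n.+1)%N ->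
  bar_column (matrix_bar m) i j = k i j.
Proof.
move=> ij jn; rewrite /bar_column; case: ifP => [jn'|/negbT].
  by have [-> _ _ _] := square_matrix_bar ij jn'.
rewrite -ltnNge => nj; have jE : j = n.+1 by apply/eqP; rewrite eqn_leq jn.
rewrite {}jE in ij jn nj *; case: ifP => [ni|/negbT].
  by have [_ _ -> _] := square_matrix_bar ni (leqnn n).
rewrite -ltnNge => ni; have -> : i = n.+1 by apply/eqP; rewrite eqn_leq ij.
by [].
Qed.

Lemma bar_entries_matrix : bar_entries (matrix_bar m) = matrix_entries m.
Proof.
congr pair; apply: functional_extensionality_dep => j.
  transitivity (g j); last exact: matrix_gE.
  case: j => -[|j] // jn; rewrite /bar_row /=.
  by have [_ _ _ ->] := @square_matrix_bar 0 j (leq0n _) jn; exact: top_edge0.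
apply: functional_extensionality_dep => i.
transitivity (k i j); last exact: matrix_kE.
exact: bar_column_matrix (leq_ord i) (leq_ord j).
Qed.

Lemma matrix_bar_in : bar_set D n.+2 (matrix_bar m).
Proof.
split.
- have [_ _ _ e] := @square_matrix_bar 0 0 (leqnn 0) (leq0n n).
  have [t1 _] := top_edge_ends Phi m (leqnn 0) (ltn0Sn n).
  transitivity (tgt A (tp (sq (matrix_bar m) 0 0))); last by [].
  by rewrite e t1 (matrix_kg m (leq0n _)).
- move=> i j ij jn.
  have [_ _ e _] := square_matrix_bar ij (ltnW jn).
  have [e' _ _ _] := square_matrix_bar (leqW ij) jn.
  exact (etrans e (esym e')).
- move=> i j ij jn.
  have [_ e _ _] := square_matrix_bar (ltnW ij) jn.
  have [_ _ _ e'] := square_matrix_bar ij jn.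
  have e2 := bottom_edge_top Phi m (ltnW ij) (jn : j < n.+1)%N ij.
  exact (etrans e (etrans e2 (esym e'))).
- have [_ _ e _] := square_matrix_bar (leqnn n) (leqnn n).
  transitivity (src B (Rt (sq (matrix_bar m) n n))); last by [].
  by rewrite e (matrix_k_comp m (leqnn _)).
Qed.

End FromMatrix.

Lemma matrix_bar_represents (m : P) : represents Phi (val m) (matrix_bar m).
Proof.
split=> // i j ij jn.
by have [e1 _ e2 e3] := square_matrix_bar m ij jn; split.
Qed.

Section FromBar.
Variable w : N.
Hypothesis wS : bar_set D n.+2 w.
Local Notation g := (bar_row w).
Local Notation k := (bar_column w).

Lemma bar_first : src A w.1.1 = tgt A (tp (sq w 0 0)).
Proof. by case: wS. Qed.

Lemma bar_right i j : (i <= j)%N -> (j < n)%N -> Rt (sq w i j) = L (sq w i j.+1).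
Proof. by case: wS => _ h _ _; exact: h. Qed.

Lemma bar_below i j : (i < j)%N -> (j <= n)%N -> b (sq w i j) = tp (sq w i.+1 j).
Proof. by case: wS => _ _ h _; exact: h. Qed.

Lemma bar_last : tgt B w.2 = src B (Rt (sq w n n)).
Proof. by case: wS. Qed.

Lemma bar_column_left i j : (j <= n)%N -> k i j = L (sq w i j).
Proof. by rewrite /bar_column => ->. Qed.

Lemma bar_column_right i j : (i <= j)%N -> (j <= n)%N -> k i j.+1 = Rt (sq w i j).
Proof.
move=> ij jn; rewrite /bar_column; case: (ltnP j n) => jn'; first by rewrite bar_right.
have -> : j = n by apply/eqP; rewrite eqn_leq jn.
by rewrite (leq_trans ij jn).
Qed.

Lemma bar_column_last : k n.+1 n.+1 = w.2.
Proof. by rewrite /bar_column ltnn. Qed.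

Lemma bar_row_comp j : (j <= n)%N -> src A (g j) = tgt A (g j.+1).
Proof.
case: j => [|j] jn /=; first exact: bar_first.
by rewrite comma_src_top comma_tgt_top bar_right.
Qed.

Lemma bar_column_row j : (j <= n.+1)%N -> tgt B (k 0 j) = src A (g j).
Proof.
case: j => [|j] jn /=; first by rewrite bar_column_left// bar_first comma_tgt_top.
by rewrite bar_column_right// comma_src_top.
Qed.

(** Off the diagonal both entries are right edges of vertically adjacent squares. At the diagonal
    the lower entry is instead the left edge of a diagonal square, or [w.2] in the last column. *)
Lemma bar_column_comp i j : (i < j)%N -> (j <= n.+1)%N -> src B (k i j) = tgt B (k i.+1 j).
Proof.
case: j => // j ij jn; rewrite bar_column_right//.
move: ij; rewrite ltnS leq_eqVlt => /orP[/eqP ij|ij].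
  rewrite {}ij in jn *; move: jn; rewrite ltnS leq_eqVlt => /orP[/eqP->|jn].
    by rewrite bar_column_last bar_last.
  by rewrite bar_right// bar_column_left// comma_srcL bar_below// comma_tgt_top.
by rewrite bar_column_right// comma_srcR bar_below// comma_src_top.
Qed.

(** The entries read off from [w] form a matrix. Its squares agree with those of [w] by induction
    down each column: the top edges agree in the first row, and the bottom edge of a square is the
    top edge of the next one on both sides. *)
Lemma bar_matrix : exists m, matrix_bar m = w.
Proof.
have [|||m mE] := @matrix_entries_surj R K G M B A n.+1 (bar_entries w).
- by move=> i j ji; rewrite /= ji; apply: bar_row_comp; rewrite -ltnS -ji leq_ord.
- move=> c i j ji; rewrite /= ji; apply: bar_column_comp; last exact: leq_ord.
  by rewrite -ji leq_ord.
- by move=> j; exact: bar_column_row (leq_ord j).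
have gE j : (j <= n.+1)%N -> matrix_g (val m) j = g j.
  by move=> jn; have := matrix_gE m (inord j); rewrite mE /= inordK.
have kE i j : (i <= j)%N -> (j <= n.+1)%N -> matrix_k (val m) i j = k i j.
  move=> ij jn; have eJ : (inord j : 'I_n.+2) = j :> nat by rewrite inordK.
  have eI : (inord i : 'I_(inord j : 'I_n.+2).+1) = i :> nat by rewrite inordK// eJ.
  by have := @matrix_kE _ _ _ _ _ _ _ m (inord j) (inord i); rewrite mE /= eI eJ.
have edges j : (j <= n)%N -> forall i, (i <= j)%N ->
    top_edge Phi m i j = tp (sq w i j) /\ bottom_edge Phi m i j = b (sq w i j).
  move=> jn; have bE i : (i <= j)%N -> top_edge Phi m i j = tp (sq w i j) ->
      bottom_edge Phi m i j = b (sq w i j).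
    move=> ij e; rewrite /bottom_edge e !kE ?(leqW ij)// ?(leqW jn)//.
    rewrite bar_column_left// bar_column_right//.
    by apply: gmul_conjK; rewrite Fs ?comma_srcL ?comma_srcR.
  elim=> [|i IH] ij; last have [_ e] := IH (ltnW ij).
    have e : top_edge Phi m 0 j = tp (sq w 0 j) by rewrite top_edge0// gE.
    by split=> //; exact: bE.
  have e' : top_edge Phi m i.+1 j = tp (sq w i.+1 j).
    by rewrite -bar_below// -e; exact (esym (bottom_edge_top Phi m (ltnW ij) jn ij)).
  by split=> //; exact: bE.
exists m; rewrite [w]surjective_pairing [w.1]surjective_pairing /matrix_bar.
congr ((_, _), _); first exact: gE.
  apply: functional_extensionality_dep => j; apply: functional_extensionality_dep => i.
  have sqE : w.1.2 j i = sq w i j by rewrite /sq !inord_val.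
  have ij := leq_ord i; have jn := leq_ord j; have [_ e] := edges _ jn _ ij.
  rewrite sqE; apply: commaP => //.
  - by rewrite -bar_column_left//; exact: kE (leqW jn).
  - by rewrite -bar_column_right//; exact: kE (leqW ij) jn.
by rewrite kE// bar_column_last.
Qed.

End FromBar.

Let hG : smooth_atlas G := manifold_smooth_atlas (lie_arr lieA).
Let hK : smooth_atlas K := manifold_smooth_atlas (lie_arr lieB).
Let mL : manifold Lam := embedded_manifold (comma_embedded lieA lieB).
Let hL := manifold_smooth_atlas mL.
Let mT : manifold (triangle n.+1 Lam).
Proof. by do 2!apply: pi_manifold => ?. Qed.
Let hT := manifold_smooth_atlas mT.
Let mN : manifold N := prod_manifold (prod_manifold (lie_arr lieA) mT) (lie_arr lieB).
Let hN := manifold_smooth_atlas mN.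
Let mP : manifold P := embedded_manifold (matrix_embedded lieA lieB n.+1).
Let hP := manifold_smooth_atlas mP.

Lemma smooth_at_matrix_bar m : smooth_at matrix_bar m.
Proof.
have hGT := prod_smooth_atlas hG hT.
have hC (j : 'I_n.+1) := @pi_smooth_atlas R _ (fun _ : 'I_j.+1 => Lam) (fun=> hL).
have st : smooth_at (fun m : P => (fun (j : 'I_n.+1) (i : 'I_j.+1) =>
    comma_square (bottom_edge_ends Phi m (leq_ord i) (ltn_ord j))) : triangle n.+1 Lam) m.
  apply: (smooth_at_tuple hC hP) => j; apply: (smooth_at_tuple (fun=> hL) hP) => i.
  have s1 := smooth_at_matrix_k lieA lieB i j m.
  have s2 := smooth_at_bottom_edge lieA lieB smooth_Phi m (leq_ord i) (ltn_ord j).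
  have s3 := smooth_at_matrix_k lieA lieB i j.+1 m.
  exact (smooth_at_comma_square lieA lieB _ hP s1 s2 s3).
exact (smooth_at_pair hGT hK hP
  (smooth_at_pair hG hT hP (smooth_at_matrix_g lieA lieB 0 m) st)
  (smooth_at_matrix_k lieA lieB n.+1 n.+1 m)).
Qed.

Lemma smooth_at_bar_square i j (w : N) : smooth_at (fun w : N => sq w i j) w.
Proof.
have hGT := prod_smooth_atlas hG hT.
have hC (j : 'I_n.+1) := @pi_smooth_atlas R _ (fun _ : 'I_j.+1 => Lam) (fun=> hL).
have s1 := smooth_at_comp hN hGT hT (smooth_at_fst hGT hK w) (smooth_at_snd hG hT _).
have s2 := smooth_at_comp hN hT (hC (inord j)) s1 (smooth_at_proj hC (inord j) _).
exact (smooth_at_comp hN (hC (inord j)) hL s2 (smooth_at_proj (fun=> hL) (inord i) _)).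
Qed.

Lemma smooth_at_bar_entries w : smooth_at bar_entries w.
Proof.
have hGT := prod_smooth_atlas hG hT.
have hPK (j : 'I_n.+2) := @pi_smooth_atlas R _ (fun _ : 'I_j.+1 => K) (fun=> hK).
apply: (smooth_at_pair (pi_smooth_atlas (fun=> hG)) (pi_smooth_atlas hPK) hN).
  apply: (smooth_at_tuple (fun=> hG) hN) => -[[|j] jn].
    exact (smooth_at_comp hN hGT hG (smooth_at_fst hGT hK w) (smooth_at_fst hG hT _)).
  exact (smooth_at_comp hN hL hG (smooth_at_bar_square 0 j w)
    (smooth_at_comma_top lieA lieB smooth_Phi _)).
apply: (smooth_at_tuple hPK hN) => j; apply: (smooth_at_tuple (fun=> hK) hN) => i.
rewrite /= /bar_column; case: (j <= n)%N; last case: (i <= n)%N.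
- have [s _ _] := smooth_at_comma_entries lieA lieB (sq w i j).
  exact (smooth_at_comp hN hL hK (smooth_at_bar_square i j w) s).
- have [_ _ s] := smooth_at_comma_entries lieA lieB (sq w i n).
  exact (smooth_at_comp hN hL hK (smooth_at_bar_square i n w) s).
- exact: smooth_at_snd.
Qed.

Lemma higher_bar_layer :
  embedded_submanifold (bar_set D n.+2) /\
  exists F : P -> bar D n.+2, diffeomorphism F /\
    forall m, represents Phi (val m) (val (F m)).
Proof.
have [ES [f [fd fE]]] := parametrized_submanifold mP mN
  (manifold_smooth_atlas (free_matrices_manifold lieA lieB))
  (matrix_retraction lieA lieB) smooth_at_matrix_bar smooth_at_bar_entries
  bar_entries_matrix matrix_bar_in bar_matrix.
split=> //; exists f; split=> // m; have := fE m => /= ->.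
exact: matrix_bar_represents.
Qed.

End HigherLayers.

Theorem proposition3p1 (R : realType) (M G K : premanifold R)
    (A : groupoid G M) (B : groupoid K M) (Phi : groupoid_morphism B A)
    (lieA : lie_groupoid A) (lieB : lie_groupoid B)
    (smooth_Phi : smooth_map (mor_fun Phi)) (r : nat) :
  [/\ embedded_submanifold (matrix_set B A r.+1),
      embedded_submanifold (bar_set (comma_double_groupoid Phi) r.+1) &
      exists F : sub_space (matrix_set B A r.+1) ->
                 bar (comma_double_groupoid Phi) r.+1,
        diffeomorphism F /\
        forall m : sub_space (matrix_set B A r.+1),
          represents Phi (val m) (val (F m))].
Proof.
have h : embedded_submanifold (bar_set (comma_double_groupoid Phi) r.+1) /\
    exists F : sub_space (matrix_set B A r.+1) ->
               bar (comma_double_groupoid Phi) r.+1,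
      diffeomorphism F /\ forall m, represents Phi (val m) (val (F m)).
  (* [bar_ambient] and [represents] are defined by cases and reduce only after the split. *)
  by case: r => [|n]; [exact: first_bar_layer|exact: higher_bar_layer].
by split; [exact: matrix_embedded|exact: h.1|exact: h.2].
Qed.
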